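(* Let $\mathcal R:(\mathcal U,0)\to(\mathcal B,0)$ be a compact analytic operator on a neighborhood $\mathcal U$ of $0$ in a complex Banach space $\mathcal B$. If the differential $D\mathcal R_0:\mathcal B\to\mathcal B$ has a neutral eigenvalue, then $\mathcal R$ has slow small orbits: for any neighborhood $\mathcal V$ of $0$, there is a forward orbit $\{\mathcal R^ng\}_{n\in\mathbb N}$ in $\mathcal V$ such that $$\lim_{n\to\infty}\frac1n\log\|\mathcal R^ng\|=0.$$
   Context: An eigenvalue $\lambda$ of a linear operator is neutral if $|\lambda|=1$. The notation $\mathcal R:(\mathcal U,0)\to(\mathcal B,0)$ means $\mathcal R:\mathcal U\to\mathcal B$ with $\mathcal R(0)=0$. *)

(* Defs.v *)
From mathcomp Require Import all_boot all_order all_algebra.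
From mathcomp Require Export complex.
From mathcomp Require Import all_classical all_reals all_analysis.

Set Implicit Arguments.
Unset Strict Implicit.
Unset Printing Implicit Defensive.

Import Order.TTheory GRing.Theory Num.Theory.
Import numFieldNormedType.Exports.

Local Open Scope classical_set_scope.
Local Open Scope ring_scope.

Section AnalyticMaps.
Context {K : numFieldType} {V W : normedModType K}.

Definition multilinear (k : nat) (L : ('I_k -> V) -> W) : Prop :=
  forall (i : 'I_k) (v : 'I_k -> V), linear (fun x => L [eta v with i |-> x]).

(* Continuity of [P] is equivalent to continuity of the symmetric [L] given by
   polarization, so these are the continuous [k]-homogeneous polynomials in the
   usual sense. *)
Definition homogeneous_polynomial (k : nat) (P : V -> W) : Prop :=
  continuous P /\
  exists2 L : ('I_k -> V) -> W,
    multilinear L & forall x, P x = L (fun=> x).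

Definition analytic_on (U : set V) (F : V -> W) : Prop :=
  forall a, U a ->
  exists2 r : K, 0 < r /\ ball a r `<=` U &
  exists2 P : nat -> V -> W,
    forall k, homogeneous_polynomial k (P k) &
    {uniform ball a r, (fun n x => \sum_(k < n) P k (x - a)) @ \oo --> F}.

(* The continuity required of a nonlinear compact operator is not repeated: it
   is only used together with [analytic_on U F]. *)
Definition compact_operator_on (U : set V) (F : V -> W) : Prop :=
  forall A : set V, A `<=` U -> bounded_set A -> precompact (F @` A).

End AnalyticMaps.

Definition eigenvalue_of {K : numFieldType} {V : normedModType K}
    (T : V -> V) (lambda : K) : Prop :=
  exists2 v : V, v != 0 & T v = lambda *: v.

Definition neutral {K : numFieldType} (lambda : K) : Prop := `|lambda| = 1.

(* The norm of a normed module over [R[i]] takes its (real) values in [R[i]]. *)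
Definition rnorm {R : realType} {V : normedModType R[i]} (x : V) : R :=
  complex.Re `|x|.

(* A map on [U] is a total function whose values outside [U] are irrelevant, so
   for the orbit of [g] to be defined all its points must lie in [U].  Since
   [ln 0 = 0] in the library, whereas a zero term of the orbit would make the
   limit [-oo], the terms must also be required to be nonzero. *)
Definition slow_small_orbits {R : realType} {V : normedModType R[i]}
    (U : set V) (F : V -> V) : Prop :=
  forall N : set V, nbhs (0 : V) N ->
  exists g : V,
    [/\ forall n, (U `&` N) (iter n F g),
        forall n, iter n F g != 0 &
        (fun n : nat => n%:R^-1 * ln (rnorm (iter n F g))) @ \oo --> (0 : R)].

(* Main.v *)
(* Split the compact operator T = DF(0) by the Riesz projection of a circle just
   inside the unit circle into a contracting part and a part E whose inverse
   grows subexponentially, and let C be the cone around E.  In C the map F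
   expands almost isometrically or better, so an orbit that stays in a small
   ball, and starts in C, decays subexponentially; it remains to find one.

   If there were none, then by compactness there would be an N such that every
   orbit segment of length N in the ball, starting in C, starts in the
   concentric ball of half radius.  Consider holomorphic discs of orbit segments
   z_0, ..., z_M that start in E, with tangent vector t v at z_M, where v is the
   neutral eigenvector.  Dropping the last N points of such a disc preserves |t|,
   as the eigenvalue is neutral, and leaves enough room to increase |t| by a
   constant s independent of M.  So |t| can be made arbitrarily large,
   contradicting Cauchy's estimate. *)
From HB Require Import structures.
Require Import Defs.
From mathcomp Require Import all_boot all_order all_algebra.
From mathcomp Require Import all_classical all_reals all_analysis.
From mathcomp Require Import ring lra zify.
Import Order.TTheory GRing.Theory Num.Theory.
Import numFieldNormedType.Exports.
Local Open Scope classical_set_scope.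
Local Open Scope ring_scope.
Local Open Scope complex_scope.

(** * Real-valued norms and Cauchy estimates *)

(** The obstacle is that [s] must not depend on [M], whereas the contraction argument that moves the
    endpoint of a disc ([perturb]) only allows displacements of order [weight ^- M]. The
    displacement is therefore cut into many tiny ones, and a priori bounds keep the intermediate
    discs away from the boundary of the ball throughout. These bounds cost a factor
    [(1 - 2 * kappa) ^- N], because two discs are compared only over the [N] points before the
    endpoint; earlier points are controlled by the escape hypothesis itself.

    Discs, rather than single orbits, are needed to measure progress: every disc passes through the
    fixed point, so its derivative is transported exactly by [T], without nonlinear error, and the
    modulus of [t] cannot be lost in the many steps.

    Complex analysis is reduced to finite sums: a disc is a uniform limit of polynomials on the unit
    circle, Cauchy's estimate is an averaging argument for polynomials, and contour integrals are
    limits of averages over roots of unity. *)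

Definition cabs {R : realType} (z : R[i]) : R := complex.Re `|z|.

Section RealNorm.
Context {R : realType}.
Implicit Types z w : R[i].

Lemma cabsE z : `|z| = (cabs z)%:C.
Proof. by rewrite /cabs RRe_real // normr_real. Qed.

Lemma cabs_ge0 z : 0 <= cabs z.
Proof. by rewrite -lecR -cabsE normr_ge0. Qed.

Lemma cabsM z w : cabs (z * w) = cabs z * cabs w.
Proof. by apply: complexI; rewrite rmorphM /= -!cabsE normrM. Qed.

Lemma cabsN z : cabs (- z) = cabs z.
Proof. by rewrite /cabs normrN. Qed.

Lemma cabsX z n : cabs (z ^+ n) = cabs z ^+ n.
Proof. by apply: complexI; rewrite rmorphXn /= -!cabsE normrX. Qed.

Lemma cabsV z : cabs z^-1 = (cabs z)^-1.
Proof. by apply: complexI; rewrite fmorphV /= -!cabsE normfV. Qed.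

Lemma cabs_real (r : R) : cabs r%:C = `|r|.
Proof.
rewrite /cabs normc_def /= expr0n /= addr0 sqrtr_sqr //.
Qed.

Lemma cabs1 : cabs (1 : R[i]) = 1.
Proof. by rewrite /cabs normr1. Qed.

Lemma cabs0 : cabs (0 : R[i]) = 0.
Proof. by rewrite /cabs normr0. Qed.

Lemma cabs_eq0 z : (cabs z == 0) = (z == 0).
Proof. by rewrite -(normr_eq0 z) cabsE -(inj_eq (@complexI R)). Qed.

Lemma cabsD z w : cabs (z + w) <= cabs z + cabs w.
Proof. by rewrite -lecR rmorphD /= -!cabsE ler_normD. Qed.

Lemma cabs_sub z w : cabs (z - w) = cabs (w - z).
Proof. by rewrite -cabsN opprB. Qed.

Context {V : normedModType R[i]}.
Implicit Types x y : V.

Lemma rnormE x : `|x| = (rnorm x)%:C.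
Proof. by rewrite /rnorm RRe_real // normr_real. Qed.

Lemma rnorm_ge0 x : 0 <= rnorm x.
Proof. by rewrite -lecR -rnormE normr_ge0. Qed.

Lemma rnorm0 : rnorm (0 : V) = 0.
Proof. by rewrite /rnorm normr0. Qed.

Lemma rnorm_eq0 x : (rnorm x == 0) = (x == 0).
Proof. by rewrite -(normr_eq0 x) rnormE -(inj_eq (@complexI R)). Qed.

Lemma rnorm_gt0 x : (0 < rnorm x) = (x != 0).
Proof. by rewrite lt0r rnorm_eq0 rnorm_ge0 andbT. Qed.

Lemma rnormN x : rnorm (- x) = rnorm x.
Proof. by rewrite /rnorm normrN. Qed.

Lemma rnormZ z x : rnorm (z *: x) = cabs z * rnorm x.
Proof. by apply: complexI; rewrite rmorphM /= -cabsE -!rnormE normrZ. Qed.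

Lemma rnormD x y : rnorm (x + y) <= rnorm x + rnorm y.
Proof. by rewrite -lecR rmorphD /= -!rnormE ler_normD. Qed.

Lemma rnormB x y : rnorm (x - y) <= rnorm x + rnorm y.
Proof. by rewrite -(rnormN y); exact: rnormD. Qed.

Lemma rnorm_sub x y : rnorm (x - y) = rnorm (y - x).
Proof. by rewrite -rnormN opprB. Qed.

Lemma rdistD y x t : rnorm (x - t) <= rnorm (x - y) + rnorm (y - t).
Proof. by rewrite -(subrKA y); exact: rnormD. Qed.

Lemma ler_rnorm_sub x y : rnorm x <= rnorm y + rnorm (x - y).
Proof. by rewrite -{1}(subrK y x) addrC; exact: rnormD. Qed.

Lemma rnorm_sum (I : Type) (s : seq I) (P : pred I) (f : I -> V) :
  rnorm (\sum_(i <- s | P i) f i) <= \sum_(i <- s | P i) rnorm (f i).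
Proof.
elim/big_ind2: _ => [|x a y b hx hy|//]; first by rewrite rnorm0.
exact: le_trans (rnormD _ _) (lerD hx hy).
Qed.

Lemma rnorm_le0 x : (forall e : R, 0 < e -> rnorm x <= e) -> x = 0.
Proof.
move=> h; apply/eqP; rewrite -rnorm_eq0 eq_le rnorm_ge0 andbT.
by apply/ler_addgt0Pl => e e0; rewrite addr0 h.
Qed.

Lemma ball_rnorm x (e : R) y : ball x e%:C y <-> rnorm (x - y) < e.
Proof. by rewrite -ball_normE /ball_ /= rnormE ltcR. Qed.

Lemma nbhs_rnorm x (A : set V) :
  nbhs x A <-> exists2 e : R, 0 < e & forall y, rnorm (x - y) < e -> A y.
Proof.
split=> [/nbhs_ballP[e /= e0 h]|[e e0 h]].
  have ee : e = (complex.Re e)%:C by rewrite RRe_real // gtr0_real.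
  exists (complex.Re e); first by rewrite -ltcR -ee.
  by move=> y hy; apply: h; rewrite ee; apply/ball_rnorm.
apply/nbhs_ballP; exists e%:C; first by rewrite /= ltcR.
by move=> y /ball_rnorm; exact: h.
Qed.

End RealNorm.

Section Completeness.
Context {R : realType} {V : completeNormedModType R[i]}.

Lemma rcauchy_cvg (u : nat -> V) :
  (forall e : R, 0 < e -> exists N, forall n m, (N <= n)%N -> (N <= m)%N ->
     rnorm (u n - u m) <= e) ->
  exists l, forall e : R, 0 < e -> exists N, forall n, (N <= n)%N ->
     rnorm (u n - l) <= e.
Proof.
move=> h.
have /cauchy_cvg/cvg_ex[l hl] : cauchy (u @ \oo).
  apply: cauchy_exP => e e0.
  have ee : e = (complex.Re e)%:C by rewrite RRe_real // gtr0_real.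
  have e1 : 0 < complex.Re e by rewrite -ltcR -ee.
  have [|N hN] := h (complex.Re e / 2); first by rewrite divr_gt0.
  exists (u N); exists N => // n /= Nn; rewrite ee; apply/ball_rnorm.
  by apply: le_lt_trans (hN _ _ (leqnn N) Nn) _; rewrite ltr_pdivrMr // ltr_pMr ?ltr1n.
exists l => e e0.
have /hl [N _ hN] : nbhs l [set y | rnorm (l - y) < e].
  by apply/nbhs_rnorm; exists e.
by exists N => n /hN /= /ltW; rewrite rnorm_sub.
Qed.

Lemma geometric_cvg (u : nat -> V) (K q : R) : 0 <= K -> 0 <= q < 1 ->
  (forall n, rnorm (u n.+1 - u n) <= K * q ^+ n) ->
  exists l, forall n, rnorm (u n - l) <= K * q ^+ n / (1 - q).
Proof.
move=> K0 /andP[q0 q1] hu.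
have q1' : 0 < 1 - q by rewrite subr_gt0.
have hd n m : rnorm (u n - u (n + m)%N) <= K * q ^+ n / (1 - q).
  suff h : rnorm (u n - u (n + m)%N) <= K * q ^+ n * (1 - q ^+ m) / (1 - q).
    apply: le_trans h _; rewrite ler_wpM2r ?invr_ge0 ?(ltW q1') //.
    by rewrite ler_piMr ?mulr_ge0 ?exprn_ge0 // gerBl exprn_ge0.
  elim: m => [|m IH]; first by rewrite addn0 subrr rnorm0 expr0 subrr mulr0 mul0r.
  apply: le_trans (rdistD (u (n + m)%N) _ _) _.
  have h1 : rnorm (u (n + m)%N - u (n + m.+1)%N) <= K * q ^+ (n + m).
    by rewrite rnorm_sub addnS.
  apply: le_trans (lerD IH h1) _.
  rewrite ler_pdivlMr // mulrDl mulfVK ?gt_eqF // exprD exprS le_eqVlt.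
  by apply/orP; left; apply/eqP; ring.
have hge e : 0 < e -> exists N, forall n, (N <= n)%N -> K * q ^+ n / (1 - q) <= e.
  move=> e0.
  have /cvgrPdist_le : (fun n => K * q ^+ n / (1 - q)) @ \oo --> (0 : R).
    have -> : (0 : R) = K * 0 / (1 - q) by rewrite mulr0 mul0r.
    apply: cvgM; last exact: cvg_cst.
    by apply: cvgM; [exact: cvg_cst|apply: cvg_expr; rewrite ger0_norm].
  move=> /(_ _ e0)[N _ hN]; exists N => n /hN /=; rewrite sub0r normrN.
  exact: le_trans (ler_norm _).
have [l hl] : exists l, forall e : R, 0 < e -> exists N, forall n, (N <= n)%N ->
     rnorm (u n - l) <= e.
  apply: rcauchy_cvg => e e0; have e2 : 0 < e / 2 by rewrite divr_gt0.
  have [N hN] := hge _ e2; exists N => n m Nn Nm.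
  apply: le_trans (rdistD (u N) _ _) _.
  rewrite [leRHS](splitr e); apply: lerD.
    by rewrite rnorm_sub -(subnKC Nn); apply: le_trans (hd _ _) (hN _ _).
  by rewrite -(subnKC Nm); apply: le_trans (hd _ _) (hN _ _).
exists l => n; apply/ler_addgt0Pr => e e0; have [N hN] := hl _ e0.
apply: le_trans (rdistD (u (n + N)%N) _ _) _.
by apply: lerD => //; apply: hN; rewrite leq_addl.
Qed.

End Completeness.

Section PolynomialCauchy.
Context {R : realType} {V : normedModType R[i]}.

Lemma root_of_minus_one (d : nat) : (0 < d)%N ->
  exists2 w : R[i], cabs w = 1 & w ^+ d = -1.
Proof.
move=> d0; exists (d.-root (-1)); last by rewrite rootCK.
have : cabs (d.-root (-1) : R[i]) ^+ d = 1.
  by rewrite -cabsX rootCK // cabsN cabs1.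
by move/eqP; rewrite pexpr_eq1 ?cabs_ge0 // => /eqP.
Qed.

(* Averaging [f z] with [w^-m * f (w z)], where [w^j = - w^m], removes the
   [j]-th coefficient, keeps the [m]-th one, and does not increase the bound. *)
Lemma poly_cauchy (n : nat) (c : nat -> V) (rho M : R) (m : nat) :
  0 <= rho ->
  (forall z : R[i], cabs z = rho -> rnorm (\sum_(i < n) z ^+ i *: c i) <= M) ->
  (m < n)%N -> rnorm (c m) * rho ^+ m <= M.
Proof.
move=> rho0 hM mn.
have kill j : exists c' : nat -> V, [/\ c' m = c m,
    forall i, (i < j)%N -> i != m -> c' i = 0 &
    forall z : R[i], cabs z = rho -> rnorm (\sum_(i < n) z ^+ i *: c' i) <= M].
  elim: j => [|j [c' [c'm c'0 c'M]]]; first by exists c.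
  have [jm|jm] := eqVneq j m.
    by exists c'; split=> // i; rewrite ltnS leq_eqVlt => /predU1P[->|/c'0//]; rewrite jm eqxx.
  have [w w1 wjm] : exists2 w : R[i], cabs w = 1 & w ^+ j = - w ^+ m.
    case: (ltngtP j m) jm => // jm _.
      have [|w w1 wd] := @root_of_minus_one (m - j); first by rewrite subn_gt0.
      by exists w => //; rewrite -(subnK (ltnW jm)) exprD wd mulN1r opprK.
    have [|w w1 wd] := @root_of_minus_one (j - m); first by rewrite subn_gt0.
    by exists w => //; rewrite -(subnK (ltnW jm)) exprD wd mulN1r.
  have w0 : w != 0 by rewrite -cabs_eq0 w1 oner_eq0.
  exists (fun i => (2^-1 * (1 + w ^- m * w ^+ i)) *: c' i); split.
  - by rewrite mulVf ?expf_neq0 // mulVf ?scale1r // -natr1 add0r.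
  - move=> i; rewrite ltnS leq_eqVlt => /predU1P[->|ij] im.
      by rewrite wjm mulrN mulVf ?expf_neq0 // subrr mulr0 scale0r.
    by rewrite c'0 // scaler0.
  - move=> z zr.
    have -> : \sum_(i < n) z ^+ i *: ((2^-1 * (1 + w ^- m * w ^+ i)) *: c' i) =
        2^-1 *: (\sum_(i < n) z ^+ i *: c' i) +
        (2^-1 * w ^- m) *: \sum_(i < n) (w * z) ^+ i *: c' i.
      rewrite !scaler_sumr -big_split /=; apply: eq_bigr => i _.
      rewrite !scalerA -scalerDl exprMn; congr (_ *: _); ring.
    apply: le_trans (rnormD _ _) _.
    have h2 : cabs (2^-1 : R[i]) = 2^-1.
      by rewrite cabsV -[2%:R](rmorph_nat (real_complex R)) cabs_real ger0_norm.
    rewrite !rnormZ cabsM h2 cabsV cabsX w1 expr1n invr1 mulr1 -mulrDr.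
    rewrite mulrC ler_pdivrMr // mulr_natr mulr2n lerD ?c'M //.
    by rewrite cabsM w1 mul1r.
(* Once every coefficient of index below [n] except the [m]-th is removed, the sum at the point
   [rho] is a single term. *)
have [c' [<- c'0 /(_ rho%:C)]] := kill n.
rewrite cabs_real ger0_norm // => /(_ erefl).
rewrite (bigD1 (Ordinal mn)) //= big1 ?addr0 => [|i im]; last first.
  by rewrite c'0 ?scaler0.
by rewrite rnormZ cabsX cabs_real ger0_norm // mulrC.
Qed.

End PolynomialCauchy.

(** * Compact operators *)

Section UltrafilterLimits.
Context {R : realType} {G : set_system nat} {GU : UltraFilter G}.

Lemma compact_ultralimit {T : topologicalType} (A : set T) (x : nat -> T) :
  compact A -> (forall n, A (x n)) ->
  exists2 p, A p & forall B, nbhs p B -> G [set n | B (x n)].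
Proof.
move=> cA Ax.
have h : (x @ G) A by apply: (@filterE _ G) => n /=.
have [p [Ap pc]] := cA (x @ G) _ h.
exists p => // B pB.
have [//|GC] := in_ultra_setVsetC [set n | B (x n)] GU.
by have [y [/= ]] := pc (~` B) B GC pB.
Qed.

Lemma bounded_ultralimit (x : nat -> R) (K : R) :
  (forall n, `|x n| <= K) ->
  exists l, forall e, 0 < e -> G [set n | `|x n - l| < e].
Proof.
move=> xK.
have [n|l _ hl] := @compact_ultralimit _ _ x (@segment_compact R (- K) K).
  by rewrite /= in_itv /= -ler_norml.
exists l => e e0; have : nbhs l (ball l e) by exact: nbhsx_ballx.
by move=> /hl; apply: filterS => n /=; rewrite /ball /= distrC.
Qed.

(* Since [G] is fixed, limits along [G] of several sequences are automatically
   simultaneous, which spares the extraction of subsequences. *)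
Definition ultracompact {V : normedModType R[i]} (f : V -> V) : Prop :=
  forall (x : nat -> V) (K : R), (forall n, rnorm (x n) <= K) ->
  exists y, forall e, 0 < e -> G [set n | rnorm (f (x n) - y) < e].

(** Each Riesz-type argument below builds a bounded sequence with uniformly separated images and is
    closed by this lemma. *)
Lemma ultracompact_not_separated {V : normedModType R[i]} (f : V -> V) :
  [set A | \forall n \near \oo, A n] `<=` G ->
  ultracompact f -> forall (x : nat -> V) (K e : R), 0 < e ->
  (forall n, rnorm (x n) <= K) ->
  exists n m, (n < m)%N /\ rnorm (f (x n) - f (x m)) < e.
Proof.
move=> Goo fc x K e e0 xK; have [y hy] := fc x K xK.
have e2 : 0 < e / 2 by rewrite divr_gt0.
have h := hy _ e2.
have [n /= hn] := filter_ex h.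
have : G [set m | (n < m)%N] by apply: Goo; exists n.+1.
move=> /(filterI h)/filter_ex[m /= [hm nm]]; exists n, m; split => //.
apply: le_lt_trans (rdistD y _ _) _; rewrite (rnorm_sub y).
by rewrite (splitr e) ltrD.
Qed.

End UltrafilterLimits.

Section RieszLemma.
Context {R : realType} {V : normedModType R[i]}.

Definition subspace_of (M : set V) : Prop :=
  M 0 /\ forall (a : R[i]) x y, M x -> M y -> M (a *: x + y).

Definition approx_closed (M : set V) : Prop :=
  forall x, (forall e : R, 0 < e -> exists2 m, M m & rnorm (x - m) <= e) -> M x.

(** Take [m0] in [M] at less than twice the distance of [x0] from [M] and normalise [x0 - m0];
    closedness of [M] makes that distance positive. *)
Lemma riesz_lemma (M M' : set V) (x0 : V) :
  subspace_of M -> subspace_of M' -> M `<=` M' -> approx_closed M ->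
  M' x0 -> ~ M x0 ->
  exists x, [/\ M' x, rnorm x = 1 & forall m, M m -> 2^-1 <= rnorm (x - m)].
Proof.
move=> [M0 MD] [_ M'D] MM' Mc M'x0 Mx0.
pose E := [set rnorm (x0 - m) | m in M].
have E0 : has_inf E.
  split; first by exists (rnorm (x0 - 0)), 0.
  by exists 0 => _ [m _ <-]; exact: rnorm_ge0.
have Eg m : M m -> inf E <= rnorm (x0 - m).
  by move=> Mm; apply: ge_inf; [exact: E0.2|exists m].
have d0 : 0 < inf E.
  apply: contrapT => /negP; rewrite -leNgt => h; apply: Mx0; apply: Mc => e e0.
  have [_ [m Mm <-] he] := inf_adherent e0 E0.
  by exists m => //; apply/ltW/(lt_le_trans he); lra.
have [_ [m0 Mm0 <-] hm0] := inf_adherent d0 E0.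
set k := rnorm (x0 - m0) in hm0.
have k0 : 0 < k := lt_le_trans d0 (Eg _ Mm0).
have kk : cabs (k^-1)%:C = k^-1 by rewrite cabs_real ger0_norm // invr_ge0 ltW.
exists ((k^-1)%:C *: (x0 - m0)); split.
- rewrite -[X in M' X]addr0; apply: (M'D); last exact: MM'.
  by rewrite addrC -scaleN1r; apply: (M'D) => //; exact: MM'.
- by rewrite rnormZ kk mulVf // gt_eqF.
- move=> m Mm.
  have -> : (k^-1)%:C *: (x0 - m0) - m = (k^-1)%:C *: (x0 - (k%:C *: m + m0)).
    rewrite opprD addrA addrAC (scalerBr _ _ (k%:C *: m)) scalerA -rmorphM mulVf ?gt_eqF //=.
    by rewrite scale1r.
  rewrite rnormZ kk ler_pdivlMl //.
  have := Eg _ (MD k%:C _ _ Mm Mm0); lra.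
Qed.

End RieszLemma.

Section CompactOperator.
Context {R : realType} {G : set_system nat} {GU : UltraFilter G}.
Hypothesis Goo : [set A | \forall n \near \oo, A n] `<=` G.
Context {V : completeNormedModType R[i]} (T : {linear V -> V}).
Hypothesis Tcompact : ultracompact (G := G) T.
Context (K0 : R) (TK0 : forall x, rnorm (T x) <= K0 * rnorm x) (K0_ge0 : 0 <= K0).

Section EigenvalueSequence.
Context (mu : nat -> R[i]).

Fixpoint shift_product n x :=
  if n is n.+1 then T (shift_product n x) - mu n *: shift_product n x else x.

Lemma shift_productD n a x y :
  shift_product n (a *: x + y) = a *: shift_product n x + shift_product n y.
Proof.
elim: n => //= n ->; rewrite (linearP T) scalerDr scalerBr !scalerA mulrC.
by rewrite opprD addrACA.
Qed.

Lemma shift_product0 n : shift_product n 0 = 0 :> V.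
Proof. by elim: n => //= n ->; rewrite (linear0 T) scaler0 subrr. Qed.

Lemma shift_productT n x : shift_product n (T x) = T (shift_product n x).
Proof. by elim: n => //= n ->; rewrite (linearB T) (linearZ_LR T). Qed.

Lemma shift_productB n x y :
  shift_product n (x - y) = shift_product n x - shift_product n y.
Proof. by rewrite addrC -scaleN1r shift_productD scaleN1r addrC. Qed.

Lemma shift_product_bounded n :
  exists2 K : R, 0 <= K & forall x, rnorm (shift_product n x) <= K * rnorm x.
Proof.
elim: n => [|n [K Kge0 hK]]; first by exists 1 => // x; rewrite mul1r.
exists ((K0 + cabs (mu n)) * K); first by rewrite mulr_ge0 // addr_ge0 // cabs_ge0.
move=> x /=; apply: le_trans (rnormB _ _) _; rewrite rnormZ.
rewrite -mulrA mulrDl; apply: lerD; last by rewrite ler_wpM2l ?cabs_ge0.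
by apply: le_trans (TK0 _) _; rewrite ler_wpM2l.
Qed.

Lemma shift_product_eigenvector n l e :
  T e = l *: e -> shift_product n e = (\prod_(i < n) (l - mu i)) *: e.
Proof.
move=> Te; elim: n => [|n IH] /=; first by rewrite big_ord0 scale1r.
rewrite IH (linearZ_LR T) /= Te big_ord_recr /= !scalerA -scalerBl.
by congr (_ *: _); ring.
Qed.

(* The kernels of the products of the [T - mu i], [i < n], are closed and, when
   the [mu i] are distinct eigenvalues, strictly increasing in [n]. *)
Lemma no_separated_eigenvalues (e : nat -> V) (d : R) :
  (forall n, T (e n) = mu n *: e n) -> (forall n, e n != 0) ->
  (forall n m, (m < n)%N -> mu n != mu m) -> 0 < d ->
  (forall n, d <= cabs (mu n)) -> False.
Proof.
move=> Te e0 muI d0 dmu.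
pose M n := [set x | shift_product n x = 0].
have Msub n : subspace_of (M n).
  split; first exact: shift_product0.
  by move=> a x y; rewrite /M /= shift_productD => -> ->; rewrite scaler0 addr0.
have MS n : M n `<=` M n.+1 by move=> x; rewrite /M /= => ->; rewrite (linear0 T) scaler0 subrr.
have Mle n m : (n <= m)%N -> M n `<=` M m.
  move=> /subnK <-; elim: (m - n)%N => [//|k IH]; rewrite addSn.
  by move=> x /IH; exact: MS.
have Mc n : approx_closed (M n).
  move=> x hx; have [K Kge0 hK] := shift_product_bounded n.
  apply: rnorm_le0 => eps eps0.
  have [|m Mm hm] := hx (eps / (K + 1)); first by rewrite divr_gt0 // ltr_wpDl.
  have -> : shift_product n x = shift_product n (x - m) by rewrite shift_productB Mm subr0.
  apply: le_trans (hK _) _; apply: (@le_trans _ _ (K * (eps / (K + 1)))).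
    by rewrite ler_wpM2l.
  rewrite mulrA ler_pdivrMr ?ltr_wpDl // mulrC ler_wpM2l ?ltW //; lra.
have Mtop n : M n.+1 (e n).
  by rewrite /M /= (shift_product_eigenvector _ _ _ (Te n)) (linearZ_LR T) /= Te !scalerA mulrC subrr.
have Mnot n : ~ M n (e n).
  rewrite /M /= (shift_product_eigenvector _ _ _ (Te n)) => /eqP.
  rewrite scaler_eq0 (negbTE (e0 n)) orbF prodf_seq_eq0 => /hasP[i _ /=].
  by rewrite subr_eq0 (negbTE (muI _ _ (ltn_ord i))).
have /choice[x hx] n := riesz_lemma _ _ _ (Msub n) (Msub n.+1) (@MS n) (@Mc n) (@Mtop n) (@Mnot n).
have [//||n [m [nm]]] := ultracompact_not_separated _ Goo Tcompact x 1 (d / 2).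
- by rewrite divr_gt0.
- by move=> n; have [_ -> _] := hx n.
(* For [n < m], both [T (x n)] and [T (x m) - mu m *: x m] lie in [M m], so [T (x m) - T (x n)] is
   [mu m] times the difference of [x m] and an element of [M m]; its norm is at least [d / 2]. *)
have [Mx _ _] := hx n; have [Mxm _ xm] := hx m.
have mum0 : mu m != 0 by rewrite -cabs_eq0 gt_eqF // (lt_le_trans d0).
have Mn1 : M m (x n) by exact: Mle Mx.
have Mz : M m ((mu m)^-1 *: (T (x n) - (T (x m) - mu m *: x m)) + 0).
  apply: (Msub m).2 (Msub m).1; rewrite addrC -scaleN1r; apply: (Msub m).2.
    by move: Mxm; rewrite /M /= shift_productB shift_productT -[mu m *: x m]addr0 shift_productD shift_product0 addr0.
  by move: Mn1; rewrite /M /= shift_productT => ->; rewrite (linear0 T).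
have := xm _ Mz; rewrite addr0.
have -> : x m - (mu m)^-1 *: (T (x n) - (T (x m) - mu m *: x m)) =
   (mu m)^-1 *: (T (x m) - T (x n)).
  rewrite !scalerBr scalerA mulVf // scale1r.
  by rewrite opprB addrA subrKC.
rewrite rnormZ cabsV rnorm_sub ler_pdivlMl ?(lt_le_trans d0) //.
have := dmu m; lra.
Qed.

End EigenvalueSequence.

(** Otherwise eigenvalues of modulus below 1 accumulate at the unit circle, and among them there are
    infinitely many distinct ones of modulus at least [2^-1]. *)
Lemma eigenvalue_free_annulus : exists2 r : R, 0 < r < 1 &
  forall mu x, r <= cabs mu < 1 -> T x = mu *: x -> x = 0.
Proof.
apply: contrapT => hn.
have ex (r : R) : exists mx : R[i] * V, 0 < r < 1 ->
    [/\ r <= cabs mx.1 < 1, mx.2 != 0 & T mx.2 = mx.1 *: mx.2].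
  have [r1|] := boolP (0 < r < 1); last by exists (0, 0).
  apply: contrapT => h; apply: hn; exists r => // mu x mur Tx.
  have [//|x0] := eqVneq x 0; case: h; exists (mu, x) => _; by split.
have [f hf] := choice ex.
(* The next threshold is the midpoint of 1 and the modulus just found, so the moduli increase
   strictly. *)
pose rs := fix rs n := if n is n.+1 then (1 + cabs (f (rs n)).1) / 2 else 2^-1 : R.
have rs1 n : 2^-1 <= rs n < 1.
  elim: n => [|n IH] /=; first lra.
  have [|/andP[h1 h2] _ _] := hf (rs n); first lra.
  by have := cabs_ge0 (f (rs n)).1; lra.
have hf' n : [/\ rs n <= cabs (f (rs n)).1 < 1, (f (rs n)).2 != 0 &
    T (f (rs n)).2 = (f (rs n)).1 *: (f (rs n)).2].
  by apply: hf; have := rs1 n; lra.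
have incr n m : (m < n)%N -> cabs (f (rs m)).1 < cabs (f (rs n)).1.
  apply: (homo_ltn (f := fun n => cabs (f (rs n)).1) lt_trans) => i.
  have [/andP[h _] _ _] := hf' i.+1; have [/andP[_ h' ] _ _] := hf' i.
  by apply: lt_le_trans h; rewrite /=; lra.
apply: (@no_separated_eigenvalues (fun n => (f (rs n)).1) (fun n => (f (rs n)).2) 2^-1).
- by move=> n; have [] := hf' n.
- by move=> n; have [] := hf' n.
- move=> n m /incr h; apply: contraTneq h => ->; by rewrite ltxx.
- lra.
- by move=> n; have [/andP[h _] _ _] := hf' n; have := rs1 n; lra.
Qed.

Context (a b : R) (a0 : 0 < a).
Hypothesis free : forall s x, a <= cabs s <= b -> x = s *: T x -> x = 0.

(** If it fails, there are unit vectors [x n] and parameters [s n] with [x n - s n *: T (x n)]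
    tending to 0. Along [G], [s n] tends to some [s] and [T (x n)] to some [y], so [x n] tends to
    [s *: y], which then has norm 1, while [y = s *: T y] forces [y = 0]. *)
Lemma resolvent_lower_bound : exists2 c : R, 0 < c &
  forall s x, a <= cabs s <= b -> c * rnorm x <= rnorm (x - s *: T x).
Proof.
apply: contrapT => hn.
have ex n : exists sx : R[i] * V, [/\ a <= cabs sx.1 <= b, rnorm sx.2 = 1 &
    rnorm (sx.2 - sx.1 *: T sx.2) < n.+1%:R^-1].
  apply: contrapT => h; apply: hn; exists (n.+1%:R^-1) => [|s x sab]; first by rewrite invr_gt0.
  rewrite leNgt; apply/negP => hlt; apply: h.
  have x0 : 0 < rnorm x.
    rewrite lt0r rnorm_ge0 andbT; apply: contraTneq hlt => ->.
    by rewrite mulr0 -leNgt rnorm_ge0.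
  have kk : cabs ((rnorm x)^-1)%:C = (rnorm x)^-1 by rewrite cabs_real ger0_norm // invr_ge0 ltW.
  exists (s, ((rnorm x)^-1)%:C *: x); split => //=; first by rewrite rnormZ kk mulVf // gt_eqF.
  rewrite (linearZ_LR T) /= scalerA mulrC -scalerA -scalerBr rnormZ kk.
  by rewrite mulrC ltr_pdivrMr.
have [f hf] := choice ex.
have Re_le (z : R[i]) : `|complex.Re z| <= cabs z.
  rewrite -lecR -cabsE normc_def lecR -sqrtr_sqr ler_sqrt ?lerDl ?sqr_ge0 //.
  by rewrite addr_ge0 // sqr_ge0.
have Im_le (z : R[i]) : `|complex.Im z| <= cabs z.
  rewrite -lecR -cabsE normc_def lecR -sqrtr_sqr ler_sqrt ?lerDr ?sqr_ge0 //.
  by rewrite addr_ge0 // sqr_ge0.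
have sb n : cabs (f n).1 <= b by have [/andP[]] := hf n.
have [al hal] := @bounded_ultralimit _ _ GU _ b (fun n => le_trans (Re_le (f n).1) (sb n)).
have [be hbe] := @bounded_ultralimit _ _ GU _ b (fun n => le_trans (Im_le (f n).1) (sb n)).
pose s : R[i] := al +i* be.
have cabs_le (z : R[i]) : cabs z <= `|complex.Re z| + `|complex.Im z|.
  rewrite {1}(complexE z); apply: le_trans (cabsD _ _) _.
  rewrite cabsM !cabs_real -[leRHS]addrC -[leRHS]addrC lerD2l.
  by rewrite ler_piMl // /cabs normc_def /= expr0n /= add0r expr1n sqrtr1.
have hs e : 0 < e -> G [set n | cabs ((f n).1 - s) < e].
  move=> e0; have e2 : 0 < e / 2 by rewrite divr_gt0.
  apply: filterS2 (hal _ e2) (hbe _ e2) => n /= h1 h2.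
  apply: le_lt_trans (cabs_le _) _; rewrite (splitr e).
  by move: h1 h2; case: ((f n).1) => x y /= h1 h2; apply: ltrD.
have [|y hy] := Tcompact (fun n => (f n).2) 1; first by move=> n; have [_ ->] := hf n.
have h3 (e : R) : 0 < e -> G [set n | n.+1%:R^-1 < e].
  move: e => _ /posnumP[e]; apply: Goo.
  exact: near_infty_natSinv_lt.
have b0 : 0 <= b := le_trans (cabs_ge0 _) (sb 0%N).
have hx e : 0 < e -> G [set n | rnorm ((f n).2 - s *: y) < e].
  move=> e0.
  have k1 : 0 < b + 1 by lra.
  have k2 : 0 < rnorm y + 1 by have := rnorm_ge0 y; lra.
  have e1 : 0 < e / 3 by lra.
  apply: filterS3 (h3 _ e1) (hy _ (divr_gt0 e1 k1)) (hs _ (divr_gt0 e1 k2)) => n /= i1 i2 i3.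
  have [_ _ i0] := hf n.
  have -> : (f n).2 - s *: y = ((f n).2 - (f n).1 *: T (f n).2) +
     ((f n).1 *: (T (f n).2 - y) + ((f n).1 - s) *: y).
    by rewrite scalerBr scalerBl !addrA !subrK.
  apply: le_lt_trans (rnormD _ _) _.
  have j1 : rnorm ((f n).1 *: (T (f n).2 - y)) <= e / 3.
    rewrite rnormZ; apply: (@le_trans _ _ ((b + 1) * (e / 3 / (b + 1)))).
      by rewrite ler_pM ?cabs_ge0 ?rnorm_ge0 // ?(ltW i2) //; have := sb n; lra.
    by rewrite mulrC mulfVK ?gt_eqF.
  have j2 : rnorm (((f n).1 - s) *: y) <= e / 3.
    rewrite rnormZ; apply: (@le_trans _ _ ((e / 3 / (rnorm y + 1)) * (rnorm y + 1))).
      by rewrite ler_pM ?cabs_ge0 ?rnorm_ge0 // ?(ltW i3) //; lra.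
    by rewrite mulfVK ?gt_eqF.
  have i4 := lt_trans i0 i1.
  have := rnormD ((f n).1 *: (T (f n).2 - y)) (((f n).1 - s) *: y); lra.
have y1 : y = s *: T y.
  apply/eqP; rewrite -subr_eq0; apply/eqP/rnorm_le0 => e e0.
  have k : 0 < K0 + 1 by rewrite ltr_wpDl.
  have e2 : 0 < e / 2 by lra.
  have /(filterI (hx _ (divr_gt0 e2 k)))/filter_ex[n /= [i1 i2]] := hy _ e2.
  have -> : y - s *: T y = - (T (f n).2 - y) + T ((f n).2 - s *: y).
    by rewrite opprB (linearB T) (linearZ_LR T) /= addrA subrK.
  apply: le_trans (rnormD _ _) _; rewrite rnormN.
  have : rnorm (T ((f n).2 - s *: y)) <= e / 2.
    apply: le_trans (TK0 _) _; apply: (@le_trans _ _ ((K0 + 1) * (e / 2 / (K0 + 1)))).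
      by rewrite ler_pM ?rnorm_ge0 // ?(ltW i1) //; lra.
    by rewrite mulrC mulfVK ?gt_eqF.
  lra.
have sab : a <= cabs s <= b.
  apply/andP; split.
    apply/ler_addgt0Pr => e e0; have /filter_ex[n /= i] := hs _ e0.
    have [/andP[j _] _ _] := hf n; have := cabsD ((f n).1 - s) s; rewrite subrK; lra.
  apply/ler_addgt0Pr => e e0; have /filter_ex[n /= i] := hs _ e0.
  have := sb n; have := cabsD (s - (f n).1) (f n).1; rewrite subrK cabs_sub; lra.
have /filter_ex[n /= i] := hx 1 ltr01.
have [_ j _] := hf n; move: i.
by rewrite (free _ _ sab y1) scaler0 subr0 j ltxx.
Qed.

(** Fredholm alternative: by the lower bound [A = 1 - s T] is injective and its powers have closed
    ranges. If [A] were not onto, these ranges would decrease strictly, and [riesz_lemma] would give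
    unit vectors with separated images. *)
Lemma resolvent_onto s y : a <= cabs s <= b -> exists x, x - s *: T x = y.
Proof.
move=> sab; have [c c0 hc] := resolvent_lower_bound.
have s0 : 0 < cabs s by case/andP: sab => h _; exact: lt_le_trans h.
pose A x := x - s *: T x.
have AL k u v : A (k *: u + v) = k *: A u + A v.
  rewrite /A (linearP T) scalerDr scalerBr !scalerA mulrC opprD; by rewrite addrACA.
have AnL n k u v : iter n A (k *: u + v) = k *: iter n A u + iter n A v.
  by elim: n => //= n ->; rewrite AL.
have An0 n : iter n A 0 = 0.
  by have := AnL n 1 0 0; rewrite !scale1r addr0 => /eqP; rewrite -subr_eq0 opprD addrA subrr sub0r oppr_eq0 => /eqP.
have AnB n u v : iter n A (u - v) = iter n A u - iter n A v.
  by rewrite addrC -scaleN1r AnL scaleN1r addrC.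
have Anc n x : c ^+ n * rnorm x <= rnorm (iter n A x).
  elim: n => [|n IH] /=; first by rewrite expr0 mul1r.
  by apply: le_trans (hc _ _ sab); rewrite exprS -mulrA ler_wpM2l // ltW.
apply: contrapT => hy.
pose B n := [set iter n A x | x in [set: V]].
have Bsub n : subspace_of (B n).
  split; first by exists 0.
  by move=> k _ _ [u _ <-] [v _ <-]; exists (k *: u + v).
have BS n : B n.+1 `<=` B n by move=> _ [x _ <-]; exists (A x) => //; rewrite iterSr.
have Ble n m : (n <= m)%N -> B m `<=` B n.
  move=> /subnK <-; elim: (m - n)%N => [//|k IH]; rewrite addSn.
  by move=> x /BS; exact: IH.
have Bc n : approx_closed (B n).
  move=> x hx.
  (* The factor [c ^+ n] in the tolerance compensates the lower bound [Anc], so that the approximate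
     preimages converge geometrically. *)
  have /choice[m hm] k : exists m, rnorm (x - iter n A m) <= c ^+ n * (2^-1 ^+ k).
    have [|_ [m _ <-] h] := hx (c ^+ n * (2^-1 ^+ k)); last by exists m.
    by rewrite mulr_gt0 // exprn_gt0 // invr_gt0.
  have cn : 0 < c ^+ n by rewrite exprn_gt0.
  have [||k|l hl] := @geometric_cvg _ _ m 2 2^-1; [lra|lra| |].
    rewrite -(ler_pM2l cn); apply: le_trans (Anc n _) _; rewrite AnB.
    apply: le_trans (rdistD x _ _) _; rewrite (rnorm_sub _ x).
    apply: le_trans (lerD (hm _) (hm _)) _; rewrite exprS.
    have : 0 < c ^+ n * 2^-1 ^+ k by rewrite mulr_gt0 // exprn_gt0 // invr_gt0.
    lra.
  exists l => //.
  have [Kn Kn0 hKn] : exists2 K : R, 0 <= K & forall x, rnorm (iter n A x) <= K * rnorm x.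
    elim: {+}n => [|p [K Kge0 hK]]; first by exists 1 => // z; rewrite mul1r.
    exists ((1 + cabs s * K0) * K); first by rewrite !mulr_ge0 // addr_ge0 // mulr_ge0 ?cabs_ge0.
    move=> z /=; apply: le_trans (rnormB _ _) _; rewrite rnormZ -mulrA mulrDl mul1r.
    apply: lerD => //; rewrite -mulrA ler_wpM2l ?cabs_ge0 //.
    by apply: le_trans (TK0 _) _; rewrite ler_wpM2l.
  apply/esym/eqP; rewrite -subr_eq0; apply/eqP/rnorm_le0 => e e0.
  have [k hk] : exists k : nat, (c ^+ n + Kn * 4) * 2^-1 ^+ k <= e.
    have : (fun k => (c ^+ n + Kn * 4) * 2^-1 ^+ k) @ \oo --> (0 : R).
      rewrite -[X in _ --> X](mulr0 (c ^+ n + Kn * 4)); apply: cvgM; first exact: cvg_cst.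
      by apply: cvg_expr; rewrite ger0_norm ?invr_ge0 // invf_lt1 // ltr1n.
    move=> /cvgrPdist_le/(_ _ e0)[k _ /(_ k (leqnn k))] /=.
    by rewrite sub0r normrN => h; exists k; apply: le_trans (ler_norm _) h.
  apply: le_trans (rdistD (iter n A (m k)) _ _) _; rewrite -AnB.
  apply: le_trans (lerD (hm k) (hKn _)) _; apply: le_trans hk.
  rewrite mulrDl lerD2l -mulrA ler_wpM2l //; apply: le_trans (hl k) _.
  have h2 : 0 <= 2^-1 :> R by lra.
  have := exprn_ge0 k h2; have -> : 1 - 2^-1 = 2^-1 :> R by lra.
  by rewrite invrK; lra.
have AnI n u v : iter n A u = iter n A v -> u = v.
  move=> h; apply/eqP; rewrite -subr_eq0 -rnorm_eq0 eq_le rnorm_ge0 andbT.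
  have := Anc n (u - v); rewrite AnB h subrr rnorm0 pmulr_rle0 // exprn_gt0 //.
have Btop n : B n (iter n A y) by exists y.
have Bnot n : ~ B n.+1 (iter n A y).
  by move=> [x _]; rewrite iterSr => /AnI h; apply: hy; exists x.
have /choice[x hx] n := riesz_lemma _ _ _ (Bsub n.+1) (Bsub n) (@BS n) (@Bc n.+1) (@Btop n) (@Bnot n).
have [//||n [m [nm]]] := ultracompact_not_separated _ Goo Tcompact x 1 ((cabs s)^-1 / 2).
- by rewrite divr_gt0 // invr_gt0.
- by move=> n; have [_ -> _] := hx n.
have [[u _ xu] _ xn] := hx n; have [Bm _ _] := hx m.
have [w _ xw] := Ble _ _ nm _ Bm.
have [t _ xt] := Ble n.+1 m.+1 (leqW nm) (A (x m)) (let: ex_intro2 z _ e := Bm in ex_intro2 _ _ z I (f_equal A e)).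
(* [A (x n)], [x m] and [A (x m)] all lie in [B n.+1], and subtracting this combination from [x n]
   leaves [s *: (T (x n) - T (x m))]. *)
have Bz : B n.+1 (A (x n) + (x m - A (x m))).
  by exists (u + (w - t)) => //; rewrite -[u]scale1r AnL scale1r AnB xw xt iterS xu.
have := xn _ Bz.
have -> : x n - (A (x n) + (x m - A (x m))) = s *: (T (x n) - T (x m)).
  by rewrite /A scalerBr [x m - (_ - _)]subKr opprD addrA subKr.
rewrite rnormZ => h1 h2.
have : cabs s * rnorm (T (x n) - T (x m)) < cabs s * ((cabs s)^-1 / 2) by rewrite ltr_pM2l.
by rewrite mulrA divff ?gt_eqF //; lra.
Qed.

End CompactOperator.

(** * Means over the unit circle *)

Section CircleMean.
Context {R : realType}.
Implicit Types u w : R[i].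

Lemma cabs_sqrt u : cabs u = 1 -> cabs (sqrtC u) = 1.
Proof.
move=> u1; have : cabs (sqrtC u) ^+ 2 = 1 by rewrite -cabsX sqrtCK.
by move/eqP; rewrite pexpr_eq1 ?cabs_ge0 // => /eqP.
Qed.

Lemma cabs_sqr u : cabs u ^+ 2 = complex.Re u ^+ 2 + complex.Im u ^+ 2.
Proof. by apply: complexI; rewrite rmorphXn /= -cabsE add_Re2_Im2. Qed.

(** The squares of [cabs (u - w)] and [cabs (u + w)] add up to 4, so one of the two moduli is at
    least [4 / 3], and their product is [cabs (u ^+ 2 - w ^+ 2)]. *)
Lemma sqrt_dist u w : cabs u = 1 -> cabs w = 1 ->
  cabs (u - w) <= 3 / 4 * cabs (u ^+ 2 - w ^+ 2) \/
  cabs (u + w) <= 3 / 4 * cabs (u ^+ 2 - w ^+ 2).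
Proof.
move=> u1 w1.
have E : cabs (u ^+ 2 - w ^+ 2) = cabs (u - w) * cabs (u + w) by rewrite subr_sqr cabsM.
have P : cabs (u + w) ^+ 2 + cabs (u - w) ^+ 2 = 4.
  have := cabs_sqr u; have := cabs_sqr w; rewrite u1 w1 expr1n !cabs_sqr.
  case: u {u1 E} => a b; case: w {w1} => c d /= h1 h2.
  have -> : 4 = 2 * (c ^+ 2 + d ^+ 2) + 2 * (a ^+ 2 + b ^+ 2) :> R by rewrite -h1 -h2; ring.
  by ring.
have p0 := cabs_ge0 (u + w); have m0 := cabs_ge0 (u - w).
have [h|h] := leP (4 / 3) (cabs (u + w)).
  by left; rewrite E; move: p0 m0 h; set x := cabs _; set y := cabs _ => *; nra.
right; rewrite E.
have : 4 / 3 <= cabs (u - w).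
  rewrite leNgt; apply/negP => h'; move: P p0 m0 h h'.
  by set x := cabs _; set y := cabs _ => *; nra.
by move: p0 m0; set x := cabs _; set y := cabs _ => *; nra.
Qed.

Context {V : completeNormedModType R[i]}.
Implicit Types g : R[i] -> V.

(* One step of averaging over the two square roots; its iterates at [1] are the
   averages of [g] over the [2 ^ n]-th roots of unity. *)
Definition average g u : V := 2^-1 *: (g (sqrtC u) + g (- sqrtC u)).

Lemma averageE0 g u : average g u = 2^-1 *: (g (sqrtC u) + g (- sqrtC u)).
Proof. by []. Qed.

Definition lipschitz_on_circle g (L : R) : Prop := forall u w,
  cabs u = 1 -> cabs w = 1 -> rnorm (g u - g w) <= L * cabs (u - w).

Lemma averageE g u a : a ^+ 2 = u -> average g u = 2^-1 *: (g a + g (- a)).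
Proof.
move=> au; rewrite /average.
have /eqP : sqrtC u ^+ 2 = a ^+ 2 by rewrite sqrtCK.
by rewrite eqf_sqr => /orP[]/eqP ->//; rewrite opprK [X in _ *: X]addrC.
Qed.

Lemma cabs_half : cabs (2^-1 : R[i]) = 2^-1.
Proof. by rewrite cabsV -[2%:R](rmorph_nat (real_complex R)) cabs_real ger0_norm. Qed.

Lemma half_add (x : V) : 2^-1 *: (x + x) = x.
Proof. by rewrite -mulr2n -(scaler_nat 2 x) scalerA mulVf ?scale1r // pnatr_eq0. Qed.

Lemma half_le (x : V) (y : R) : rnorm x <= 2 * y -> rnorm (2^-1 *: x) <= y.
Proof. by move=> h; rewrite rnormZ cabs_half mulrC ler_pdivrMr // mulrC. Qed.

(** The average does not depend on which root is called [sqrtC u], so the roots of [u] and [w] may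
    be paired in the closer of the two ways. *)
Lemma average_lipschitz g L : 0 <= L -> lipschitz_on_circle g L ->
  lipschitz_on_circle (average g) (3 / 4 * L).
Proof.
move=> L0 gL u w u1 w1.
have key a b : a ^+ 2 = u -> b ^+ 2 = w -> cabs a = 1 -> cabs b = 1 ->
    cabs (a - b) <= 3 / 4 * cabs (u - w) ->
    rnorm (average g u - average g w) <= 3 / 4 * L * cabs (u - w).
  move=> au bw a1 b1 hab; rewrite (averageE _ _ _ au) (averageE _ _ _ bw) -scalerBr.
  apply: half_le; rewrite opprD addrACA; apply: le_trans (rnormD _ _) _.
  have h1 := gL a b a1 b1.
  have h2 : rnorm (g (- a) - g (- b)) <= L * cabs (a - b).
    have -> : cabs (a - b) = cabs (- a - - b) by rewrite -opprD cabsN.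
    by apply: gL; rewrite cabsN.
  have := ler_wpM2l L0 hab; lra.
have su := cabs_sqrt _ u1; have sw := cabs_sqrt _ w1.
have [] := sqrt_dist _ _ su sw; rewrite !sqrtCK.
- by apply: key => //; rewrite sqrtCK.
- move=> h; apply: (key (sqrtC u) (- sqrtC w)); rewrite ?sqrrN ?sqrtCK ?cabsN ?opprK //.
Qed.

Lemma iter_average_lipschitz g L n : 0 <= L -> lipschitz_on_circle g L ->
  lipschitz_on_circle (iter n average g) ((3 / 4) ^+ n * L).
Proof.
move=> L0 gL; elim: n => [|n IH]; first by rewrite expr0 mul1r.
rewrite iterS exprS -mulrA; apply: average_lipschitz => //.
by rewrite mulr_ge0 // exprn_ge0.
Qed.

(** For Lipschitz [g] this is the integral over the circle with normalised arc length. Uniformity in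
    the starting point [u] is what yields invariance under rotations. *)
Definition is_mean g (l : V) : Prop := forall e : R, 0 < e ->
  exists N, forall n u, (N <= n)%N -> cabs u = 1 -> rnorm (iter n average g u - l) <= e.

Lemma is_mean_unique g l l' : is_mean g l -> is_mean g l' -> l = l'.
Proof.
move=> gl gl'; apply/eqP; rewrite -subr_eq0; apply/eqP/rnorm_le0 => e e0.
have e2 : 0 < e / 2 by rewrite divr_gt0.
have [N hN] := gl _ e2; have [N' hN'] := gl' _ e2.
apply: le_trans (rdistD (iter (maxn N N') average g 1) _ _) _.
rewrite [leRHS]splitr lerD // ?(rnorm_sub l) ?hN ?hN' ?cabs1 ?leq_maxl ?leq_maxr //.
Qed.

(** The Lipschitz constants of the iterates decay like [(3 / 4) ^+ n]. Since 1 is a square root of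
    1, consecutive values at 1 differ by half the difference of two values of the same iterate. *)
Lemma is_mean_exists g L : 0 <= L -> lipschitz_on_circle g L -> exists l, is_mean g l.
Proof.
move=> L0 gL.
have iL n := iter_average_lipschitz _ _ n L0 gL.
have d2 u : cabs u = 1 -> cabs (u - 1) <= 2.
  by move=> u1; apply: le_trans (cabsD _ _) _; rewrite cabsN u1 cabs1; lra.
have [||n|l hl] := @geometric_cvg _ _ (fun n => iter n average g 1) L (3 / 4); [done|lra| |].
  rewrite iterS (averageE _ _ 1) ?expr1n //.
  have -> : 2^-1 *: (iter n average g 1 + iter n average g (-1)) - iter n average g 1 =
            2^-1 *: (iter n average g (-1) - iter n average g 1).
    by rewrite -[X in _ - X]half_add -scalerBr opprD addrACA subrr add0r.
  apply: half_le; apply: le_trans (iL _ _ _ _ cabs1) _; first by rewrite cabsN cabs1.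
  have := d2 (-1); rewrite cabsN cabs1 => /(_ erefl) h.
  apply: (@le_trans _ _ ((3 / 4) ^+ n * L * 2)); last by rewrite mulrC [L * _]mulrC.
  by rewrite ler_wpM2l // mulr_ge0 // exprn_ge0.
exists l => e e0.
(* The 2 bounds the distance from [u] to 1, and the 4 is the inverse of [1 - 3 / 4] in the tail of
   the geometric series. *)
have : (fun n => (3 / 4) ^+ n * (2 * L + 4 * L)) @ \oo --> (0 : R).
  rewrite -[X in _ --> X](mul0r (2 * L + 4 * L)); apply: cvgM; last exact: cvg_cst.
  by apply: cvg_expr; rewrite ger0_norm; lra.
move=> /cvgrPdist_le/(_ _ e0)[N _ hN]; exists N => n u /hN /=.
rewrite sub0r normrN => /(le_trans (ler_norm _)) he u1; apply: le_trans he.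
apply: le_trans (rdistD (iter n average g 1) _ _) _; rewrite mulrDr.
have p0 : 0 <= (3 / 4 : R) ^+ n by rewrite exprn_ge0.
apply: lerD.
  apply: le_trans (iL _ _ _ u1 cabs1) _; rewrite -mulrA ler_wpM2l // mulrC.
  by rewrite ler_wpM2r // d2.
apply: le_trans (hl _) _.
have -> : 1 - 3 / 4 = 4^-1 :> R by lra.
by rewrite invrK le_eqVlt; apply/orP; left; apply/eqP; ring.
Qed.

Lemma is_mean_linear g h l m (a : R[i]) : is_mean g l -> is_mean h m ->
  is_mean (fun u => a *: g u + h u) (a *: l + m).
Proof.
move=> gl hm e e0.
have iE n u : iter n average (fun u => a *: g u + h u) u =
    a *: iter n average g u + iter n average h u.
  elim: n u => //= n IH u; rewrite !averageE0 !IH addrACA -scalerDr [LHS]scalerDr !scalerA.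
  by rewrite (mulrC a).
have a1 : 0 < cabs a + 1 by have := cabs_ge0 a; lra.
have e2 : 0 < e / 2 by rewrite divr_gt0.
have [N hN] := gl _ (divr_gt0 e2 a1); have [N' hN'] := hm _ e2.
exists (maxn N N') => n u; rewrite geq_max => /andP[Nn N'n] u1; rewrite iE.
rewrite opprD addrACA -scalerBr; apply: le_trans (rnormD _ _) _.
rewrite [leRHS]splitr lerD ?hN' // rnormZ.
apply: (@le_trans _ _ ((cabs a + 1) * (e / 2 / (cabs a + 1)))).
  by rewrite ler_pM ?cabs_ge0 ?rnorm_ge0 ?hN //; lra.
by rewrite mulrC mulfVK ?gt_eqF.
Qed.

Lemma is_mean_ext g h l : (forall u, cabs u = 1 -> g u = h u) ->
  is_mean g l -> is_mean h l.
Proof.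
move=> gh gl e /gl[N hN]; exists N => n u Nn u1.
suff <- : iter n average g u = iter n average h u by exact: hN.
elim: n u u1 {Nn} => [|n IH] u u1 /=; first exact: gh.
by rewrite !averageE0 !IH // ?cabsN cabs_sqrt.
Qed.

Lemma is_mean_comp g l (f : {linear V -> V}) (K : R) : 0 <= K ->
  (forall x, rnorm (f x) <= K * rnorm x) -> is_mean g l ->
  is_mean (fun u => f (g u)) (f l).
Proof.
move=> K0 fK gl e e0.
have K1 : 0 < K + 1 by lra.
have [N hN] := gl _ (divr_gt0 e0 K1); exists N => n u Nn u1.
have -> : iter n average (fun u => f (g u)) u = f (iter n average g u).
  by elim: n u {Nn u1} => //= n IH u; rewrite !averageE0 !IH (linearZ_LR f) (linearD f).
rewrite -(linearB f); apply: le_trans (fK _) _.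
apply: (@le_trans _ _ ((K + 1) * (e / (K + 1)))).
  by rewrite ler_pM ?rnorm_ge0 ?hN //; lra.
by rewrite mulrC mulfVK ?gt_eqF.
Qed.

Lemma is_mean_bound g l (M : R) : (forall u, cabs u = 1 -> rnorm (g u) <= M) ->
  is_mean g l -> rnorm l <= M.
Proof.
move=> gM gl; apply/ler_addgt0Pr => e /gl[N /(_ N 1 (leqnn N) cabs1)] h.
have hb n u : cabs u = 1 -> rnorm (iter n average g u) <= M.
  elim: n u => [|n IH] u u1 /=; first exact: gM.
  apply: half_le; apply: le_trans (rnormD _ _) _; rewrite mulr2n mulrDl mul1r.
  by rewrite lerD // IH ?cabsN ?cabs_sqrt.
have := ler_rnorm_sub l (iter N average g 1); rewrite rnorm_sub.
have := hb N 1 cabs1; lra.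
Qed.

Lemma is_mean_rotate g l w : cabs w = 1 -> is_mean g l ->
  is_mean (fun u => g (w * u)) l.
Proof.
move=> w1 gl e /gl[N hN]; exists N => n u Nn u1.
have -> : iter n average (fun u => g (w * u)) u = iter n average g (w ^+ (2 ^ n) * u).
  elim: n u {Nn u1} => [|n IH] u /=; first by rewrite expn0 expr1.
  rewrite (averageE (iter n average g) _ (w ^+ (2 ^ n) * sqrtC u)); last first.
    by rewrite exprMn sqrtCK -exprM expnSr.
  by rewrite averageE0 !IH mulrN.
by apply: hN => //; rewrite cabsM cabsX w1 u1 expr1n mulr1.
Qed.

Lemma is_mean_average g l : is_mean (average g) l -> is_mean g l.
Proof.
move=> gl e /gl[N hN]; exists N.+1 => -[//|n] u; rewrite ltnS => Nn u1.
by rewrite iterSr hN.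
Qed.

Lemma is_mean0 : is_mean (fun=> 0) 0.
Proof.
move=> e e0; exists 0%N => n u _ _.
suff -> : iter n average (fun=> 0) u = 0 by rewrite subrr rnorm0 ltW.
by elim: n u => //= n IH u; rewrite /average !IH addr0 scaler0.
Qed.

(** An odd power cancels over the two square roots, and averaging an even power halves its exponent.
    The conditions on [f] allow both the identity and inversion. *)
Lemma is_mean_power (f : R[i] -> R[i]) (k : nat) (x : V) :
  (forall a, f (- a) = - f a) -> (forall a, f (a ^+ 2) = f a ^+ 2) -> (0 < k)%N ->
  is_mean (fun u => f u ^+ k *: x) 0.
Proof.
move=> fN fX; elim/ltn_ind: k => k IH k0; apply: is_mean_average.
have [ok|ek] := boolP (odd k).
  apply: (is_mean_ext (fun=> 0)); last exact: is_mean0.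
  move=> u _; rewrite /average fN exprNn -signr_odd ok expr1 mulN1r scaleNr subrr.
  by rewrite scaler0.
have kE : k = (k./2 * 2)%N by rewrite muln2 -[LHS]odd_double_half (negbTE ek).
apply: (is_mean_ext (fun u => f u ^+ k./2 *: x)); last by apply: IH; lia.
have hk u : f (sqrtC u) ^+ k = f u ^+ k./2 by rewrite {1}kE mulnC exprM -fX sqrtCK.
by move=> u _; rewrite averageE0 fN exprNn -signr_odd (negbTE ek) expr0 mul1r hk half_add.
Qed.

Definition mean g : V := xget 0 [set l | is_mean g l].

Lemma meanP g L : 0 <= L -> lipschitz_on_circle g L -> is_mean g (mean g).
Proof. by move=> L0 /(is_mean_exists _ _ L0)h; exact: xgetPex h. Qed.

End CircleMean.

(** * The Riesz projection *)

Lemma linear_bundle {R : realType} {V : normedModType R[i]} (f : V -> V) :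
  linear f -> exists g : {linear V -> V}, forall x, g x = f x.
Proof.
move=> fl; pose m := GRing.isLinear.Build R[i] V V *:%R f fl.
by pose g : {linear V -> V} := HB.pack f m; exists g.
Qed.

(** Over [n] equal pieces the increments add up to at most [C * (b - a) ^+ 2 / n%:R]. This takes the
    place of differentiation in the radius of a circle. *)
Lemma quadratic_constant {R : realType} {V : normedModType R[i]} (f : R -> V)
    (a b C : R) : 0 <= C -> a <= b ->
  (forall x y, a <= x <= b -> a <= y <= b -> rnorm (f x - f y) <= C * (x - y) ^+ 2) ->
  f a = f b.
Proof.
move=> C0 ab hf; apply/eqP; rewrite -subr_eq0; apply/eqP/rnorm_le0 => e e0.
pose D := C * (b - a) ^+ 2.
have D0 : 0 <= D by rewrite mulr_ge0 // sqr_ge0.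
have /Num.Theory.archi_boundP := divr_ge0 D0 (ltW e0).
set n := Num.bound _; rewrite ltr_pdivrMr // => hn.
have n0 : 0 < n%:R :> R.
  by rewrite lt0r ler0n andbT; apply: contraTneq hn => ->; rewrite mul0r -leNgt.
pose h := (b - a) / n%:R.
have h0 : 0 <= h by rewrite divr_ge0 // ?subr_ge0 // ltW.
have nh : n%:R * h = b - a by rewrite mulrC mulfVK // gt_eqF.
have step k : (k <= n)%N -> rnorm (f a - f (a + k%:R * h)) <= k%:R * (C * h ^+ 2).
  elim: k => [|k IH] kn; first by rewrite !mul0r addr0 subrr rnorm0.
  have kh m : (m <= n)%N -> a <= a + m%:R * h <= b.
    move=> mn; rewrite lerDl mulr_ge0 //= -lerBrDl -nh ler_wpM2r // ler_nat //.
  apply: le_trans (rdistD (f (a + k%:R * h)) _ _) _.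
  rewrite -natr1 [leRHS]mulrDl mul1r lerD ?IH // ?(ltnW kn) //.
  apply: le_trans (hf _ _ (kh _ (ltnW kn)) _) _; first by rewrite natr1 kh.
  have -> : a + k%:R * h - (a + (k%:R + 1) * h) = - h by ring.
  by rewrite sqrrN.
have := step n (leqnn n); rewrite nh subrKC => /le_trans; apply.
rewrite mulrCA expr2 [n%:R * (h * h)]mulrA nh -(ler_pM2r n0).
have -> : C * ((b - a) * h) * n%:R = C * (b - a) * (n%:R * h) by ring.
by rewrite nh -mulrA -expr2 -/D mulrC ltW.
Qed.

Section UnitPowers.
Context {R : realType}.

Lemma circle_neq0 (u : R[i]) : cabs u = 1 -> u != 0.
Proof. by move=> u1; rewrite -cabs_eq0 u1 oner_eq0. Qed.

Definition scalar_lipschitz (f : R[i] -> R[i]) : Prop :=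
  (forall u, cabs u = 1 -> cabs (f u) = 1) /\ exists2 L : R, 0 <= L &
  forall u w, cabs u = 1 -> cabs w = 1 -> cabs (f u - f w) <= L * cabs (u - w).

Lemma scalar_lipschitz_exp f k :
  scalar_lipschitz f -> scalar_lipschitz (fun u => f u ^+ k).
Proof.
move=> [f1 [L L0 fL]]; split; first by move=> u u1; rewrite cabsX f1 ?expr1n.
exists (k%:R * L); first by rewrite mulr_ge0.
move=> u w u1 w1; elim: k => [|k IH]; first by rewrite !expr0 subrr cabs0 !mul0r.
have -> : f u ^+ k.+1 - f w ^+ k.+1 = f u * (f u ^+ k - f w ^+ k) + (f u - f w) * f w ^+ k.
  by rewrite !exprS; ring.
apply: le_trans (cabsD _ _) _; rewrite !cabsM cabsX !f1 // expr1n mul1r mulr1.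
by rewrite -natr1 !mulrDl !mul1r lerD // fL.
Qed.

Lemma scalar_lipschitz_id : scalar_lipschitz id.
Proof. by split=> //; exists 1 => // u w _ _; rewrite mul1r. Qed.

Lemma scalar_lipschitz_inv : scalar_lipschitz GRing.inv.
Proof.
split; first by move=> u u1; rewrite cabsV u1 invr1.
exists 1 => // u w u1 w1.
have -> : u^-1 - w^-1 = (w - u) * (u^-1 * w^-1).
  by field; rewrite !circle_neq0.
by rewrite cabsM cabsM !cabsV u1 w1 invr1 !mulr1 mul1r cabs_sub.
Qed.

End UnitPowers.

Section RieszProjection.
Context {R : realType} {V : completeNormedModType R[i]} (T : {linear V -> V}).
Context (K0 : R) (K0_ge0 : 0 <= K0) (TK0 : forall x, rnorm (T x) <= K0 * rnorm x).
Context (r1 r2 : R) (r1_gt0 : 0 < r1) (r12 : r1 <= r2).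

(** [s] is the inverse of the spectral parameter: [res s] below inverts [1 - s T], and the circles
    of radius [rho^-1] with [r1 <= rho <= r2] fill this set. *)
Definition annulus (s : R[i]) : Prop := r2^-1 <= cabs s <= r1^-1.

Context (res : R[i] -> V -> V) (Kc : R) (Kc_ge0 : 0 <= Kc).
Hypothesis resP : forall s y, annulus s -> res s y - s *: T (res s y) = y.
Hypothesis resI : forall s x, annulus s -> x = s *: T x -> x = 0.
Hypothesis res_bound : forall s y, annulus s -> rnorm (res s y) <= Kc * rnorm y.

Lemma res_unique s x y : annulus s -> x - s *: T x = y -> x = res s y.
Proof.
move=> sA xy; apply/eqP; rewrite -subr_eq0; apply/eqP/(resI _ _ sA).
have /eqP := etrans xy (esym (resP s y sA)); rewrite subr_eq => /eqP h.
rewrite (linearB T) scalerBr [X in X - _]h.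
by rewrite addrAC [X in X - _ + _]addrC addrK addrC.
Qed.

Lemma res_linear s a x y : annulus s -> res s (a *: x + y) = a *: res s x + res s y.
Proof.
move=> sA; apply/esym/res_unique => //.
rewrite (linearP T) scalerDr scalerA [s * a]mulrC -scalerA opprD addrACA -scalerBr.
by rewrite !resP.
Qed.

Lemma resT s x : annulus s -> res s (T x) = T (res s x).
Proof.
by move=> sA; apply/esym/res_unique => //; rewrite -(linearZ_LR T) -(linearB T) resP.
Qed.

Lemma res_diff s t x : annulus s -> annulus t ->
  res s x - res t x = (s - t) *: T (res s (res t x)).
Proof.
move=> sA tA; set y := res t x.
apply/eqP; rewrite subr_eq; apply/eqP/esym/res_unique => //.
rewrite (linearD T) (linearZ_LR T) scalerDr opprD addrACA scalerA [s * _]mulrC.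
rewrite -scalerA -scalerBr -(linearZ_LR T) -(linearB T) resP // scalerBl.
by rewrite addrC addrA subrK /y resP.
Qed.

Definition on_circle (rho : R) (u : R[i]) : R[i] := u * (rho^-1)%:C.

Lemma on_circle_annulus rho u : r1 <= rho <= r2 -> cabs u = 1 ->
  annulus (on_circle rho u).
Proof.
move=> /andP[h1 h2] u1; have rho0 : 0 < rho := lt_le_trans r1_gt0 h1.
rewrite /annulus /on_circle cabsM u1 mul1r cabs_real ger0_norm ?invr_ge0 ?(ltW rho0) //.
by rewrite !lef_pV2 ?h1 ?h2 // posrE // (lt_le_trans rho0).
Qed.

Definition weighted rho (f : R[i] -> R[i]) (x : V) (u : R[i]) : V :=
  f u *: res (on_circle rho u) x.

(* The Laurent coefficients of the resolvent are obtained from weights [f] that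
   are powers of [u] or of [u^-1]. *)
Definition coef rho f x : V := mean (weighted rho f x).

Lemma res_lipschitz rho x u w : r1 <= rho <= r2 -> cabs u = 1 -> cabs w = 1 ->
  rnorm (res (on_circle rho u) x - res (on_circle rho w) x) <=
  (rho^-1 * K0 * Kc * Kc * rnorm x) * cabs (u - w).
Proof.
move=> hr u1 w1; have rho0 : 0 < rho by case/andP: hr => h _; exact: lt_le_trans h.
rewrite res_diff; try exact: on_circle_annulus.
rewrite rnormZ -mulrBl cabsM cabs_real ger0_norm ?invr_ge0 ?(ltW rho0) //.
rewrite [leRHS]mulrC -!mulrA ler_wpM2l ?cabs_ge0 // ler_wpM2l ?invr_ge0 ?(ltW rho0) //.
apply: le_trans (TK0 _) _; rewrite ler_wpM2l //.
apply: le_trans (res_bound _ _ (on_circle_annulus _ _ hr u1)) _; rewrite ler_wpM2l //.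
exact: res_bound (on_circle_annulus _ _ hr w1).
Qed.

Lemma coefP rho f x : r1 <= rho <= r2 -> scalar_lipschitz f ->
  is_mean (weighted rho f x) (coef rho f x).
Proof.
move=> hr [f1 [L L0 fL]].
have rho0 : 0 < rho by case/andP: hr => h _; exact: lt_le_trans h.
apply: (meanP _ (rho^-1 * K0 * Kc * Kc * rnorm x + L * (Kc * rnorm x))).
  by rewrite addr_ge0 // !mulr_ge0 ?rnorm_ge0 // invr_ge0 ltW.
move=> u w u1 w1; rewrite /weighted.
set a := res _ x; set b := res _ x.
have -> : f u *: a - f w *: b = f u *: (a - b) + (f u - f w) *: b.
  by rewrite scalerBr scalerBl addrA subrK.
apply: le_trans (rnormD _ _) _; rewrite !rnormZ f1 // mul1r mulrDl lerD //.
  exact: res_lipschitz.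
rewrite mulrAC ler_pM ?cabs_ge0 ?rnorm_ge0 ?fL //.
exact: res_bound (on_circle_annulus _ _ hr w1).
Qed.

Lemma coef_linear rho f a x y : r1 <= rho <= r2 -> scalar_lipschitz f ->
  coef rho f (a *: x + y) = a *: coef rho f x + coef rho f y.
Proof.
move=> hr fL; apply: is_mean_unique (coefP _ _ _ hr fL) _.
apply: (is_mean_ext (fun u => a *: weighted rho f x u + weighted rho f y u)).
  move=> u u1; rewrite /weighted res_linear; last exact: on_circle_annulus.
  by rewrite scalerDr !scalerA mulrC.
by apply: is_mean_linear; exact: coefP.
Qed.

Lemma coef_bound rho f x : r1 <= rho <= r2 -> scalar_lipschitz f ->
  rnorm (coef rho f x) <= Kc * rnorm x.
Proof.
move=> hr fL; apply: is_mean_bound (coefP _ _ _ hr fL) => u u1.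
rewrite rnormZ fL.1 // mul1r; exact: res_bound (on_circle_annulus _ _ hr u1).
Qed.

Lemma coef_comm rho f x : r1 <= rho <= r2 -> scalar_lipschitz f ->
  coef rho f (T x) = T (coef rho f x).
Proof.
move=> hr fL; apply: is_mean_unique (coefP _ _ _ hr fL) _.
apply: (is_mean_ext (fun u => T (weighted rho f x u))).
  move=> u u1; rewrite /weighted resT; last exact: on_circle_annulus.
  by rewrite (linearZ_LR T).
by apply: is_mean_comp TK0 _ => //; exact: coefP.
Qed.

(** With [s = on_circle rho u], the equation [res s x - s *: T (res s x) = x] expresses
    [T (res s x)] as [rho%:C * u^-1] times [res s x - x]; multiply by [f u] and take means. *)
Lemma coef_shift rho f x m : r1 <= rho <= r2 -> scalar_lipschitz f ->
  scalar_lipschitz (fun u => f u * u^-1) -> is_mean (fun u => (f u * u^-1) *: x) m ->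
  T (coef rho f x) = rho%:C *: (coef rho (fun u => f u * u^-1) x - m).
Proof.
move=> hr fL f'L xm.
have rho0 : 0 < rho by case/andP: hr => h _; exact: lt_le_trans h.
apply: is_mean_unique.
  by apply: (is_mean_comp _ _ T K0) => //; exact: coefP.
apply: (is_mean_ext (fun u => rho%:C *: (weighted rho (fun u => f u * u^-1) x u - (f u * u^-1) *: x) + 0)).
  move=> u u1; have u0 := circle_neq0 _ u1; rewrite addr0 /weighted -scalerBr.
  have := resP _ x (on_circle_annulus _ _ hr u1); set y := res _ x => h.
  rewrite -{1}h subKr !scalerA (linearZ_LR T); congr (_ *: _).
  rewrite /on_circle; have -> : rho%:C * (f u / u) * (u * (rho^-1)%:C) = f u * (u / u) * (rho%:C * (rho^-1)%:C) by ring.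
  by rewrite divff // -rmorphM divff ?gt_eqF //= !mulr1.
rewrite -[X in is_mean _ X]addr0; apply: is_mean_linear; last exact: is_mean0.
apply: (is_mean_ext (fun u => -1 *: ((f u * u^-1) *: x) + weighted rho (fun u => f u * u^-1) x u)).
  by move=> u _; rewrite scaleN1r addrC.
rewrite (_ : _ - m = -1 *: m + coef rho (fun u => f u * u^-1) x); last by rewrite scaleN1r addrC.
by apply: is_mean_linear => //; exact: coefP.
Qed.

(** With [Q = pcoef rho 0], which will be the projection onto the part inside the circle of radius
    [rho], [pcoef rho k] is [rho ^- k] times [T ^ k Q]. For [k > 0], [ncoef rho k] is [- rho ^+ k]
    times the [k]-th power of the inverse of [T] on the complementary part, applied to [1 - Q]. *)
Definition pcoef rho k := coef rho (fun u => u^-1 ^+ k).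
Definition ncoef rho k := coef rho (fun u => u ^+ k).

Lemma inv_powerP k : scalar_lipschitz (fun u : R[i] => u^-1 ^+ k).
Proof. exact/scalar_lipschitz_exp/scalar_lipschitz_inv. Qed.

Lemma powerP k : scalar_lipschitz (fun u : R[i] => u ^+ k).
Proof. exact/scalar_lipschitz_exp/scalar_lipschitz_id. Qed.

Lemma coef_ext rho f g x : (forall u, cabs u = 1 -> f u = g u) ->
  r1 <= rho <= r2 -> scalar_lipschitz f -> scalar_lipschitz g ->
  coef rho f x = coef rho g x.
Proof.
move=> fg hr fL gL; apply: is_mean_unique (coefP _ _ _ hr gL).
by apply: is_mean_ext (coefP _ _ _ hr fL) => u u1; rewrite /weighted fg.
Qed.

Lemma scalar_lipschitz_ext (f g : R[i] -> R[i]) : (forall u, cabs u = 1 -> f u = g u) ->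
  scalar_lipschitz f -> scalar_lipschitz g.
Proof.
move=> fg [f1 [L L0 fL]]; split; first by move=> u u1; rewrite -fg ?f1.
by exists L => // u w u1 w1; rewrite -!fg // fL.
Qed.

Lemma pcoefS rho k x : r1 <= rho <= r2 -> T (pcoef rho k x) = rho%:C *: pcoef rho k.+1 x.
Proof.
move=> hr.
have E (u : R[i]) : cabs u = 1 -> u^-1 ^+ k.+1 = u^-1 ^+ k * u^-1 by rewrite exprSr.
have hL := scalar_lipschitz_ext _ _ E (inv_powerP k.+1).
rewrite /pcoef (coef_shift _ _ _ 0 hr (inv_powerP k) hL); last first.
  apply: (is_mean_ext (fun u => u^-1 ^+ k.+1 *: x)); first by move=> u /E ->.
  by apply: is_mean_power => // a; rewrite ?invrN ?exprVn.
by rewrite subr0 (coef_ext _ _ _ _ E hr (inv_powerP k.+1) hL).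
Qed.

(** The exceptional term at [k = 0] is the mean of the constant function [x]; the complementary
    projection originates from it. *)
Lemma ncoefS rho k x : r1 <= rho <= r2 ->
  T (ncoef rho k.+1 x) = rho%:C *: (ncoef rho k x - (if k == 0%N then x else 0)).
Proof.
move=> hr.
have E (u : R[i]) : cabs u = 1 -> u ^+ k = u ^+ k.+1 * u^-1.
  by move=> u1; rewrite exprSr mulfK // circle_neq0.
have hL := scalar_lipschitz_ext _ _ E (powerP k).
rewrite /ncoef (coef_shift _ _ _ (if k == 0%N then x else 0) hr (powerP k.+1) hL); last first.
  apply: (is_mean_ext (fun u => u ^+ k *: x)); first by move=> u /E ->.
  case: (posnP k) => [->|k0]; last exact: is_mean_power.
  move=> e e0; exists 0%N => n u _ _.
  suff -> : iter n average (fun u0 => u0 ^+ 0 *: x) u = x by rewrite subrr rnorm0 ltW.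
  by elim: n u => [|n IH] u /=; rewrite ?scale1r // averageE0 !IH half_add.
by rewrite (coef_ext _ _ _ _ E hr (powerP k) hL).
Qed.

Lemma iter_pcoef rho n x : r1 <= rho <= r2 ->
  iter n T (pcoef rho 0 x) = (rho ^+ n)%:C *: pcoef rho n x.
Proof.
move=> hr; elim: n => [|n IH]; first by rewrite expr0 scale1r.
by rewrite iterS IH (linearZ_LR T) /= pcoefS // scalerA -rmorphM -exprSr.
Qed.

Lemma iterL n a x y : iter n T (a *: x + y) = a *: iter n T x + iter n T y.
Proof. by elim: n => //= n ->; rewrite (linearP T). Qed.

Lemma iterZ n a x : iter n T (a *: x) = a *: iter n T x.
Proof.
have i0 : iter n T 0 = 0 by elim: n => //= n ->; rewrite (linear0 T).
by have := iterL n a x 0; rewrite i0 !addr0.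
Qed.

Lemma iter_ncoef rho n x : r1 <= rho <= r2 ->
  iter n.+1 T (ncoef rho n.+1 x) = (rho ^+ n.+1)%:C *: (pcoef rho 0 x - x).
Proof.
move=> hr; elim: n => [|n IH]; first by rewrite /= ncoefS // expr1.
rewrite iterSr ncoefS // subr0 iterZ IH scalerA -rmorphM -exprS //.
Qed.

Definition sT_res s (y : V) : V := s *: T (res s y).

Lemma sT_res_bound s y : annulus s -> rnorm (sT_res s y) <= r1^-1 * K0 * Kc * rnorm y.
Proof.
move=> sA; rewrite /sT_res rnormZ -!mulrA; case/andP: (sA) => _ h.
have h2 : rnorm (T (res s y)) <= K0 * (Kc * rnorm y).
  by apply: le_trans (TK0 _) _; rewrite ler_wpM2l // res_bound.
by apply: ler_pM; rewrite ?cabs_ge0 ?rnorm_ge0.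
Qed.

(** The resolvent identity inserted into itself. The coefficient of [eta] does not depend on [eta],
    hence is common to radial and angular changes of [s]. *)
Lemma res_second_order s eta x : annulus s -> annulus ((1 + eta) * s) ->
  res ((1 + eta) * s) x - res s x = eta *: sT_res s (res s x) +
    (eta ^+ 2) *: sT_res s (sT_res s (res ((1 + eta) * s) x)).
Proof.
move=> sA tA; set y := res _ x.
have E : y - res s x = eta *: sT_res s y.
  rewrite -opprB /y res_diff // -scaleNr /sT_res scalerA; congr (_ *: _); ring.
have yE : y = eta *: sT_res s y + res s x by rewrite -E subrK.
rewrite E {1}yE /sT_res res_linear // (linearP T) !scalerDr !scalerA addrC.
by congr (_ + _); congr (_ *: _); ring.
Qed.

(** The Cayley transform [(1 + i e / 2) / (1 - i e / 2)] has modulus 1 and differs from 1 by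
    [i e / (1 - i e / 2)]. *)
Lemma small_rotation (e : R) : 0 < e ->
  exists w : R[i], [/\ cabs w = 1, w != 1 & cabs (w - 1) <= e].
Proof.
move=> e0; pose a : R[i] := 1 +i* (e / 2); pose b : R[i] := 1 -i* (e / 2).
have ab : cabs a = cabs b.
  by apply: complexI; rewrite -!cabsE !normc_def /= sqrrN.
have b1 : 1 <= cabs b.
  rewrite -lecR -cabsE normc_def lecR /= -[leLHS]sqrtr1 expr1n ler_sqrt ?lerDl ?sqr_ge0 //.
  by rewrite addr_ge0 // sqr_ge0.
have bg0 : 0 < cabs b := lt_le_trans ltr01 b1.
have b0 : b != 0 by rewrite -cabs_eq0 gt_eqF.
have E : a / b - 1 = (a - b) / b by rewrite mulrBl divff.
have ab2 : a - b = 0 +i* e.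
  by apply/eqP; rewrite eq_complex /= subrr eqxx /= opprK -splitr.
have cab : cabs (a - b) = e.
  by apply: complexI; rewrite -cabsE normc_def ab2 /= expr0n /= add0r sqrtr_sqr gtr0_norm.
exists (a / b); split.
- by rewrite cabsM cabsV ab divff // gt_eqF.
- by rewrite -subr_eq0 E -cabs_eq0 cabsM cabsV cab mulf_neq0 ?invr_eq0 ?gt_eqF.
- by rewrite E cabsM cabsV cab ler_piMr ?(ltW e0) // invf_le1.
Qed.

(* The first-order radial variation of the resolvent is a multiple of its
   angular variation, whose mean is zero. *)
Lemma pcoef0_const rho rho' x : r1 <= rho -> rho <= rho' -> rho' <= r2 ->
  pcoef rho 0 x = pcoef rho' 0 x.
Proof.
move=> h1 h12 h2.
pose K := r1^-1 * K0 * Kc.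
have K_ge0 : 0 <= K by rewrite !mulr_ge0 // invr_ge0 ltW.
pose C := 2 * (K * (K * (Kc * rnorm x))) * r1^-1 ^+ 2.
have C_ge0 : 0 <= C.
  apply: mulr_ge0; last by rewrite exprn_ge0 // invr_ge0 ltW.
  by do 4!(apply: mulr_ge0 => //); exact: rnorm_ge0.
apply: (quadratic_constant (fun r => pcoef r 0 x) rho rho' C) => //.
move=> a b /andP[ra ar] /andP[rb br].
have hra : r1 <= a <= r2 by rewrite (le_trans h1 ra) (le_trans ar h2).
have hrb : r1 <= b <= r2 by rewrite (le_trans h1 rb) (le_trans br h2).
have [->|ab] := eqVneq a b; first by rewrite !subrr rnorm0 expr0n mulr0.
have a0 : 0 < a by case/andP: hra => h _; exact: lt_le_trans h.
have b0 : 0 < b by case/andP: hrb => h _; exact: lt_le_trans h.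
(* Passing from radius [a] to radius [b] multiplies the parameter by [1 + t]. *)
pose t := a / b - 1.
have tE : t = (a - b) / b by rewrite /t mulrBl divff ?gt_eqF.
have t0 : 0 < `|t| by rewrite normr_gt0 tE mulf_neq0 ?subr_eq0 // invr_eq0 gt_eqF.
have tab : `|t| <= `|a - b| * r1^-1.
  rewrite tE normrM ler_wpM2l // normfV gtr0_norm // lef_pV2 ?posrE //.
  by case/andP: hrb.
have [w [w1 wn1 wt]] := small_rotation _ t0.
have h0 : w - 1 != 0 by rewrite subr_eq0.
pose wa := weighted a (fun u => u^-1 ^+ 0) x; pose wb := weighted b (fun u => u^-1 ^+ 0) x.
pose c := t%:C / (w - 1).
have Ma : is_mean wa (pcoef a 0 x) by apply: coefP => //; exact: inv_powerP.
have Mb : is_mean wb (pcoef b 0 x) by apply: coefP => //; exact: inv_powerP.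
have M := is_mean_linear _ _ _ _ (- c) (is_mean_linear _ _ _ _ (-1) Ma (is_mean_rotate _ _ _ w1 Ma)) (is_mean_linear _ _ _ _ (-1) Ma Mb).
rewrite rnorm_sub.
have -> : pcoef b 0 x - pcoef a 0 x = - c *: (-1 *: pcoef a 0 x + pcoef a 0 x) + (-1 *: pcoef a 0 x + pcoef b 0 x).
  by rewrite !scaleN1r addNr scaler0 add0r addrC.
apply: (is_mean_bound _ _ _ _ M) => u u1.
have sA := on_circle_annulus _ _ hra u1.
have tA : annulus ((1 + t%:C) * on_circle a u).
  have -> : (1 + t%:C) * on_circle a u = on_circle b u.
    rewrite /on_circle mulrCA; congr (_ * _).
    by rewrite -[1]/(1%:C) -rmorphD -rmorphM /t subrKC mulrAC divff ?gt_eqF // mul1r.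
  exact: on_circle_annulus.
have wu1 : cabs (w * u) = 1 by rewrite cabsM w1 u1 mulr1.
have sE : on_circle a (w * u) = (1 + (w - 1)) * on_circle a u by rewrite /on_circle subrKC mulrA.
have wA : annulus ((1 + (w - 1)) * on_circle a u) by rewrite -sE; exact: on_circle_annulus.
rewrite /wa /wb /weighted !expr0 !scale1r sE.
have -> : on_circle b u = (1 + t%:C) * on_circle a u.
  rewrite /on_circle mulrCA; congr (_ * _).
  by rewrite -[1]/(1%:C) -rmorphD -rmorphM /t subrKC mulrAC divff ?gt_eqF // mul1r.
have comb (D E1 E2 : V) : - c *: ((w - 1) *: D + (w - 1) ^+ 2 *: E1) + (t%:C *: D + t%:C ^+ 2 *: E2) =
    (t%:C ^+ 2) *: E2 + (- (t%:C * (w - 1))) *: E1.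
  rewrite scalerDr !scalerA addrACA -scalerDl.
  have -> : - c * (w - 1) + t%:C = 0 by rewrite /c mulNr mulfVK // addNr.
  rewrite scale0r add0r addrC.
  have -> : - c * (w - 1) ^+ 2 = - (t%:C * (w - 1)); last by [].
  by rewrite expr2 mulrA mulNr /c mulfVK // mulNr.
rewrite !scaleN1r ![- res _ x + _]addrC !res_second_order //.
have Eb z : annulus z -> rnorm (sT_res (on_circle a u) (sT_res (on_circle a u) (res z x))) <= K * (K * (Kc * rnorm x)).
  move=> zA; apply: le_trans (sT_res_bound _ _ sA) _; rewrite -/K ler_wpM2l //.
  apply: le_trans (sT_res_bound _ _ sA) _; rewrite -/K ler_wpM2l //; exact: res_bound.
have := Eb _ wA; have := Eb _ tA.
move: (sT_res _ (res _ x)) (sT_res _ (sT_res _ (res ((1 + (w - 1)) * _) x))) (sT_res _ (sT_res _ (res ((1 + t%:C) * _) x))) => D E1 E2 e2 e1.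
rewrite comb.
apply: le_trans (rnormD _ _) _; rewrite !rnormZ cabsN cabsX cabsM cabs_real.
have M0 : 0 <= K * (K * (Kc * rnorm x)) by do 3!(apply: mulr_ge0 => //); exact: rnorm_ge0.
have -> : C * (a - b) ^+ 2 = 2 * (K * (K * (Kc * rnorm x))) * (`|a - b| * r1^-1) ^+ 2.
  by rewrite /C exprMn real_normK ?num_real //; ring.
move: (`|a - b| * r1^-1) (K * _) tab M0 e1 e2 => p M2 tab M0 e1 e2.
have p0 : 0 <= p := le_trans (normr_ge0 _) tab.
have q1 : `|t| ^+ 2 * rnorm E2 <= p ^+ 2 * M2.
  by rewrite ler_pM ?exprn_ge0 ?rnorm_ge0 // ler_pXn2r ?nnegrE.
have q2 : `|t| * cabs (w - 1) * rnorm E1 <= p ^+ 2 * M2.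
  rewrite ler_pM ?mulr_ge0 ?cabs_ge0 ?rnorm_ge0 // expr2 ler_pM ?cabs_ge0 //.
  exact: le_trans wt tab.
have -> : 2 * M2 * p ^+ 2 = p ^+ 2 * M2 + p ^+ 2 * M2 by ring.
exact: lerD.
Qed.

Lemma stable_iter n x : rnorm (iter n T (pcoef r1 0 x)) <= Kc * r1 ^+ n * rnorm x.
Proof.
have hr : r1 <= r1 <= r2 by rewrite lexx.
rewrite iter_pcoef // rnormZ cabs_real ger0_norm ?exprn_ge0 ?(ltW r1_gt0) //.
rewrite (_ : Kc * _ * _ = r1 ^+ n * (Kc * rnorm x)); last by ring.
rewrite ler_wpM2l ?exprn_ge0 ?(ltW r1_gt0) //; exact: coef_bound hr (inv_powerP n).
Qed.

Lemma central_iter n x : (0 < n)%N ->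
  iter n T (ncoef r2 n x) = (r2 ^+ n)%:C *: (pcoef r1 0 x - x).
Proof.
case: n => // n _; rewrite iter_ncoef; last by rewrite r12 lexx.
by rewrite (pcoef0_const r1 r2).
Qed.

Lemma pcoef0_comm x : pcoef r1 0 (T x) = T (pcoef r1 0 x).
Proof. by apply: coef_comm; [rewrite lexx|exact: inv_powerP]. Qed.

(** Write [Q = pcoef r1 0] and [y = Q x - x]. Then [r2 ^+ n] times [y] is [iter n T z] with
    [rnorm z <= Kc * rnorm x], whereas [iter n T] is of order [r1 ^+ n] on the range of [Q]. So
    [Q y] is at most a constant times [(r1 / r2) ^+ n] for every [n > 0], and vanishes. *)
Lemma pcoef0_proj x : r1 < r2 -> pcoef r1 0 (pcoef r1 0 x) = pcoef r1 0 x.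
Proof.
move=> r12'; have r2_gt0 := lt_trans r1_gt0 r12'.
have hr : r1 <= r1 <= r2 by rewrite lexx.
have L a y z : pcoef r1 0 (a *: y + z) = a *: pcoef r1 0 y + pcoef r1 0 z.
  by apply: coef_linear => //; exact: inv_powerP.
have iterQ n y : pcoef r1 0 (iter n T y) = iter n T (pcoef r1 0 y).
  by elim: n => //= n <-; rewrite pcoef0_comm.
set y := pcoef r1 0 x - x.
suff y0 : pcoef r1 0 y = 0.
  have := L (-1) x (pcoef r1 0 x); rewrite !scaleN1r addrC -/y y0 addrC => /esym/eqP.
  by rewrite subr_eq0 => /eqP.
apply: rnorm_le0 => e e0.
pose q := r1 / r2.
have q01 : 0 <= q < 1 by rewrite divr_ge0 ?ltW //= ltr_pdivrMr ?mul1r.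
have key n : rnorm (pcoef r1 0 y) <= Kc * (Kc * rnorm x) * q ^+ n.+1.
  have := central_iter n.+1 x erefl; rewrite -/y => h.
  have r2n : 0 < r2 ^+ n.+1 by rewrite exprn_gt0.
  rewrite /q expr_div_n (mulrA _ (r1 ^+ n.+1)) ler_pdivlMr //.
  have -> : rnorm (pcoef r1 0 y) * r2 ^+ n.+1 = rnorm (pcoef r1 0 (iter n.+1 T (ncoef r2 n.+1 x))).
    rewrite h; have := L ((r2 ^+ n.+1)%:C) y 0.
    have -> : pcoef r1 0 0 = 0 by have := L (-1) 0 0; rewrite !scaleN1r oppr0 addr0 addNr.
    by rewrite !addr0 => ->; rewrite rnormZ cabs_real ger0_norm ?ltW // mulrC.
  rewrite iterQ; apply: le_trans (stable_iter _ _) _.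
  rewrite mulrAC ler_wpM2r ?exprn_ge0 ?(ltW r1_gt0) // ler_wpM2l //.
  by apply: coef_bound (powerP _); rewrite r12 lexx.
have : (fun n => Kc * (Kc * rnorm x) * q ^+ n) @ \oo --> (0 : R).
  rewrite -[X in _ --> X](mulr0 (Kc * (Kc * rnorm x))); apply: cvgM; first exact: cvg_cst.
  by apply: cvg_expr; case/andP: q01 => h h'; rewrite ger0_norm.
move=> /cvgrPdist_le/(_ _ e0)[N _ /(_ N.+1 (leqnSn N))] /=; rewrite sub0r normrN => h.
exact: le_trans (key N) (le_trans (ler_norm _) h).
Qed.

End RieszProjection.

(** [Q] projects onto the contracting part, and [S] inverts [T] on the kernel of [Q]. In
    [split_central] the rate may be taken arbitrarily close to 1 at the price of the constant: this
    is the subexponential growth of the inverse. *)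
Record spectral_splitting {R : realType} {V : completeNormedModType R[i]}
    (T Q S : {linear V -> V}) (r : R) : Prop := SpectralSplitting {
  split_rate : 0 < r < 1;
  split_bounded : exists2 K, 0 <= K & forall x, rnorm (Q x) <= K * rnorm x;
  split_proj : forall x, Q (Q x) = Q x;
  split_comm : forall x, Q (T x) = T (Q x);
  split_right : forall x, T (S x) = x - Q x;
  split_left : forall x, S (T x) = x - Q x;
  split_QS : forall x, Q (S x) = 0;
  split_stable : exists2 C, 0 <= C & forall n x, rnorm (iter n T (Q x)) <= C * r ^+ n * rnorm x;
  split_central : forall rho, r <= rho < 1 -> exists2 C, 0 <= C &
    forall n x, rnorm (iter n S (x - Q x)) <= C * rho ^- n * rnorm x }.

Theorem compact_spectral_splitting {R : realType} {G : set_system nat} {GU : UltraFilter G}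
    (Goo : [set A | \forall n \near \oo, A n] `<=` G)
    {V : completeNormedModType R[i]} (T : {linear V -> V}) (K0 : R) :
  0 <= K0 -> (forall x, rnorm (T x) <= K0 * rnorm x) -> ultracompact (G := G) T ->
  exists Q S r, spectral_splitting T Q S r.
Proof.
move=> K0_ge0 TK0 Tc.
have [r /andP[r0 r1] rfree] := eigenvalue_free_annulus Goo _ Tc _ TK0 K0_ge0.
have free rho s x : r <= rho -> rho < 1 -> annulus r rho s -> x = s *: T x -> x = 0.
  move=> rrho rho1 /andP[sA1 sA2] sx; have rho0 : 0 < rho := lt_le_trans r0 rrho.
  have c0 : 0 < cabs s by apply: lt_le_trans sA1; rewrite invr_gt0.
  have s0 : s != 0 by rewrite -cabs_eq0 gt_eqF.
  apply: (rfree s^-1); last by rewrite {2}sx scalerA mulVf // scale1r.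
  rewrite cabsV; apply/andP; split; first by rewrite -[leLHS]invrK lef_pV2 ?posrE ?invr_gt0.
  by apply: le_lt_trans rho1; rewrite -[leRHS]invrK lef_pV2 ?posrE ?invr_gt0.
have onto s y : exists x, r <= (cabs s)^-1 < 1 -> x - s *: T x = y.
  have [h1|h] := boolP (r <= (cabs s)^-1 < 1); last by exists 0.
  have c0 : 0 < cabs s.
    by rewrite -invr_gt0; case/andP: h1 => h1 _; exact: lt_le_trans h1.
  case/andP: h1 => h1 h2.
  have V0 : 0 < (cabs s)^-1^-1 by rewrite invrK.
  have sA : (cabs s)^-1^-1 <= cabs s <= r^-1.
    by rewrite invrK lexx -[leLHS]invrK lef_pV2 ?posrE ?invr_gt0.
  have [x hx] := resolvent_onto Goo T Tc _ TK0 K0_ge0 _ _ V0 (fun t x => free _ t x h1 h2) s y sA.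
  by exists x.
(* The resolvent is chosen once for all parameters with [r <= (cabs s)^-1 < 1], so that the
   projection at radius [r] is the same for every outer radius [rho] used below. *)
have [res hres] : exists res : R[i] -> V -> V, forall s y,
    r <= (cabs s)^-1 < 1 -> res s y - s *: T (res s y) = y.
  have /choice[f hf] s : exists g : V -> V, forall y,
      r <= (cabs s)^-1 < 1 -> g y - s *: T (g y) = y.
    by have [g hg] := choice (onto s); exists g.
  by exists f.
have bundle rho : r <= rho -> rho < 1 ->
    (forall s y, annulus r rho s -> res s y - s *: T (res s y) = y) /\
    exists2 Kc, 0 <= Kc & forall s y, annulus r rho s -> rnorm (res s y) <= Kc * rnorm y.
  move=> rrho rho1; have rho0 : 0 < rho := lt_le_trans r0 rrho.
  have resP s y : annulus r rho s -> res s y - s *: T (res s y) = y.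
    move=> /andP[sA1 sA2]; apply: hres.
    have c0 : 0 < cabs s by apply: lt_le_trans sA1; rewrite invr_gt0.
    apply/andP; split; first by rewrite -[leLHS]invrK lef_pV2 ?posrE ?invr_gt0.
    by apply: le_lt_trans rho1; rewrite -[leRHS]invrK lef_pV2 ?posrE ?invr_gt0.
  split => //.
  have [c c0 hc] := resolvent_lower_bound Goo T Tc _ TK0 K0_ge0 _ _ (fun s x => free rho s x rrho rho1).
  exists c^-1; first by rewrite invr_ge0 ltW.
  by move=> s y sA; rewrite ler_pdivlMl // -{2}(resP s y sA); exact: hc.
pose rho1 := (r + 1) / 2.
have rr1 : r < rho1 by rewrite /rho1; lra.
have r11 : rho1 < 1 by rewrite /rho1; lra.
have [resP [Kc Kc_ge0 resB]] := bundle _ (ltW rr1) r11.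
have resI s x : annulus r rho1 s -> x = s *: T x -> x = 0 := free _ s x (ltW rr1) r11.
have hr : r <= r <= rho1 by rewrite lexx ltW.
have [Q QE] : exists Q : {linear V -> V}, forall x, Q x = pcoef res r 0 x.
  apply: linear_bundle => a x y.
  exact: (coef_linear T _ K0_ge0 TK0 _ _ r0 res Kc Kc_ge0 resP resI resB _ _ _ _ _ hr (inv_powerP 0)).
have QT x : Q (T x) = T (Q x).
  rewrite !QE; exact: (pcoef0_comm T _ K0_ge0 TK0 _ _ r0 (ltW rr1) res Kc Kc_ge0 resP resI resB).
have QQ x : Q (Q x) = Q x.
  rewrite !QE; exact: (pcoef0_proj T _ K0_ge0 TK0 _ _ r0 (ltW rr1) res Kc Kc_ge0 resP resI resB _ rr1).
have [N NE] : exists N : {linear V -> V}, forall x, N x = ncoef res r 1 x.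
  apply: linear_bundle => a x y.
  exact: (coef_linear T _ K0_ge0 TK0 _ _ r0 res Kc Kc_ge0 resP resI resB _ _ _ _ _ hr (powerP 1)).
have NT x : N (T x) = T (N x).
  rewrite !NE; exact: (coef_comm T _ K0_ge0 TK0 _ _ r0 res Kc Kc_ge0 resP resI resB _ _ _ hr (powerP 1)).
have TN x : T (N x) = r%:C *: (Q x - x).
  rewrite NE (ncoefS T _ K0_ge0 TK0 _ _ r0 res Kc Kc_ge0 resP resI resB _ _ _ hr) QE //.
have [S0 S0E] : exists S : {linear V -> V}, forall x, S x = - (r^-1)%:C *: N x.
  by apply: linear_bundle => a x y; rewrite (linearP N) scalerDr !scalerA mulrC.
have TS0 x : T (S0 x) = x - Q x.
  rewrite S0E (linearZ_LR T) /= TN scalerA mulNr -rmorphM mulVf ?gt_eqF //=.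
  by rewrite scaleN1r opprB.
have S0T x : S0 (T x) = x - Q x.
  by rewrite -TS0 !S0E NT (linearZ_LR T).
(* Removing the [Q]-component puts the range into the kernel of [Q] and leaves the products with [T]
   on either side unchanged. *)
have [S SE] : exists S : {linear V -> V}, forall x, S x = S0 x - Q (S0 x).
  by apply: linear_bundle => a x y; rewrite !(linearP S0) !(linearP Q) opprD addrACA -scalerBr.
have TS x : T (S x) = x - Q x.
  rewrite SE (linearB T) -QT TS0 (linearB Q) QQ subrr subr0 //.
have ST x : S (T x) = x - Q x.
  by rewrite SE S0T (linearB Q) QQ subrr subr0.
have QS x : Q (S x) = 0 by rewrite SE (linearB Q) QQ subrr.
exists Q, S, r; split => //.
- by rewrite r0.
- exists Kc => // x; rewrite QE.
  exact: (coef_bound T _ K0_ge0 TK0 _ _ r0 res Kc Kc_ge0 resP resI resB _ _ _ hr (inv_powerP 0)).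
- exists Kc => // n x; rewrite QE.
  exact: (stable_iter T _ K0_ge0 TK0 _ _ r0 (ltW rr1) res Kc Kc_ge0 resP resI resB).
- move=> rho /andP[rrho rho_lt1].
  have [resP' [Kc' Kc'_ge0 resB']] := bundle _ rrho rho_lt1.
  have resI' s x : annulus r rho s -> x = s *: T x -> x = 0 := free _ s x rrho rho_lt1.
  have rho0 : 0 < rho := lt_le_trans r0 rrho.
  have cen := central_iter T _ K0_ge0 TK0 _ _ r0 rrho res Kc' Kc'_ge0 resP' resI' resB'.
  have [KQ KQ0 QB] : exists2 K, 0 <= K & forall x, rnorm (Q x) <= K * rnorm x.
    exists Kc => // x; rewrite QE.
    exact: (coef_bound T _ K0_ge0 TK0 _ _ r0 res Kc Kc_ge0 resP resI resB _ _ _ hr (inv_powerP 0)).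
  have QTn n x : Q (iter n T x) = iter n T (Q x) by elim: n => //= n <-; rewrite QT.
  have SQ x : S (Q x) = 0.
    have -> : Q x = x - T (S x) by rewrite TS subKr.
    by rewrite (linearB S) ST QS subr0 subrr.
  have STn n x : iter n S (iter n T (x - Q x)) = x - Q x.
    elim: n x => // n IH x; rewrite iterSr iterS ST QTn.
    have -> : Q (x - Q x) = 0 by rewrite (linearB Q) QQ subrr.
    suff -> : iter n T (0 : V) = 0 by rewrite subr0 IH.
    by elim: n {IH} => //= n ->; rewrite (linear0 T).
  have iS0 n a x : iter n S (a *: x) = a *: iter n S x.
    by elim: n => //= n ->; rewrite (linearZ_LR S).
  exists ((1 + KQ) * (Kc' + 1)); first by rewrite mulr_ge0 // addr_ge0.
  have PB x : rnorm (x - Q x) <= (1 + KQ) * rnorm x.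
    by apply: le_trans (rnormB _ _) _; rewrite mulrDl mul1r lerD2l.
  move=> [|n] x.
    rewrite expr0 invr1 mulr1; apply: le_trans (PB _) _; rewrite ler_wpM2r ?rnorm_ge0 //.
    by rewrite ler_peMr ?lerDr ?addr_ge0.
  have rn : 0 < rho ^+ n.+1 by rewrite exprn_gt0.
  pose y := ncoef res rho n.+1 x.
  have yB : rnorm y <= Kc' * rnorm x.
    apply: (coef_bound T _ K0_ge0 TK0 _ _ r0 res Kc' Kc'_ge0 resP' resI' resB' _ _ _ _ (powerP n.+1)).
    by rewrite rrho lexx.
  (* The bound on [y] does not depend on [n]; applying [iter n.+1 S] to this identity therefore
     leaves only the factor [rho ^- n.+1]. *)
  have E : x - Q x = - (rho ^- n.+1)%:C *: iter n.+1 T (y - Q y).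
    have iTB k u v : iter k T (u - v) = iter k T u - iter k T v.
      by elim: k => //= k ->; rewrite (linearB T).
    rewrite iTB -QTn cen // -QE (linearZ_LR Q) (linearB Q) QQ subrr scaler0 subr0.
    rewrite scalerA mulNr -rmorphM mulVf ?gt_eqF //= scaleN1r opprB //.
  rewrite E iS0 STn rnormZ cabsN cabs_real ger0_norm ?invr_ge0 ?(ltW rn) //.
  rewrite mulrAC [leRHS]mulrC ler_wpM2l ?invr_ge0 ?(ltW rn) //.
  apply: le_trans (PB _) _; rewrite -mulrA ler_wpM2l ?addr_ge0 // mulrDl mul1r.
  by apply: le_trans yB _; rewrite lerDl rnorm_ge0.
Qed.

(** * Adapted norms and holomorphic discs *)

Record bounded_seminorm {R : realType} {V : normedModType R[i]} (N : V -> R) : Prop :=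
  BoundedSeminorm {
    semi_ge0 : forall x, 0 <= N x;
    semiD : forall x y, N (x + y) <= N x + N y;
    semiZ : forall a x, N (a *: x) <= cabs a * N x;
    semi_bounded : exists2 C, 0 <= C & forall x, N x <= C * rnorm x }.

Section Seminorm.
Context {R : realType} {V : normedModType R[i]} (N : V -> R).
Hypothesis HN : bounded_seminorm N.

Lemma semi0 : N 0 = 0.
Proof.
by apply/eqP; rewrite eq_le (semi_ge0 _ HN) andbT -(scale0r 0) (le_trans (semiZ _ HN _ _)) // cabs0 mul0r.
Qed.

Lemma semiN x : N (- x) = N x.
Proof.
have h y : N (- y) <= N y.
  by rewrite -scaleN1r; apply: le_trans (semiZ _ HN _ _) _; rewrite cabsN cabs1 mul1r.
by apply/eqP; rewrite eq_le h -{1}(opprK x) h.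
Qed.

Lemma semiB x y : N (x - y) <= N x + N y.
Proof. by rewrite -(semiN y); exact: semiD. Qed.

Lemma semi_le_sub x y : N x <= N y + N (x - y).
Proof. by rewrite -{1}(subrK y x) addrC; exact: semiD. Qed.

Lemma semi_sub x y : N (x - y) = N (y - x).
Proof. by rewrite -semiN opprB. Qed.

End Seminorm.

(** Source of the adapted norms: a supremum of weighted iterates turns an estimate for all [n] with
    a constant into an estimate for one step without a constant. *)
Lemma sup_seminorm {R : realType} {V : normedModType R[i]} (L : nat -> V -> V)
    (c : nat -> R) (C : R) :
  (forall n a x y, L n (a *: x + y) = a *: L n x + L n y) -> 0 <= C ->
  (forall n, 0 <= c n) -> (forall n x, c n * rnorm (L n x) <= C * rnorm x) ->
  exists N : V -> R, [/\ bounded_seminorm N,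
    forall n x, c n * rnorm (L n x) <= N x &
    forall x M, (forall n, c n * rnorm (L n x) <= M) -> N x <= M].
Proof.
move=> LL C0 c0 cC.
pose E x := [set c n * rnorm (L n x) | n in setT].
have E0 x : E x !=set0 by exists (c 0%N * rnorm (L 0%N x)), 0%N.
have ub n x : c n * rnorm (L n x) <= sup (E x).
  by apply: ub_le_sup; [exists (C * rnorm x) => _ [m _ <-]|exists n].
have lu x M : (forall n, c n * rnorm (L n x) <= M) -> sup (E x) <= M.
  by move=> h; apply: ge_sup => // _ [m _ <-].
exists (fun x => sup (E x)); split => //.
have LD n x y : L n (x + y) = L n x + L n y by have := LL n 1 x y; rewrite !scale1r.
have L0 n : L n 0 = 0 by have := LL n (-1) 0 0; rewrite !scaleN1r !addNr.
split.
- by move=> x; apply: le_trans (ub 0%N x); rewrite mulr_ge0 // rnorm_ge0.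
- move=> x y; apply: lu => n; rewrite LD.
  apply: (@le_trans _ _ (c n * (rnorm (L n x) + rnorm (L n y)))).
    by rewrite ler_wpM2l // rnormD.
  by rewrite mulrDr lerD.
- move=> a x; apply: lu => n; have := LL n a x 0; rewrite L0 !addr0 => ->.
  by rewrite rnormZ mulrCA ler_wpM2l ?cabs_ge0.
- by exists C => // x; apply: lu.
Qed.

Section AdaptedNorms.
Context {R : realType} {V : completeNormedModType R[i]}.
Context (T Q S : {linear V -> V}) (r : R) (HS : spectral_splitting T Q S r).

Lemma split_iterL (f : {linear V -> V}) n (a : R[i]) x y :
  iter n f (a *: x + y) = a *: iter n f x + iter n f y.
Proof. by elim: n => //= n ->; rewrite (linearP f). Qed.

Lemma split_SQ x : S (Q x) = 0.
Proof.
have -> : Q x = x - T (S x) by rewrite (split_right _ _ _ _ HS) subKr.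
by rewrite (linearB S) (split_left _ _ _ _ HS) (split_QS _ _ _ _ HS) subr0 subrr.
Qed.

Lemma split_QP x : Q (x - Q x) = 0.
Proof. by rewrite (linearB Q) (split_proj _ _ _ _ HS) subrr. Qed.

Lemma split_SP x : S x - Q (S x) = S (x - Q x).
Proof. by rewrite (split_QS _ _ _ _ HS) (linearB S) split_SQ. Qed.

(** The supremum of [(1 + kappa) ^- n * rnorm (iter n S (x - Q x))] is finite by [split_central]
    with a rate [rho >= (1 + kappa)^-1]. Shifting the index by one gives the bounds under [S] and
    [T]. *)
Lemma central_norm (kappa : R) : 0 < kappa -> exists N : V -> R,
  [/\ bounded_seminorm N, forall x, N (Q x) = 0, forall x, rnorm (x - Q x) <= N x,
      forall x, N (S x) <= (1 + kappa) * N x & forall x, N x <= (1 + kappa) * N (T x)].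
Proof.
move=> k0; have /andP[r0 r1] := split_rate _ _ _ _ HS.
have k1 : 0 < 1 + kappa by lra.
pose rho := Num.max r (1 + kappa)^-1.
have hrho : r <= rho < 1.
  by rewrite /rho le_max lexx /= gt_max r1 invf_lt1 // ltrDl.
have rho0 : 0 < rho by case/andP: hrho => h _; exact: lt_le_trans h.
have [C C0 hC] := split_central _ _ _ _ HS _ hrho.
have cb n x : (1 + kappa) ^- n * rnorm (iter n S (x - Q x)) <= C * rnorm x.
  rewrite ler_pdivrMl ?exprn_gt0 //; apply: le_trans (hC n x) _.
  rewrite mulrAC mulrC ler_wpM2r ?mulr_ge0 ?rnorm_ge0 //.
  rewrite -exprVn lerXn2r ?nnegrE ?invr_ge0 ?(ltW rho0) ?(ltW k1) //.
  by rewrite -[leRHS]invrK lef_pV2 ?posrE ?invr_gt0 // /rho le_max lexx orbT.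
have LL n a x y : iter n S (a *: x + y - Q (a *: x + y)) =
    a *: iter n S (x - Q x) + iter n S (y - Q y).
  by rewrite -split_iterL (linearP Q) scalerBr opprD addrACA.
have c0 n : 0 <= (1 + kappa) ^- n by rewrite invr_ge0 exprn_ge0 // ltW.
have [N [HN Nge Nle]] := sup_seminorm (fun n x => iter n S (x - Q x)) _ C LL C0 c0 cb.
exists N; split => //.
- move=> x; apply/eqP; rewrite eq_le (semi_ge0 _ HN) andbT; apply: Nle => n.
  rewrite (split_proj _ _ _ _ HS) subrr; suff -> : iter n S (0 : V) = 0 by rewrite rnorm0 mulr0.
  by elim: n => //= n ->; rewrite (linear0 S).
- by move=> x; have := Nge 0%N x; rewrite expr0 invr1 mul1r.
- move=> x; apply: Nle => n; rewrite split_SP -iterSr.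
  have := Nge n.+1 x; rewrite exprS invfM -mulrA ler_pdivrMl //.
- move=> x; apply: Nle => n.
  have := Nge n.+1 (T x); rewrite exprS invfM -mulrA ler_pdivrMl // iterSr.
  by rewrite (split_comm _ _ _ _ HS) -(linearB T) (split_left _ _ _ _ HS) split_QP subr0.
Qed.

Lemma stable_norm : exists N : V -> R,
  [/\ bounded_seminorm N, forall x, N (x - Q x) = 0, forall x, rnorm (Q x) <= N x &
      forall x, N (T x) <= r * N x].
Proof.
have /andP[r0 r1] := split_rate _ _ _ _ HS.
have [C C0 hC] := split_stable _ _ _ _ HS.
have cb n x : r ^- n * rnorm (iter n T (Q x)) <= C * rnorm x.
  by rewrite ler_pdivrMl ?exprn_gt0 // mulrCA mulrA.
have LL n a x y : iter n T (Q (a *: x + y)) = a *: iter n T (Q x) + iter n T (Q y).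
  by rewrite -split_iterL (linearP Q).
have c0 n : 0 <= r ^- n by rewrite invr_ge0 exprn_ge0 // ltW.
have [N [HN Nge Nle]] := sup_seminorm (fun n x => iter n T (Q x)) _ C LL C0 c0 cb.
exists N; split => //.
- move=> x; apply/eqP; rewrite eq_le (semi_ge0 _ HN) andbT; apply: Nle => n.
  rewrite split_QP; suff -> : iter n T (0 : V) = 0 by rewrite rnorm0 mulr0.
  by elim: n => //= n ->; rewrite (linear0 T).
- by move=> x; have := Nge 0%N x; rewrite expr0 invr1 mul1r.
- move=> x; apply: Nle => n; rewrite (split_comm _ _ _ _ HS) -iterSr.
  by have := Nge n.+1 x; rewrite exprS invfM -mulrA ler_pdivrMl.
Qed.

End AdaptedNorms.

(** * Holomorphic discs through the origin *)

Lemma sum_pad {R : realType} {V : normedModType R[i]} n m (c : nat -> V) (t : R[i]) : (n <= m)%N ->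
  \sum_(i < m) t ^+ i *: (if (i < n)%N then c i else 0) = \sum_(i < n) t ^+ i *: c i.
Proof.
move=> nm; rewrite (big_ord_widen _ (fun i => t ^+ i *: c i) nm) [RHS]big_mkcond /=.
by apply: eq_bigr => i _; case: ifP => //; rewrite scaler0.
Qed.

Section HolomorphicOnCircle.
Context {R : realType} {V : completeNormedModType R[i]}.
Implicit Types (z : R[i] -> V) (w v : V).

(* [z] is, on the unit circle, a uniform limit of polynomials
   [w zeta + O(zeta ^ 2)]: the boundary values of a holomorphic disc through [0]
   with derivative [w] at [0]. *)
Definition holo z w : Prop := forall e : R, 0 < e ->
  exists n, exists c : nat -> V, [/\ c 0%N = 0, c 1%N = w &
    forall t, cabs t = 1 -> rnorm (z t - \sum_(i < n.+2) t ^+ i *: c i) <= e].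

Lemma holo_bound z w (M : R) : holo z w ->
  (forall t, cabs t = 1 -> rnorm (z t) <= M) -> rnorm w <= M.
Proof.
move=> zw zM; apply/ler_addgt0Pr => e /zw[n [c [_ <- h]]].
rewrite -[leLHS]mulr1 -(expr1n _ 1).
apply: (@poly_cauchy _ _ n.+2 c 1 (M + e) 1) => // t t1.
apply: le_trans (ler_rnorm_sub _ (z t)) _; rewrite rnorm_sub.
by rewrite lerD ?zM ?h.
Qed.

Lemma holo_linear a z w z' w' : holo z w -> holo z' w' ->
  holo (fun t => a *: z t + z' t) (a *: w + w').
Proof.
move=> zw zw' e e0.
have a1 : 0 < cabs a + 1 by have := cabs_ge0 a; lra.
have e2 : 0 < e / 2 by rewrite divr_gt0.
have [n [c [c0 c1 h]]] := zw _ (divr_gt0 e2 a1).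
have [n' [c' [c'0 c'1 h']]] := zw' _ e2.
pose m := maxn n n'.
have nm : (n.+2 <= m.+2)%N by rewrite !ltnS leq_maxl.
have n'm : (n'.+2 <= m.+2)%N by rewrite !ltnS leq_maxr.
exists m, (fun i => a *: (if (i < n.+2)%N then c i else 0) + (if (i < n'.+2)%N then c' i else 0)).
split; rewrite ?c0 ?c'0 ?scaler0 ?addr0 ?c1 ?c'1 // => t t1.
have -> : \sum_(i < m.+2) t ^+ i *: (a *: (if (i < n.+2)%N then c i else 0) + (if (i < n'.+2)%N then c' i else 0))
   = a *: \sum_(i < n.+2) t ^+ i *: c i + \sum_(i < n'.+2) t ^+ i *: c' i.
  rewrite -(sum_pad _ _ c t nm) -(sum_pad _ _ c' t n'm) scaler_sumr -big_split /=.
  by apply: eq_bigr => i _; rewrite scalerDr !scalerA mulrC.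
rewrite opprD addrACA -scalerBr; apply: le_trans (rnormD _ _) _.
rewrite [leRHS]splitr lerD ?h' // rnormZ.
apply: (@le_trans _ _ ((cabs a + 1) * (e / 2 / (cabs a + 1)))).
  by rewrite ler_pM ?cabs_ge0 ?rnorm_ge0 ?h //; lra.
by rewrite mulrC mulfVK ?gt_eqF.
Qed.

Lemma holo_ext z z' w : (forall t, cabs t = 1 -> z t = z' t) -> holo z w -> holo z' w.
Proof.
move=> zz' zw e /zw[n [c [c0 c1 h]]]; exists n, c; split => // t t1.
by rewrite -zz' // h.
Qed.

Lemma holoD z w z' w' : holo z w -> holo z' w' -> holo (fun t => z t + z' t) (w + w').
Proof.
move=> h h'; have := holo_linear 1 _ _ _ _ h h'; rewrite scale1r.
by apply: holo_ext => t _; rewrite scale1r.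
Qed.

Lemma holoB z w z' w' : holo z w -> holo z' w' -> holo (fun t => z t - z' t) (w - w').
Proof.
move=> h h'; have := holo_linear (-1) _ _ _ _ h' h; rewrite scaleN1r addrC.
by apply: holo_ext => t _; rewrite scaleN1r addrC.
Qed.

Lemma holo_cst0 : holo (fun=> 0) 0.
Proof.
move=> e e0; exists 0%N, (fun=> 0); split => // t _.
by rewrite big1 ?subrr ?rnorm0 ?ltW // => i _; rewrite scaler0.
Qed.

Lemma holo_ray v : holo (fun t => t *: v) v.
Proof.
move=> e e0; exists 0%N, (fun i => if i == 1%N then v else 0); split => // t _.
by rewrite !big_ord_recr big_ord0 /= scaler0 !add0r expr1 subrr rnorm0 ltW.
Qed.

Lemma holo_unique z w w' : holo z w -> holo z w' -> w = w'.
Proof.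
move=> h h'; apply/eqP; rewrite -subr_eq0; apply/eqP/rnorm_le0 => e e0.
have := holo_linear (-1) _ _ _ _ h' h; rewrite !scaleN1r addrC => /holo_bound; apply => t _.
by rewrite scaleN1r addNr rnorm0 ltW.
Qed.

Lemma holo_comp (f : {linear V -> V}) (K : R) z w : 0 <= K ->
  (forall x, rnorm (f x) <= K * rnorm x) -> holo z w -> holo (fun t => f (z t)) (f w).
Proof.
move=> K0 fK zw e e0.
have K1 : 0 < K + 1 by lra.
have [n [c [c0 c1 h]]] := zw _ (divr_gt0 e0 K1).
exists n, (fun i => f (c i)); split; rewrite ?c0 ?c1 ?(linear0 f) // => t t1.
have -> : \sum_(i < n.+2) t ^+ i *: f (c i) = f (\sum_(i < n.+2) t ^+ i *: c i).
  by rewrite (linear_sum f); apply: eq_bigr => i _; rewrite (linearZ_LR f).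
rewrite -(linearB f); apply: le_trans (fK _) _.
apply: (@le_trans _ _ ((K + 1) * (e / (K + 1)))).
  by rewrite ler_pM ?rnorm_ge0 ?h //; lra.
by rewrite mulrC mulfVK ?gt_eqF.
Qed.

(** By [holo_bound] applied to differences, the derivatives form a Cauchy sequence. Replacing the
    first coefficient of an approximating polynomial by their limit costs only the distance between
    the two. *)
Lemma holo_limit (zn : nat -> R[i] -> V) z :
  (forall n, exists w, holo (zn n) w) ->
  (forall e : R, 0 < e -> exists N, forall n t, (N <= n)%N -> cabs t = 1 ->
     rnorm (zn n t - z t) <= e) ->
  exists w, holo z w.
Proof.
move=> /choice[wn hwn] lim.
have wB n m e : (forall t, cabs t = 1 -> rnorm (zn n t - zn m t) <= e) -> rnorm (wn n - wn m) <= e.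
  move=> h; have := holo_linear (-1) _ _ _ _ (hwn m) (hwn n).
  rewrite scaleN1r addrC => /holo_bound; apply => t t1.
  by rewrite scaleN1r addrC h.
have [w hw] : exists l, forall e : R, 0 < e -> exists N, forall n, (N <= n)%N -> rnorm (wn n - l) <= e.
  apply: rcauchy_cvg => e e0; have e2 : 0 < e / 2 by rewrite divr_gt0.
  have [N hN] := lim _ e2; exists N => n m Nn Nm; apply: wB => t t1.
  apply: le_trans (rdistD (z t) _ _) _; rewrite [leRHS]splitr lerD ?hN //.
  by rewrite rnorm_sub hN.
exists w => e e0; have e3 : 0 < e / 3 by rewrite divr_gt0.
have [N hN] := lim _ e3; have [N' hN'] := hw _ e3.
pose m := maxn N N'.
have [n [c [c0 c1 h]]] := hwn m _ e3.
exists n, (fun i => if i == 1%N then w else c i); split => // t t1.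
have -> : \sum_(i < n.+2) t ^+ i *: (if i == 1%N :> nat then w else c i) =
    \sum_(i < n.+2) t ^+ i *: c i - t *: (wn m - w).
  rewrite (bigD1 (@Ordinal n.+2 1 erefl)) //= [in RHS](bigD1 (@Ordinal n.+2 1 erefl)) //= expr1 c1.
  rewrite scalerBr opprB [RHS]addrC addrA subrK; congr (_ + _).
  apply: eq_bigr => i i1; case: eqP => // ii; case/eqP: i1; exact: val_inj.
rewrite opprB addrA [_ + t *: _]addrC -addrA.
apply: le_trans (rnormD _ _) _; rewrite rnormZ t1 mul1r.
have i1 := hN' m (leq_maxr _ _).
have i2 := hN m t (leq_maxl _ _) t1.
have i3 := h t t1.
have := rdistD (zn m t) (z t) (\sum_(i < n.+2) t ^+ i *: c i).
rewrite (rnorm_sub (z t) (zn m t)); lra.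
Qed.

End HolomorphicOnCircle.

(** * Orbits in the unstable-central cone *)

Section ConeDynamics.
Context {R : realType} {V : completeNormedModType R[i]}.
Context (T Q S : {linear V -> V}) (r : R) (HS : spectral_splitting T Q S r).
Context (K0 : R) (K0_ge0 : 0 <= K0) (TK0 : forall x, rnorm (T x) <= K0 * rnorm x).
Context (kappa : R) (rE : r = 1 - 8 * kappa).
Context (nc ns : V -> R) (Hnc : bounded_seminorm nc) (Hns : bounded_seminorm ns).
Hypothesis ncQ : forall x, nc (Q x) = 0.
Hypothesis nc_ge : forall x, rnorm (x - Q x) <= nc x.
Hypothesis ncS : forall x, nc (S x) <= (1 + kappa) * nc x.
Hypothesis ncT : forall x, nc x <= (1 + kappa) * nc (T x).
Hypothesis nsP : forall x, ns (x - Q x) = 0.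
Hypothesis ns_ge : forall x, rnorm (Q x) <= ns x.
Hypothesis nsT : forall x, ns (T x) <= r * ns x.

Definition nmax x : R := Num.max (nc x) (ns x).

Lemma kappa_bounds : 0 < kappa /\ kappa < 1 / 8.
Proof. by have /andP[h1 h2] := split_rate _ _ _ _ HS; move: h1 h2; rewrite rE; split; lra. Qed.

Lemma nc_le_nmax x : nc x <= nmax x.
Proof. by rewrite /nmax le_max lexx. Qed.

Lemma ns_le_nmax x : ns x <= nmax x.
Proof. by rewrite /nmax le_max lexx orbT. Qed.

Lemma nmax_le x (M : R) : nc x <= M -> ns x <= M -> nmax x <= M.
Proof. by move=> h1 h2; rewrite /nmax ge_max h1 h2. Qed.

Lemma nmax_seminorm : bounded_seminorm nmax.
Proof.
split.
- by move=> x; apply: le_trans (semi_ge0 _ Hnc x) (nc_le_nmax x).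
- move=> x y; apply: nmax_le.
    exact: le_trans (semiD _ Hnc _ _) (lerD (nc_le_nmax _) (nc_le_nmax _)).
  exact: le_trans (semiD _ Hns _ _) (lerD (ns_le_nmax _) (ns_le_nmax _)).
- move=> a x; apply: nmax_le.
    by apply: le_trans (semiZ _ Hnc _ _) _; rewrite ler_wpM2l ?cabs_ge0 // nc_le_nmax.
  by apply: le_trans (semiZ _ Hns _ _) _; rewrite ler_wpM2l ?cabs_ge0 // ns_le_nmax.
- have [C C0 hC] := semi_bounded _ Hnc; have [D D0 hD] := semi_bounded _ Hns.
  exists (C + D); first by rewrite addr_ge0.
  move=> x; rewrite mulrDl; apply: nmax_le.
    by apply: le_trans (hC x) _; rewrite lerDl mulr_ge0 // rnorm_ge0.
  by apply: le_trans (hD x) _; rewrite lerDr mulr_ge0 // rnorm_ge0.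
Qed.

Lemma rnorm_le_nmax x : rnorm x <= 2 * nmax x.
Proof.
rewrite -{1}(subrK (Q x) x); apply: le_trans (rnormD _ _) _.
have := nc_ge x; have := ns_ge x; have := nc_le_nmax x; have := ns_le_nmax x; lra.
Qed.

Lemma nc_addQ x y : nc (x + Q y) <= nc x.
Proof. by apply: le_trans (semiD _ Hnc _ _) _; rewrite ncQ addr0. Qed.

Lemma ns_addQ x y : Q x = 0 -> ns (x + Q y) <= ns y.
Proof.
move=> Qx; have x0 : ns x = 0 by rewrite -(subr0 x) -Qx nsP.
apply: le_trans (semiD _ Hns _ _) _; rewrite x0 add0r.
have := semi_le_sub _ Hns (Q y) y.
by rewrite (semi_sub _ Hns (Q y)) nsP addr0.
Qed.

Lemma nc_proj x : nc (x - Q x) = nc x.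
Proof.
apply/eqP; rewrite eq_le; apply/andP; split.
  by apply: le_trans (semiB _ Hnc _ _) _; rewrite ncQ addr0.
by rewrite -{1}(subrK (Q x) x) nc_addQ.
Qed.

Context (F : V -> V) (delta : R) (delta_gt0 : 0 < delta) (F0 : F 0 = 0).
Hypothesis Flip : forall x y, nmax x <= delta -> nmax y <= delta ->
  nmax (F x - T x - (F y - T y)) <= kappa * nmax (x - y).

(** [T] multiplies [nc] by at least [1 - kappa] and [ns] by at most [r = 1 - 8 * kappa], and the
    nonlinear error adds at most [kappa * nc (x - y)] to each change. So [nc] keeps a factor
    [1 - 2 * kappa], while the new [ns] is at most [1 - 7 * kappa] times the old [nc]. *)
Lemma cone_step x y : nmax x <= delta -> nmax y <= delta -> ns (x - y) <= nc (x - y) ->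
  (1 - 2 * kappa) * nc (x - y) <= nc (F x - F y) /\ ns (F x - F y) <= nc (F x - F y).
Proof.
move=> xd yd cone.
have FE : F x - F y = T (x - y) + (F x - T x - (F y - T y)).
  by rewrite (linearB T) opprB [RHS]addrACA subrKC addKr.
have nE : nmax (x - y) = nc (x - y).
  by apply/eqP; rewrite eq_le nc_le_nmax andbT nmax_le.
have := Flip _ _ xd yd; rewrite nE; set e := F x - T x - _ => he.
have [k0 k1] := kappa_bounds.
have h0 := semi_ge0 _ Hnc (x - y).
have h1 : (1 - kappa) * nc (x - y) <= nc (T (x - y)).
  have h2 := ncT (x - y); have h3 := semi_ge0 _ Hnc (T (x - y)).
  have k2 : 0 < 1 + kappa by lra.
  rewrite -(ler_pM2l k2); apply: le_trans h2; rewrite mulrA.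
  have k3 : (1 + kappa) * (1 - kappa) <= 1 by nra.
  by have := ler_wpM2r h0 k3; rewrite mul1r.
have h2 := semi_le_sub _ Hnc (T (x - y)) (F x - F y).
have h3 : nc (T (x - y) - (F x - F y)) <= kappa * nc (x - y).
  by rewrite FE opprD addrA subrr sub0r (semiN _ Hnc); apply: le_trans (nc_le_nmax _) he.
have h4 : ns (F x - F y) <= (r + kappa) * nc (x - y).
  rewrite FE; apply: le_trans (semiD _ Hns _ _) _; rewrite mulrDl lerD //.
    have /andP[r0 _] := split_rate _ _ _ _ HS.
    by apply: le_trans (nsT _) _; rewrite ler_pM2l.
  exact: le_trans (ns_le_nmax _) he.
have h5 : (1 - 2 * kappa) * nc (x - y) <= nc (F x - F y) by lra.
split => //; apply: le_trans h4 (le_trans _ h5).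
by rewrite ler_wpM2r // rE; lra.
Qed.

Lemma nmax0 : nmax 0 = 0.
Proof. exact: semi0 nmax_seminorm. Qed.

Lemma cone_step0 x : nmax x <= delta -> ns x <= nc x ->
  (1 - 2 * kappa) * nc x <= nc (F x) /\ ns (F x) <= nc (F x).
Proof.
move=> xd cone; have := cone_step x 0; rewrite F0 !subr0; apply => //.
by rewrite nmax0 ltW.
Qed.

(* The unstable-central space is [ker Q]. *)
Record orbit_family (M : nat) (z : nat -> R[i] -> V) (d : R) : Prop := OrbitFamily {
  fam_bound : forall k t, (k <= M)%N -> cabs t = 1 -> nmax (z k t) <= d;
  fam_orbit : forall k t, (k < M)%N -> cabs t = 1 -> F (z k t) = z k.+1 t;
  fam_start : forall t, cabs t = 1 -> Q (z 0%N t) = 0;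
  fam_holo : forall k, (k <= M)%N -> exists w, holo (z k) w }.

Lemma fam_trunc M N z d : orbit_family (M + N) z d -> orbit_family M z d.
Proof.
move=> [h1 h2 h3 h4]; split => //.
- by move=> k t kM; apply: h1; rewrite (leq_trans kM) // leq_addr.
- by move=> k t kM; apply: h2; rewrite (leq_trans kM) // leq_addr.
- by move=> k kM; apply: h4; rewrite (leq_trans kM) // leq_addr.
Qed.

Lemma fam_cone M z k t : orbit_family M z delta -> (k <= M)%N -> cabs t = 1 ->
  ns (z k t) <= nc (z k t).
Proof.
move=> [h1 h2 h3 h4] kM t1; elim: k kM => [|k IH] kM.
  by rewrite -(subr0 (z _ _)) -(h3 t t1) nsP (semi_ge0 _ Hnc).
by rewrite -h2 //; apply: (cone_step0 _ _ _).2; rewrite ?IH ?h1 // ltnW.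
Qed.

Lemma fam_iter M z k j t d : orbit_family M z d -> (k + j <= M)%N -> cabs t = 1 ->
  iter j F (z k t) = z (k + j)%N t.
Proof.
move=> h kjM t1; elim: j kjM => [|j IH] kjM; first by rewrite addn0.
have kj : (k + j < M)%N by rewrite -addnS.
by rewrite iterS IH ?(ltnW kj) // addnS; exact: fam_orbit h _ _ kj t1.
Qed.

(* Two families are compared through the cone: the distance contracts backwards. *)
Lemma fam_dist M z z' k t : orbit_family M z delta -> orbit_family M z' delta ->
  (k <= M)%N -> cabs t = 1 ->
  nmax (z k t - z' k t) <= (1 - 2 * kappa) ^- (M - k) * nc (z M t - z' M t).
Proof.
move=> h h' kM t1.
have cone j : (j <= M)%N -> ns (z j t - z' j t) <= nc (z j t - z' j t).
  elim: j => [|j IH] jM.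
    have -> : z 0%N t - z' 0%N t = (z 0%N t - z' 0%N t) - Q (z 0%N t - z' 0%N t).
      by rewrite (linearB Q) (fam_start _ _ _ h) ?(fam_start _ _ _ h') // subrr subr0.
    by rewrite nsP (semi_ge0 _ Hnc).
  rewrite -(fam_orbit _ _ _ h) // -(fam_orbit _ _ _ h') //.
  apply: (cone_step _ _ _ _ _).2; last by rewrite IH // ltnW.
    by apply: (fam_bound _ _ _ h) => //; exact: ltnW.
  by apply: (fam_bound _ _ _ h') => //; exact: ltnW.
have [k0 k1] := kappa_bounds.
have a0 : 0 < 1 - 2 * kappa by lra.
have grow j : (j <= M - k)%N ->
    (1 - 2 * kappa) ^+ j * nc (z k t - z' k t) <= nc (z (k + j)%N t - z' (k + j)%N t).
  elim: j => [|j IH] jM; first by rewrite expr0 mul1r addn0.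
  have jM' : (k + j < M)%N by lia.
  rewrite addnS -(fam_orbit _ _ _ h) // -(fam_orbit _ _ _ h') //.
  apply: le_trans (cone_step _ _ _ _ _).1.
  - by rewrite exprS -mulrA ler_pM2l // IH // ltnW.
  - by apply: (fam_bound _ _ _ h) => //; exact: ltnW.
  - by apply: (fam_bound _ _ _ h') => //; exact: ltnW.
  - by apply: cone; exact: ltnW.
have := grow _ (leqnn _); rewrite subnKC // => g.
rewrite ler_pdivlMl ?exprn_gt0 //; apply: le_trans g.
by rewrite ler_pM2l ?exprn_gt0 // nmax_le // cone.
Qed.

(** * Boundary value problem for discs of orbits *)

Hypothesis holoF : forall z w, holo z w ->
  (forall t, cabs t = 1 -> nmax (z t) <= delta) -> holo (fun t => F (z t)) (T w).

Lemma S_bounded : exists2 K, 0 <= K & forall x, rnorm (S x) <= K * rnorm x.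
Proof.
have [k0 k1] := kappa_bounds; have [C C0 hC] := semi_bounded _ Hnc.
have k2 : 0 <= 1 + kappa by lra.
exists ((1 + kappa) * C); first by rewrite mulr_ge0.
move=> x; rewrite -[S x]subr0 -(split_QS _ _ _ _ HS x).
apply: le_trans (nc_ge _) (le_trans (ncS _) _).
by rewrite -mulrA ler_wpM2l.
Qed.

(** The inverse of the weight must separate the stable rate plus error, [r + kappa = 1 - 7 * kappa],
    from the central rate; with [1 - 4 * kappa] both halves of [bvp_step] contract by
    [1 - kappa]. *)
Definition weight : R := (1 - 4 * kappa)^-1.

Lemma weight_bounds : [/\ 1 <= weight, (r + kappa) * weight <= 1 - kappa &
  (1 + kappa) * (1 + kappa * weight) <= (1 - kappa) * weight].
Proof.
have [k0 k1] := kappa_bounds.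
have i0 : 0 < 1 - 4 * kappa by lra.
have w0 : 0 <= weight by rewrite /weight invr_ge0 ltW.
have wi : weight * (1 - 4 * kappa) = 1 by rewrite /weight mulVf // gt_eqF.
split.
- by rewrite /weight invf_ge1 //; lra.
- by rewrite /weight ler_pdivrMr // rE; nra.
- have -> : 1 + kappa * weight = weight * (1 - 4 * kappa + kappa).
    by rewrite mulrDr wi [kappa * _]mulrC.
  by rewrite mulrCA [leRHS]mulrC ler_wpM2l //; nra.
Qed.

(* The boundary value problem for orbits with prescribed [Q]-part at time [0]
   and prescribed unstable-central part at time [M] is a fixed point problem,
   contracting for the norm weighted by [weight ^ (M - k)]. *)
Definition central_part M (y : R[i] -> V) (z : nat -> R[i] -> V) k t : V :=
  if (k < M)%N then S (z k.+1 t - (F (z k t) - T (z k t))) else y t.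

Definition stable_part (z : nat -> R[i] -> V) k t : V :=
  if k is j.+1 then F (z j t) else 0.

Definition bvp_step M y z k t : V := central_part M y z k t + Q (stable_part z k t).

(** The central part at time [k] is read off at time [k.+1], where the allowed distance is smaller
    by a factor [weight]. The stable part comes from the preceding time, where that distance is
    larger by the same factor but [T] contracts by [r]. *)
Lemma bvp_step_contract M y a b B t : 0 <= B -> Q (y t) = 0 ->
  (forall k, (k <= M)%N -> nmax (a k t) <= delta) ->
  (forall k, (k <= M)%N -> nmax (b k t) <= delta) ->
  (forall k, (k <= M)%N -> nmax (a k t - b k t) <= B * weight ^+ (M - k)) ->
  forall k, (k <= M)%N ->
  nmax (bvp_step M y a k t - bvp_step M y b k t) <= (1 - kappa) * B * weight ^+ (M - k).
Proof.
move=> B0 Qy ad bd ab k kM.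
have [k0 k1] := kappa_bounds; have [W1 W2 W3] := weight_bounds.
have w0 : 0 <= weight by apply: le_trans W1; exact: ler01.
have wn n : 0 <= weight ^+ n by rewrite exprn_ge0.
rewrite /bvp_step opprD addrACA -(linearB Q).
have sub4 (c d e f : V) : c - d - (e - f) = (c - e) - (d - f).
  by rewrite !opprD !opprK addrACA.
have QS x : Q (S x) = 0 := split_QS _ _ _ _ HS x.
have Qc z : Q (central_part M y z k t) = 0 by rewrite /central_part; case: ifP.
apply: nmax_le.
  apply: le_trans (nc_addQ _ _) _; rewrite /central_part; case: ifP => [km|_]; last first.
    rewrite subrr (semi0 _ Hnc) mulr_ge0 // mulr_ge0 //; lra.
  rewrite -(linearB S); apply: le_trans (ncS _) _.
  have -> : a k.+1 t - (F (a k t) - T (a k t)) - (b k.+1 t - (F (b k t) - T (b k t))) =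
     (a k.+1 t - b k.+1 t) - (F (a k t) - T (a k t) - (F (b k t) - T (b k t))).
    exact: sub4.
  set p := weight ^+ (M - k.+1).
  have wS : weight ^+ (M - k) = weight * p by rewrite /p -exprS subnSK.
  have h1 : nc (a k.+1 t - b k.+1 t - (F (a k t) - T (a k t) - (F (b k t) - T (b k t)))) <=
     B * p * (1 + kappa * weight).
    apply: le_trans (semiB _ Hnc _ _) _; rewrite mulrDr mulr1 lerD //.
      exact: le_trans (nc_le_nmax _) (ab _ km).
    apply: le_trans (nc_le_nmax _) _; apply: le_trans (Flip _ _ (ad _ kM) (bd _ kM)) _.
    rewrite (_ : B * p * (kappa * weight) = kappa * (B * (weight * p))); last by ring.
    by rewrite -wS ler_pM2l // ab.
  have k2 : 0 <= 1 + kappa by lra.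
  apply: le_trans (ler_wpM2l k2 h1) _; rewrite wS.
  rewrite (_ : (1 + kappa) * (B * p * (1 + kappa * weight)) = B * p * ((1 + kappa) * (1 + kappa * weight))); last by ring.
  rewrite (_ : (1 - kappa) * B * (weight * p) = B * p * ((1 - kappa) * weight)); last by ring.
  by rewrite ler_wpM2l // mulr_ge0 // wn.
have Qd : Q (central_part M y a k t - central_part M y b k t) = 0.
  by rewrite (linearB Q) !Qc subrr.
apply: le_trans (ns_addQ _ _ Qd) _; case: k kM {Qc Qd} => [|j] jM /=.
  rewrite subrr (semi0 _ Hns) mulr_ge0 ?wn // mulr_ge0 //; lra.
have jM' : (j <= M)%N := ltnW jM.
have -> : F (a j t) - F (b j t) = T (a j t - b j t) + (F (a j t) - T (a j t) - (F (b j t) - T (b j t))).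
  by rewrite (linearB T) opprB [RHS]addrACA subrKC addKr.
have /andP[r0 _] := split_rate _ _ _ _ HS.
have h : ns (T (a j t - b j t) + (F (a j t) - T (a j t) - (F (b j t) - T (b j t)))) <=
    (r + kappa) * (B * weight ^+ (M - j)).
  apply: le_trans (semiD _ Hns _ _) _; rewrite mulrDl lerD //.
    apply: le_trans (nsT _) _; rewrite ler_pM2l //.
    exact: le_trans (ns_le_nmax _) (ab _ jM').
  apply: le_trans (ns_le_nmax _) _; apply: le_trans (Flip _ _ (ad _ jM') (bd _ jM')) _.
  by rewrite ler_pM2l // ab.
apply: le_trans h _.
have -> : weight ^+ (M - j) = weight * weight ^+ (M - j.+1) by rewrite -exprS subnSK.
rewrite (_ : (r + kappa) * _ = (r + kappa) * weight * (B * weight ^+ (M - j.+1))); last by ring.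
by rewrite -[leRHS]mulrA ler_wpM2r // mulr_ge0.
Qed.

(** Iterate [bvp_step] from [z] with the shifted end condition. Since [z] is already an orbit, the
    first iterate differs from it only at time [M]; the later increments decay like
    [(1 - kappa) ^+ n] in the weighted norm, and their sum is what the last hypothesis fits into
    [delta - d]. Each iterate is holomorphic, hence so is the uniform limit. *)
Lemma perturb M z d sigma v : orbit_family M z d -> d <= delta -> Q v = 0 ->
  cabs sigma * nmax v * weight ^+ M / kappa <= delta - d ->
  exists2 z', orbit_family M z' delta & forall t, cabs t = 1 ->
    z' M t - Q (z' M t) = z M t - Q (z M t) + (sigma * t) *: v.
Proof.
move=> zf dd Qv small.
have [k0 k1] := kappa_bounds; have [W1 W2 W3] := weight_bounds.
have w0 : 0 <= weight by apply: le_trans W1; exact: ler01.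
have wn n : 0 <= weight ^+ n by rewrite exprn_ge0.
have q0 n : 0 <= (1 - kappa) ^+ n by rewrite exprn_ge0; lra.
pose y t := z M t - Q (z M t) + (sigma * t) *: v.
pose beta := cabs sigma * nmax v.
have nmax_ge0 x : 0 <= nmax x := semi_ge0 _ nmax_seminorm x.
have b0 : 0 <= beta by rewrite mulr_ge0 ?cabs_ge0.
have QP x : Q (x - Q x) = 0 := split_QP _ _ _ _ HS x.
have Qy t : Q (y t) = 0 by rewrite /y (linearD Q) QP (linearZ_LR Q) /= Qv scaler0 addr0.
pose X n := iter n (bvp_step M y) z.
have wM k : (k <= M)%N -> weight ^+ (M - k) <= weight ^+ M.
  by move=> kM; rewrite ler_weXn2l // leq_subr.
have inb n t : (forall k, (k <= M)%N ->
      nmax (X n k t - z k t) <= beta * weight ^+ (M - k) * ((1 - (1 - kappa) ^+ n) / kappa)) ->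
    cabs t = 1 -> forall k, (k <= M)%N -> nmax (X n k t) <= delta.
  move=> h t1 k kM; apply: le_trans (semi_le_sub _ nmax_seminorm _ (z k t)) _.
  rewrite -(subrKC d delta) lerD ?(fam_bound _ _ _ zf) //; apply: le_trans (h k kM) _.
  apply: le_trans small; rewrite -/beta mulrA ler_pM2r ?invr_gt0 //.
  apply: (@le_trans _ _ (beta * weight ^+ (M - k) * 1)).
    by apply: ler_wpM2l; [rewrite mulr_ge0 ?wn|rewrite gerBl q0].
  by rewrite mulr1 ler_wpM2l ?b0 // wM.
have main n t : cabs t = 1 ->
    (forall k, (k <= M)%N -> nmax (X n k t - z k t) <= beta * weight ^+ (M - k) * ((1 - (1 - kappa) ^+ n) / kappa)) /\
    (forall k, (k <= M)%N -> nmax (X n.+1 k t - X n k t) <= (1 - kappa) ^+ n * beta * weight ^+ (M - k)).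
  move=> t1; elim: n => [|n [IH1 IH2]].
    split=> k kM; first by rewrite subrr nmax0 expr0 subrr mul0r mulr0.
    rewrite expr0 mul1r /X /= /bvp_step /central_part.
    have Qpart : Q (stable_part z k t) = Q (z k t).
      case: k kM => [|j] jM /=; first by rewrite (linear0 Q) (fam_start _ _ _ zf).
      by rewrite (fam_orbit _ _ _ zf).
    rewrite Qpart; case: ltnP => [km|Mk].
      rewrite -(fam_orbit _ _ _ zf) // subKr (split_left _ _ _ _ HS) subrK subrr nmax0.
      by rewrite mulr_ge0.
    have -> : k = M by apply/eqP; rewrite eqn_leq kM.
    rewrite /y [X in X - _]addrAC subrK [X in X - _]addrC addrK subnn expr0 mulr1 /beta.
    apply: le_trans (semiZ _ nmax_seminorm _ _) _.
    by rewrite cabsM t1 mulr1.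
  have IH1' k : (k <= M)%N -> nmax (X n.+1 k t - z k t) <=
      beta * weight ^+ (M - k) * ((1 - (1 - kappa) ^+ n.+1) / kappa).
    move=> kM.
    have -> : X n.+1 k t - z k t = (X n k t - z k t) + (X n.+1 k t - X n k t).
      by rewrite [RHS]addrC subrKA.
    apply: le_trans (semiD _ nmax_seminorm _ _) _.
    apply: le_trans (lerD (IH1 k kM) (IH2 k kM)) _.
    rewrite le_eqVlt; apply/orP; left; apply/eqP; rewrite exprS.
    by field; rewrite gt_eqF.
  split=> // k kM; rewrite exprS -(mulrA (1 - kappa)).
  apply: (@bvp_step_contract M y (X n.+1) (X n) ((1 - kappa) ^+ n * beta) t) => //.
  - by rewrite mulr_ge0.
  - exact: inb.
  - exact: inb.
have Xd n k t : (k <= M)%N -> cabs t = 1 -> nmax (X n k t) <= delta.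
  by move=> kM t1; apply: inb => //; exact: (main n t t1).1.
have XD n k t : (k <= M)%N -> cabs t = 1 ->
    rnorm (X n.+1 k t - X n k t) <= 2 * beta * weight ^+ M * (1 - kappa) ^+ n.
  move=> kM t1; apply: le_trans (rnorm_le_nmax _) _.
  rewrite (_ : 2 * beta * weight ^+ M * _ = 2 * ((1 - kappa) ^+ n * beta * weight ^+ M)); last by ring.
  rewrite ler_pM2l //; apply: le_trans ((main n t t1).2 k kM) _.
  by apply: ler_wpM2l; [exact: mulr_ge0|exact: wM].
have ex (kt : nat * R[i]) : exists l, (kt.1 <= M)%N -> cabs kt.2 = 1 ->
    forall n, rnorm (X n kt.1 kt.2 - l) <= 2 * beta * weight ^+ M * (1 - kappa) ^+ n / kappa.
  case: kt => k t /=.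
  have [[kM /eqP t1]|h] := pselect ((k <= M)%N /\ cabs t == 1); last first.
    by exists 0 => kM t1; case: h; rewrite kM t1.
  have [|||l hl] := @geometric_cvg _ _ (fun n => X n k t) (2 * beta * weight ^+ M) (1 - kappa).
  - by apply: mulr_ge0 => //; exact: mulr_ge0.
  - by lra.
  - by move=> n; exact: XD.
  exists l => _ _ n; have := hl n.
  by rewrite (_ : 1 - (1 - kappa) = kappa) //; ring.
have [l hl] := choice ex.
pose z' k t := l (k, t).
have z'X k t n : (k <= M)%N -> cabs t = 1 ->
    rnorm (X n k t - z' k t) <= 2 * beta * weight ^+ M * (1 - kappa) ^+ n / kappa.
  by move=> kM t1; exact: (hl (k, t) kM t1 n).
have small_pow e : 0 < e -> exists N, forall n, (N <= n)%N ->
    2 * beta * weight ^+ M * (1 - kappa) ^+ n / kappa <= e.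
  move=> e0.
  have : (fun n => (2 * beta * weight ^+ M / kappa) * (1 - kappa) ^+ n) @ \oo --> (0 : R).
    rewrite -[X in _ --> X](mulr0 (2 * beta * weight ^+ M / kappa)).
    apply: cvgM; first exact: cvg_cst.
    by apply: cvg_expr; rewrite ger0_norm; lra.
  move=> /cvgrPdist_le/(_ _ e0)[N _ hN]; exists N => n /hN /=; rewrite sub0r normrN => h.
  by rewrite mulrAC; exact: le_trans (ler_norm _) h.
have [C C0 hC] := semi_bounded _ nmax_seminorm.
have C1 : 0 < C + 1 by lra.
have nz e k t : 0 < e -> (k <= M)%N -> cabs t = 1 -> exists N, forall n, (N <= n)%N ->
    nmax (X n k t - z' k t) <= e.
  move=> e0 kM t1; have [N hN] := small_pow _ (divr_gt0 e0 C1); exists N => n Nn.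
  apply: le_trans (hC _) _; apply: (@le_trans _ _ ((C + 1) * (e / (C + 1)))).
    rewrite ler_pM ?rnorm_ge0 //; first by lra.
    exact: le_trans (z'X _ _ _ kM t1) (hN _ Nn).
  by rewrite mulrC mulfVK ?gt_eqF.
have z'd k t : (k <= M)%N -> cabs t = 1 -> nmax (z' k t) <= delta.
  move=> kM t1; apply/ler_addgt0Pr => e e0; have [N hN] := nz _ _ _ e0 kM t1.
  apply: le_trans (semi_le_sub _ nmax_seminorm _ (X N k t)) _.
  by rewrite (semi_sub _ nmax_seminorm) lerD ?Xd ?hN.
have XM n t : X n.+1 M t - Q (X n.+1 M t) = y t.
  rewrite /X iterS /bvp_step /central_part ltnn (linearD Q) Qy add0r.
  by rewrite (split_proj _ _ _ _ HS) addrK.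
exists z'; last first.
  move=> t t1; rewrite -/(y t); apply/eqP; rewrite -subr_eq0; apply/eqP/rnorm_le0 => e e0.
  have [N hN] := nz _ _ _ e0 (leqnn M) t1.
  have -> : z' M t - Q (z' M t) - y t = (z' M t - X N.+1 M t) - Q (z' M t - X N.+1 M t).
    by rewrite -(XM N t) (linearB Q) !opprD !opprK addrACA.
  apply: le_trans (nc_ge _) (le_trans (nc_le_nmax _) _).
  by rewrite (semi_sub _ nmax_seminorm) hN.
split => //.
- move=> k t km t1; have kM := ltnW km.
  apply/eqP; rewrite -subr_eq0; apply/eqP/rnorm_le0 => e e0.
  pose CT := C * K0 * 2.
  have CT0 : 0 <= CT by rewrite !mulr_ge0.
  have nT x : nmax (T x) <= CT * nmax x.
    apply: le_trans (hC _) _; rewrite /CT -!mulrA ler_wpM2l //.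
    by apply: le_trans (TK0 _) _; rewrite ler_wpM2l // rnorm_le_nmax.
  have c0 : 0 < 2 * (3 * CT + 4) by lra.
  (* The defect of the limit at time [k] will be at most [(3 * CT + 4) * e'] in [nmax], and [rnorm]
     is at most twice [nmax]. *)
  pose e' := e / (2 * (3 * CT + 4)).
  have e'0 : 0 < e' by rewrite divr_gt0.
  have [N hN] := nz _ _ _ e'0 kM t1; have [N' hN'] := nz _ _ _ e'0 km t1.
  pose n := maxn N N'.
  have a1 m : (n <= m)%N -> nmax (X m k t - z' k t) <= e'.
    by move=> nm; apply: hN; rewrite (leq_trans (leq_maxl _ _) nm).
  have a2 m : (n <= m)%N -> nmax (X m k.+1 t - z' k.+1 t) <= e'.
    by move=> nm; apply: hN'; rewrite (leq_trans (leq_maxr _ _) nm).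
  have a3 j : nmax (X n j t - z' j t) <= e' -> nmax (X n.+1 j t - z' j t) <= e' ->
      nmax (X n j t - X n.+1 j t) <= 2 * e'.
    move=> h1 h2; rewrite -(subrKA (z' j t)); apply: le_trans (semiD _ nmax_seminorm _ _) _.
    by rewrite (semi_sub _ nmax_seminorm (z' j t)); lra.
  have b1 := a3 k (a1 n (leqnn n)) (a1 n.+1 (leqnSn n)).
  have b2 := a3 k.+1 (a2 n (leqnn n)) (a2 n.+1 (leqnSn n)).
  set u := X n k t in b1; set u' := X n.+1 k t in b1.
  set w := X n k.+1 t in b2; set w' := X n.+1 k.+1 t in b2.
  have Qw' : Q w' = Q (F u).
    rewrite /w' /X iterS /bvp_step /central_part /= (linearD Q) (split_proj _ _ _ _ HS).
    by case: ifP => _; rewrite ?(split_QS _ _ _ _ HS) ?Qy add0r.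
  have Pu' : u' - Q u' = S (w - (F u - T u)).
    rewrite /u' /X iterS /bvp_step /central_part km -/X (linearD Q).
    by rewrite (split_QS _ _ _ _ HS) (split_proj _ _ _ _ HS) add0r addrK.
  (* The failure of the iterate to be an orbit, expressed by the increments from [X n] to [X n.+1],
     which tend to 0. *)
  have D : F u - w = T ((u - u') - Q (u - u')) + Q (w' - w).
    have TP x : T (x - Q x) = T x - Q (T x) by rewrite (linearB T) (split_comm _ _ _ _ HS).
    have -> : (u - u') - Q (u - u') = (u - Q u) - (u' - Q u') by rewrite (linearB Q) !opprD !opprK addrACA.
    rewrite Pu' (linearB T) TP (split_right _ _ _ _ HS) (linearB Q w') Qw' !(linearB Q).
    have sub4 (a b c g : V) : a - b - (c - g) = (a - c) - (b - g).
      by rewrite !opprD !opprK addrACA.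
    have E (a b c : V) : a - (c - (b - a)) = b - c by rewrite opprB addrA subrKC.
    by rewrite sub4 !E subrK.
  have FE : F (z' k t) - z' k.+1 t = (F u - w) + (w - z' k.+1 t) - (T (u - z' k t) + (F u - T u - (F (z' k t) - T (z' k t)))).
    have -> : T (u - z' k t) + (F u - T u - (F (z' k t) - T (z' k t))) = F u - F (z' k t).
      by rewrite (linearB T) opprB addrACA subrKC addKr.
    by rewrite subrKA opprB [RHS]addrC addrA subrK.
  have zd' := z'd _ _ kM t1; have ud : nmax u <= delta by exact: Xd.
  have uz := a1 n (leqnn n); rewrite -/u in uz.
  have wz := a2 n (leqnn n); rewrite -/w in wz.
  have d1 : nmax (T (u - z' k t) + (F u - T u - (F (z' k t) - T (z' k t)))) <= (CT + 1) * e'.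
    apply: le_trans (semiD _ nmax_seminorm _ _) _; rewrite mulrDl mul1r lerD //.
      by apply: le_trans (nT _) _; rewrite ler_wpM2l.
    apply: le_trans (Flip _ _ ud zd') _.
    by apply: le_trans uz; rewrite ler_piMl //; lra.
  have d2 : nmax (F u - w) <= CT * (2 * e') + 2 * e'.
    rewrite D; apply: le_trans (semiD _ nmax_seminorm _ _) _; apply: lerD.
      apply: le_trans (nT _) _; rewrite ler_wpM2l //; apply: le_trans b1.
      apply: nmax_le; first by rewrite nc_proj nc_le_nmax.
      by rewrite nsP.
    rewrite -/w (semi_sub _ nmax_seminorm) in b2.
    apply: le_trans b2; rewrite -[Q _]add0r; apply: nmax_le.
      by apply: le_trans (nc_addQ _ _) _; rewrite (semi0 _ Hnc).
    by apply: le_trans (ns_addQ _ _ (linear0 Q)) (ns_le_nmax _).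
  have d3 : nmax (F (z' k t) - z' k.+1 t) <= (3 * CT + 4) * e'.
    rewrite FE; apply: le_trans (semiB _ nmax_seminorm _ _) _.
    have := semiD _ nmax_seminorm (F u - w) (w - z' k.+1 t); lra.
  apply: le_trans (rnorm_le_nmax _) _.
  apply: (@le_trans _ _ (2 * (3 * CT + 4) * e')); first by rewrite -mulrA ler_pM2l.
  by rewrite /e' mulrC mulfVK ?gt_eqF.
- move=> t t1; apply/rnorm_le0 => e e0; have [N hN] := nz _ _ _ e0 (leq0n M) t1.
  have QX : Q (X N.+1 0%N t) = 0.
    rewrite /X iterS /bvp_step /central_part /= (linear0 Q) addr0.
    by case: ifP => _; rewrite ?(split_QS _ _ _ _ HS) ?Qy.
  rewrite -[X in rnorm X]subr0 -QX -(linearB Q).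
  apply: le_trans (ns_ge _) (le_trans (ns_le_nmax _) _).
  by rewrite (semi_sub _ nmax_seminorm) hN.
- move=> k kM.
  apply: (holo_limit (fun n => X n k)).
    move=> n; elim: n k kM => [|n IH] k kM; first exact: (fam_holo _ _ _ zf).
    have [KQ KQ0 hQ] := split_bounded _ _ _ _ HS.
    have [KS KS0 hS] := S_bounded.
    have hF j : (j <= M)%N -> exists w, holo (fun t => F (X n j t)) w.
      move=> jM; have [w hw] := IH j jM; exists (T w); apply: holoF hw _ => t t1.
      exact: Xd.
    have [w1 hw1] : exists w, holo (central_part M y (X n) k) w.
      rewrite /central_part; case: ltnP => km.
        have [a ha] := IH _ km; have [b hb] := hF _ kM; have [c hc] := IH _ kM.
        exists (S (a - (b - T c))); apply: holo_comp KS0 hS _.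
        by apply: holoB => //; apply: holoB => //; exact: holo_comp K0_ge0 TK0 hc.
      have [a ha] := fam_holo _ _ _ zf _ (leqnn M).
      exists ((a - Q a) + sigma *: v); apply: holoD.
        by apply: holoB => //; exact: holo_comp KQ0 hQ ha.
      have := holo_linear sigma _ _ _ _ (holo_ray v) holo_cst0; rewrite addr0.
      by apply: holo_ext => t _; rewrite addr0 scalerA.
    have [w2 hw2] : exists w, holo (stable_part (X n) k) w.
      case: k kM {w1 hw1} => [|j] jM; first by exists 0; exact: holo_cst0.
      by apply: hF; exact: ltnW.
    by exists (w1 + Q w2); apply: holoD => //; exact: holo_comp KQ0 hQ hw2.
  move=> e e0; have [N hN] := small_pow _ e0; exists N => n t Nn t1.
  exact: le_trans (z'X _ _ _ kM t1) (hN _ Nn).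
Qed.

Lemma fam_kerQ M z k w : orbit_family M z delta -> (k <= M)%N -> holo (z k) w -> Q w = 0.
Proof.
move=> h; elim: k w => [|k IH] w kM zw.
  have [KQ KQ0 hQ] := split_bounded _ _ _ _ HS.
  apply: (holo_unique (fun=> 0)); last exact: holo_cst0.
  apply: (holo_ext _ _ _ _ (holo_comp _ _ _ _ KQ0 hQ zw)) => t t1; exact: (fam_start _ _ _ h).
have [u zu] := fam_holo _ _ _ h _ (ltnW kM).
have hF : holo (z k.+1) (T u).
  apply: (holo_ext _ _ _ _ (holoF _ _ zu _)) => t t1; first exact: (fam_orbit _ _ _ h).
  by apply: (fam_bound _ _ _ h) => //; exact: ltnW.
by rewrite (holo_unique _ _ _ zw hF) (split_comm _ _ _ _ HS) (IH _ (ltnW kM) zu) (linear0 T).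
Qed.

(** Every disc passes through the fixed point 0, so the chain rule [holoF] involves only the
    differential there. *)
Lemma fam_deriv M z k j w w' : orbit_family M z delta -> (k + j <= M)%N ->
  holo (z k) w -> holo (z (k + j)%N) w' -> w' = iter j T w.
Proof.
move=> h; elim: j w' => [|j IH] w' kjM zw zw'.
  by move: zw'; rewrite addn0 => zw'; rewrite (holo_unique _ _ _ zw' zw).
have kj : (k + j < M)%N by rewrite -addnS.
have [u zu] := fam_holo _ _ _ h _ (ltnW kj).
rewrite iterS -(IH _ (ltnW kj) zw zu).
apply: holo_unique zw' _; rewrite addnS.
apply: (holo_ext _ _ _ _ (holoF _ _ zu _)) => t t1; first exact: (fam_orbit _ _ _ h).
by apply: (fam_bound _ _ _ h) => //; exact: ltnW.
Qed.

Lemma central_inverse n w : Q w = 0 -> iter n S (iter n T w) = w.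
Proof.
move=> Qw; have QTn k : Q (iter k T w) = 0.
  by elim: k => //= k IH; rewrite (split_comm _ _ _ _ HS) IH (linear0 T).
by elim: n => // n IH; rewrite iterSr iterS (split_left _ _ _ _ HS) QTn subr0.
Qed.

(** * Uniform escape and its impossibility *)

Definition escape N : Prop := forall x,
  (forall k, (k <= N)%N -> nmax (iter k F x) <= delta) -> ns x <= nc x -> nc x <= delta / 2.

Lemma fam_escape N M z k t : escape N -> orbit_family M z delta -> (k + N <= M)%N ->
  cabs t = 1 -> nmax (z k t) <= delta / 2.
Proof.
move=> esc h kN t1; have kM : (k <= M)%N := leq_trans (leq_addr _ _) kN.
have cone := fam_cone _ _ _ _ h kM t1.
have : nc (z k t) <= delta / 2.
  apply: esc => // j jN; have kjM : (k + j <= M)%N by rewrite (leq_trans _ kN) // leq_add2l.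
  by rewrite (fam_iter _ _ _ _ _ _ h kjM t1); exact: (fam_bound _ _ _ h).
by move=> hn; apply: nmax_le => //; exact: le_trans cone hn.
Qed.

Context (v : V) (lam : R[i]) (Tv : T v = lam *: v) (lam1 : cabs lam = 1) (Qv : Q v = 0).

Lemma iter_S_eigenvector n : iter n S v = lam^-1 ^+ n *: v.
Proof.
have lam0 : lam != 0 by exact: circle_neq0.
have Sv : S v = lam^-1 *: v.
  have : S (T v) = v by rewrite (split_left _ _ _ _ HS) Qv subr0.
  rewrite Tv (linearZ_LR S) /= => h.
  by rewrite -[in RHS]h scalerA mulVf // scale1r.
elim: n => [|n IH]; first by rewrite expr0 scale1r.
by rewrite iterS IH (linearZ_LR S) Sv /= scalerA -exprSr.
Qed.

(* Dropping the last [N] steps leaves room, at every time, to move the endpoint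
   by [s] in the direction [v], in steps small enough for [perturb]. *)
Lemma walk N M z s t : escape N -> orbit_family (M + N) z delta -> 0 <= s ->
  (1 - 2 * kappa) ^- N * (s * nc v) <= delta / 4 -> holo (z (M + N)%N) (t *: v) ->
  exists z' t', [/\ orbit_family M z' delta, holo (z' M) (t' *: v) & cabs t' = cabs t + s].
Proof.
move=> esc zf s0 room zt.
have [k0 k1] := kappa_bounds.
have zfM := fam_trunc _ _ _ _ zf.
have [w zw] := fam_holo _ _ _ zfM _ (leqnn M).
have Qw := fam_kerQ _ _ _ _ zfM (leqnn M) zw.
(* The derivative at time [M] is recovered from the one at time [M + N] by [S], which acts on [v] as
   [lam^-1], of modulus 1. *)
have wE : w = (t * lam^-1 ^+ N) *: v.
  rewrite -(central_inverse N w Qw) -(fam_deriv _ _ _ _ _ _ zf (leqnn _) zw zt).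
  have -> : iter N S (t *: v) = t *: iter N S v.
    by elim: (N) => //= n ->; rewrite (linearZ_LR S).
  by rewrite iter_S_eigenvector scalerA.
set t0 := t * _ in wE.
have t0E : cabs t0 = cabs t by rewrite /t0 cabsM cabsX cabsV lam1 invr1 expr1n mulr1.
(* [e] points in the direction of [t0], so that the displacement lengthens [t0] by the full amount
   [s]. *)
have [e e1 te] : exists2 e : R[i], cabs e = 1 & cabs (t0 + s%:C * e) = cabs t + s.
  have [t00|tn0] := eqVneq t0 0.
    exists 1; first exact: cabs1.
    by rewrite -t0E t00 cabs0 !add0r mulr1 cabs_real ger0_norm.
  have c0 : 0 < cabs t0 by rewrite lt0r cabs_ge0 cabs_eq0 tn0.
  exists (t0 * ((cabs t0)^-1)%:C).
    by rewrite cabsM cabs_real ger0_norm ?invr_ge0 ?cabs_ge0 // divff // gt_eqF.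
  rewrite mulrCA -rmorphM /= -{1}(mulr1 t0) -[1]/(1%:C) -mulrDr -rmorphD /= cabsM cabs_real.
  rewrite ger0_norm; last by rewrite addr_ge0 // divr_ge0 // cabs_ge0.
  by rewrite mulrDr mulr1 mulrCA divff ?gt_eqF // mulr1 t0E.
(* With more than [D] steps, each of size [s / J%:R], the smallness condition of [perturb] holds
   with margin [delta / 4]. *)
pose D := s * nmax v * weight ^+ M / kappa / (delta / 4).
have d4 : 0 < delta / 4 by rewrite divr_gt0.
have [W1 _ _] := weight_bounds.
have wM : 0 <= weight ^+ M by rewrite exprn_ge0 //; apply: le_trans W1; exact: ler01.
have D0 : 0 <= D.
  rewrite /D; apply: mulr_ge0; last by rewrite invr_ge0 ltW.
  apply: mulr_ge0; last by rewrite invr_ge0 ltW.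
  by apply: mulr_ge0 => //; apply: mulr_ge0 => //; exact: semi_ge0 nmax_seminorm _.
have /Num.Theory.archi_boundP := D0; set J := Num.bound _ => DJ.
have J0 : 0 < J%:R :> R := le_lt_trans D0 DJ.
have nv0 : 0 <= nc v := semi_ge0 _ Hnc v.
have steps i : (i <= J)%N -> exists2 z', orbit_family M z' delta &
    forall u, cabs u = 1 -> z' M u - Q (z' M u) =
      z M u - Q (z M u) + ((i%:R * (s / J%:R))%:C * e * u) *: v.
  elim: i => [|i IH] iJ.
    by exists z => // u _; rewrite mul0r !mul0r scale0r addr0.
  have [z1 z1f z1E] := IH (ltnW iJ).
  have z1b : orbit_family M z1 (3 / 4 * delta).
    have d0 := delta_gt0.
    split; [|exact: fam_orbit z1f|exact: fam_start z1f|exact: fam_holo z1f] => k u kM u1.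
    (* As long as [N] points remain, the current disc is itself within [delta / 2]. After that it is
       within [delta / 4] of [z], which is within [delta / 2] there because it continues for [N]
       more points. *)
    have [kN|kN] := leqP (k + N) M.
      by have := fam_escape _ _ _ _ _ esc z1f kN u1; lra.
    have kNM : (k + N <= M + N)%N by rewrite leq_add2r.
    have h1 := fam_escape _ _ _ _ _ esc zf kNM u1.
    have h2 := fam_dist _ _ _ _ _ z1f zfM kM u1.
    have h3 : nc (z1 M u - z M u) <= s * nc v.
      rewrite -nc_proj.
      have -> : z1 M u - z M u - Q (z1 M u - z M u) = ((i%:R * (s / J%:R))%:C * e * u) *: v.
        have -> : z1 M u - z M u - Q (z1 M u - z M u) = (z1 M u - Q (z1 M u)) - (z M u - Q (z M u)).
          by rewrite (linearB Q) !opprD !opprK addrACA.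
        by rewrite z1E // addrC addKr.
      apply: le_trans (semiZ _ Hnc _ _) _; rewrite ler_wpM2r //.
      rewrite !cabsM e1 u1 !mulr1 cabs_real ger0_norm; last first.
        by rewrite mulr_ge0 // divr_ge0 // ltW.
      rewrite mulrCA ler_piMr // ler_pdivrMr // mul1r ler_nat; exact: ltnW.
    have h4 : (1 - 2 * kappa) ^- (M - k) * nc (z1 M u - z M u) <= delta / 4.
      apply: le_trans room; apply: ler_pM => //; first by rewrite invr_ge0 exprn_ge0 //; lra.
        exact: semi_ge0 Hnc _.
      have a0 : 0 < 1 - 2 * kappa by lra.
      have a1 : 1 - 2 * kappa <= 1 by lra.
      have kMN : (M - k <= N)%N by rewrite leq_subLR ltnW.
      rewrite lef_pV2 ?posrE ?exprn_gt0 //.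
      exact: ler_wiXn2l (ltW a0) a1 _ _ kMN.
    have := semi_le_sub _ nmax_seminorm (z1 k u) (z k u); lra.
  have [||z2 z2f z2E] := perturb M z1 (3 / 4 * delta) ((s / J%:R)%:C * e) v z1b _ Qv.
  - by have d0 := delta_gt0; lra.
  - rewrite cabsM e1 mulr1 cabs_real ger0_norm ?divr_ge0 ?(ltW J0) //.
    have -> : delta - 3 / 4 * delta = delta / 4 by lra.
    have -> : s / J%:R * nmax v * weight ^+ M / kappa = s * nmax v * weight ^+ M / kappa / J%:R by field; rewrite !gt_eqF.
    by rewrite ler_pdivrMr // [leRHS]mulrC -ler_pdivrMr // ltW.
  exists z2 => // u u1; rewrite z2E // z1E // -addrA -scalerDl; congr (_ + _ *: _).
  by rewrite -natr1 mulrDl mul1r rmorphD /=; ring.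
have [z2 z2f z2E] := steps J (leqnn J).
have [w2 zw2] := fam_holo _ _ _ z2f _ (leqnn M).
exists z2, (t0 + s%:C * e); split => //.
(* As [w2] lies in the kernel of [Q], it is also the derivative of the disc with its [Q]-component
   removed, which is prescribed by [z2E]. *)
suff <- : w2 = (t0 + s%:C * e) *: v by [].
have [KQ KQ0 hQ] := split_bounded _ _ _ _ HS.
have Qw2 := fam_kerQ _ _ _ _ z2f (leqnn M) zw2.
have h1 : holo (fun u => z2 M u - Q (z2 M u)) w2.
  by rewrite -[w2]subr0 -Qw2; apply: holoB => //; exact: holo_comp KQ0 hQ zw2.
apply: holo_unique h1 _.
have h2 : holo (fun u => z M u - Q (z M u)) w.
  by rewrite -[w]subr0 -Qw; apply: holoB => //; exact: holo_comp KQ0 hQ zw.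
have h3 := holo_linear (s%:C * e) _ _ _ _ (holo_ray v) h2.
rewrite scalerDl -wE addrC; apply: holo_ext h3 => u u1.
have -> : s = J%:R * (s / J%:R) by rewrite mulrC mulfVK ?gt_eqF.
by rewrite z2E // addrC scalerA.
Qed.

Hypothesis v0 : v != 0.

(** Induction on [j] for all lengths at once: a disc of length [M] with [cabs t >= j.+1%:R * s] is
    obtained by [walk] from one of length [M + N], and ultimately from the zero disc. For large [j]
    this contradicts [holo_bound]. *)
Lemma no_escape N : ~ escape N.
Proof.
move=> esc; have [k0 k1] := kappa_bounds; have d0 := delta_gt0.
have a0 : 0 < 1 - 2 * kappa by lra.
have nv0 : 0 <= nc v := semi_ge0 _ Hnc v.
have nv1 : 0 < nc v + 1 by lra.
have aN : 0 < (1 - 2 * kappa) ^+ N by rewrite exprn_gt0.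
(* The room condition of [walk] determines [s]; it involves [N] but not the length of the disc. *)
pose s := delta / 4 * (1 - 2 * kappa) ^+ N / (nc v + 1).
have s0 : 0 < s by rewrite /s divr_gt0 // mulr_gt0 // divr_gt0.
have room : (1 - 2 * kappa) ^- N * (s * nc v) <= delta / 4.
  rewrite ler_pdivrMl // [leRHS]mulrC.
  have -> : s * nc v = delta / 4 * (1 - 2 * kappa) ^+ N * (nc v / (nc v + 1)).
    by rewrite /s; field; rewrite gt_eqF.
  rewrite ler_piMr //; first by rewrite mulr_ge0 ?(ltW aN) // divr_ge0 // ltW.
  by rewrite ler_pdivrMr // mul1r lerDl.
have fams j : forall M, exists z t, [/\ orbit_family M z delta, holo (z M) (t *: v) & j%:R * s <= cabs t].
  elim: j => [|j IH] M.
    exists (fun _ _ => 0), 0; split.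
    - split => [k t _ _|k t _ _|t _|k _]; rewrite ?nmax0 ?ltW ?F0 ?(linear0 Q) //.
      by exists 0; exact: holo_cst0.
    - by rewrite scale0r; exact: holo_cst0.
    - by rewrite mul0r cabs_ge0.
  have [z [t [zf zt tj]]] := IH (M + N)%N.
  have [z' [t' [zf' zt' tE]]] := walk N M z s t esc zf (ltW s0) room zt.
  exists z', t'; split => //; rewrite tE -natr1 mulrDl mul1r; lra.
have rv : 0 < rnorm v by rewrite rnorm_gt0.
have D0 : 0 <= 2 * delta / (s * rnorm v).
  by apply: divr_ge0; apply: mulr_ge0 => //; exact: ltW.
have /Num.Theory.archi_boundP := D0; set J := Num.bound _ => DJ.
have [z [t [zf zt tJ]]] := fams J 0%N.
have : rnorm (t *: v) <= 2 * delta.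
  apply: holo_bound zt _ => u u1; apply: le_trans (rnorm_le_nmax _) _.
  by rewrite ler_pM2l // (fam_bound _ _ _ zf).
rewrite rnormZ leNgt => /negP; apply; move: DJ.
rewrite ltr_pdivrMr; last exact: mulr_gt0.
move=> /lt_le_trans; apply.
by rewrite mulrA ler_pM2r.
Qed.

(** * A full orbit in the cone and its growth rate *)

Context {G : set_system nat} {GU : UltraFilter G}.
Hypothesis Goo : [set A | \forall n \near \oo, A n] `<=` G.
Hypothesis Fcompact : forall x : nat -> V, (forall n, nmax (x n) <= delta) ->
  exists y, forall e, 0 < e -> G [set n | rnorm (F (x n) - y) < e].

(** [no_escape] gives, for each [N], a point in the cone with [nc] above [delta / 2] whose first [N]
    iterates stay in the ball. Compactness yields a limit of the images [F (x N)], not of the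
    points; this step costs a factor [1 - 2 * kappa] in the lower bound for [nc]. *)
Lemma bounded_orbit : exists x,
  [/\ forall k, nmax (iter k F x) <= delta, ns x <= nc x & 0 < nc x].
Proof.
have [k0 k1] := kappa_bounds; have d0 := delta_gt0.
have /choice[x hx] N : exists x, [/\ forall k, (k <= N)%N -> nmax (iter k F x) <= delta,
    ns x <= nc x & delta / 2 < nc x].
  apply: contrapT => h; apply: (no_escape N) => x xd cone.
  by rewrite leNgt; apply/negP => xn; apply: h; exists x.
have [|y hy] := Fcompact x; first by move=> n; have [h _ _] := hx n; exact: h 0%N _.
have [C C0 hC] := semi_bounded _ nmax_seminorm.
have C1 : 0 < C + 1 by lra.
have ev (e : R) k : 0 < e -> exists2 n, (k < n)%N & nmax (F (x n) - y) <= e.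
  move=> e0; have Gk : G [set n | (k < n)%N] by apply: Goo; exists k.+1.
  have /(filterI Gk)/filter_ex[n /= [kn hn]] := hy _ (divr_gt0 e0 C1).
  exists n => //; apply: le_trans (hC _) _.
  apply: (@le_trans _ _ ((C + 1) * (e / (C + 1)))).
    by rewrite ler_pM ?rnorm_ge0 ?(ltW hn) //; lra.
  by rewrite mulrC mulfVK ?gt_eqF.
pose L := C * K0 * 2 + kappa.
have L0 : 0 <= L by rewrite /L addr_ge0 ?mulr_ge0 // ltW.
have FL u w : nmax u <= delta -> nmax w <= delta -> nmax (F u - F w) <= L * nmax (u - w).
  move=> ud wd.
  have -> : F u - F w = T (u - w) + (F u - T u - (F w - T w)).
    by rewrite (linearB T) opprB [RHS]addrACA subrKC addKr.
  apply: le_trans (semiD _ nmax_seminorm _ _) _; rewrite /L mulrDl; apply: lerD; last exact: Flip.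
  apply: le_trans (hC _) _; rewrite -!mulrA ler_wpM2l //.
  by apply: le_trans (TK0 _) _; rewrite ler_wpM2l // rnorm_le_nmax.
have main k : (forall n, (k < n)%N ->
    nmax (iter k F (F (x n)) - iter k F y) <= L ^+ k * nmax (F (x n) - y)) /\
    nmax (iter k F y) <= delta.
  elim: k => [|k [IH1 IH2]].
    have h n : (0 < n)%N -> nmax (iter 0 F (F (x n)) - iter 0 F y) <= L ^+ 0 * nmax (F (x n) - y).
      by rewrite expr0 mul1r.
    split=> //; apply/ler_addgt0Pr => e /(ev _ 0%N)[n n0 hn].
    apply: le_trans (semi_le_sub _ nmax_seminorm _ (F (x n))) _.
    rewrite (semi_sub _ nmax_seminorm) lerD //.
    by have [hb _ _] := hx n; exact: hb 1%N n0.
  have h n : (k.+1 < n)%N -> nmax (iter k.+1 F (F (x n)) - iter k.+1 F y) <= L ^+ k.+1 * nmax (F (x n) - y).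
    move=> kn; rewrite !iterS exprS -mulrA; apply: le_trans (FL _ _ _ IH2) _.
      by have [hb _ _] := hx n; rewrite -iterSr; apply: hb; exact: ltnW.
    by rewrite ler_wpM2l // IH1 // ltnW.
  split=> //; apply/ler_addgt0Pr => e e0.
  have Lk : 0 < L ^+ k.+1 + 1 by have := exprn_ge0 k.+1 L0; lra.
  have [n kn hn] := ev _ k.+1 (divr_gt0 e0 Lk).
  apply: le_trans (semi_le_sub _ nmax_seminorm _ (iter k.+1 F (F (x n)))) _.
  rewrite (semi_sub _ nmax_seminorm) lerD //.
    by have [hb _ _] := hx n; rewrite -iterSr; exact: hb.
  apply: le_trans (h n kn) _.
  apply: (@le_trans _ _ ((L ^+ k.+1 + 1) * (e / (L ^+ k.+1 + 1)))).
    rewrite ler_pM ?exprn_ge0 //; last by rewrite lerDl.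
    exact: semi_ge0 nmax_seminorm _.
  by rewrite mulrC mulfVK ?gt_eqF.
have near_y (e : R) : 0 < e -> exists n, nc (F (x n) - y) <= e /\ ns (F (x n) - y) <= e.
  move=> e0; have [n _ hn] := ev _ 0%N e0; exists n.
  by split; apply: le_trans hn; [exact: nc_le_nmax|exact: ns_le_nmax].
have stepx n : (1 - 2 * kappa) * nc (x n) <= nc (F (x n)) /\ ns (F (x n)) <= nc (F (x n)).
  by have [hb cone _] := hx n; apply: cone_step0 => //; exact: hb 0%N _.
exists y; split.
- by move=> k; have [] := main k.
- apply/ler_addgt0Pr => e e0; have [|n [h1 h2]] := near_y (e / 2); first by rewrite divr_gt0.
  have [_ h3] := stepx n.
  have h4 := semi_le_sub _ Hns y (F (x n)); rewrite (semi_sub _ Hns) in h4.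
  have h5 := semi_le_sub _ Hnc (F (x n)) y.
  lra.
- pose c := (1 - 2 * kappa) * (delta / 2).
  have c0 : 0 < c by rewrite /c mulr_gt0 //; lra.
  have [|n [h1 _]] := near_y (c / 2); first by rewrite divr_gt0.
  have [h2 _] := stepx n; have [_ _ h3] := hx n.
  have h5 := semi_le_sub _ Hnc (F (x n)) y.
  have h6 : c <= (1 - 2 * kappa) * nc (x n) by rewrite /c ler_wpM2l //; lra.
  lra.
Qed.

Hypothesis Fdiff : forall e : R, 0 < e -> exists2 d, 0 < d &
  forall x, rnorm x <= d -> rnorm (F x - T x) <= e * rnorm x.

(* Close to [0] the orbit is expanded by almost 1 in a norm adapted to a smaller
   rate [e]; away from [0] it cannot shrink by more than a constant factor. *)
Lemma slow_orbit : exists x, (forall k, nmax (iter k F x) <= delta) /\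
  forall e : R, 0 < e -> e < 1 / 2 -> exists2 c, 0 < c &
    forall n, c * (1 - 2 * e) ^+ n <= rnorm (iter n F x).
Proof.
have [k0 k1] := kappa_bounds; have d0 := delta_gt0.
have [x [xd xcone x0]] := bounded_orbit; exists x; split=> // e e0 e1.
have [nc' [Hnc' nc'Q nc'_ge _ nc'T]] := central_norm _ _ _ _ HS _ e0.
have [C' C'0 hC'] := semi_bounded _ Hnc'.
have [C C0 hC] := semi_bounded _ Hnc.
have C1 : 0 < C + 1 by lra.
have C1' : 0 < C' + 1 by lra.
have cone n : ns (iter n F x) <= nc (iter n F x).
  by elim: n => //= n IH; have [] := cone_step0 _ (xd n) IH.
have nc_nc' u : nc u <= (C + 1) * nc' u.
  rewrite -nc_proj; apply: le_trans (hC _) _.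
  apply: ler_pM; rewrite ?rnorm_ge0 //; lra.
have rn u : ns u <= nc u -> rnorm u <= 2 * nc u.
  by move=> uc; apply: le_trans (rnorm_le_nmax _) _; rewrite ler_pM2l // nmax_le.
(* In the cone [rnorm u <= 2 * (C + 1) * nc' u], so this makes the nonlinear error at most
   [e * nc' u] in [nc']. *)
pose e' := e / (C' * (2 * (C + 1)) + 1).
have den0 : 0 < C' * (2 * (C + 1)) + 1 by rewrite ltr_wpDl // mulr_ge0 //; lra.
have e'0 : 0 < e' by rewrite divr_gt0.
have [d dgt0 hd] := Fdiff _ e'0.
(* A lower bound for [nc' (F u)] when [u] is in the cone and [rnorm u > d]. *)
pose c1 := (1 - 2 * kappa) * (d / 2) / (C + 1).
have a0 : 0 < 1 - 2 * kappa by lra.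
have c10 : 0 < c1 by rewrite /c1 divr_gt0 // mulr_gt0 // divr_gt0.
have x0' : 0 < nc' x by have := nc_nc' x; rewrite -(pmulr_rgt0 _ C1); lra.
pose c := Num.min c1 (nc' x).
have c0 : 0 < c by rewrite /c lt_min c10 x0'.
have q0 : 0 <= 1 - 2 * e by lra.
have q1 : 1 - 2 * e <= 1 by lra.
have grow n : c * (1 - 2 * e) ^+ n <= nc' (iter n F x).
  elim: n => [|n IH]; first by rewrite expr0 mulr1 /c ge_min lexx orbT.
  set u := iter n F x in IH *; rewrite iterS -/u.
  have ucone : ns u <= nc u := cone n.
  have [ud|ud] := leP (rnorm u) d.
    have h1 := hd _ ud.
    have h2 := semi_le_sub _ Hnc' (T u) (F u).
    rewrite (semi_sub _ Hnc') in h2.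
    have h3 : nc' (F u - T u) <= e * nc' u.
      apply: le_trans (hC' _) _; apply: (@le_trans _ _ (C' * (e' * (2 * (C + 1) * nc' u)))).
        rewrite ler_wpM2l //; apply: le_trans h1 _; rewrite ler_pM2l //.
        by apply: le_trans (rn _ ucone) _; rewrite -mulrA ler_pM2l.
      have -> : C' * (e' * (2 * (C + 1) * nc' u)) = e * nc' u * (C' * (2 * (C + 1)) / (C' * (2 * (C + 1)) + 1)).
        by rewrite /e'; field; rewrite gt_eqF.
      rewrite ler_piMr ?mulr_ge0 ?(semi_ge0 _ Hnc') ?(ltW e0) //.
      by rewrite ler_pdivrMr // mul1r lerDl.
    have h4 : (1 - e) * nc' u <= nc' (T u).
      have h5 := nc'T u; have h6 := semi_ge0 _ Hnc' u.
      have p : 0 < 1 + e by lra.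
      rewrite -(ler_pM2l p); apply: le_trans h5; rewrite mulrA.
      have p2 : (1 + e) * (1 - e) <= 1 by nra.
      by have := ler_wpM2r h6 p2; rewrite mul1r.
    have h7 : (1 - 2 * e) * nc' u <= nc' (F u) by lra.
    apply: le_trans h7; rewrite exprS mulrCA; exact: ler_wpM2l.
  apply: (@le_trans _ _ c1).
    apply: (@le_trans _ _ (c * 1)); last by rewrite mulr1 /c ge_min lexx.
    by rewrite ler_wpM2l ?(ltW c0) // exprn_ile1.
  have [h1 _] := cone_step0 _ (xd n) ucone.
  rewrite /c1 ler_pdivrMr // [leRHS]mulrC; apply: le_trans (nc_nc' _); apply: le_trans h1.
  by rewrite ler_pM2l //; have := rn _ ucone; rewrite -/u; lra.
exists (c / (C' + 1)); first by rewrite divr_gt0.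
move=> n; rewrite mulrAC ler_pdivrMr //; apply: le_trans (grow n) _.
apply: le_trans (hC' _) _; rewrite [leRHS]mulrC ler_wpM2r ?rnorm_ge0 //; lra.
Qed.

End ConeDynamics.

(** * Analytic maps near a fixed point *)

Section VectorPolynomials.
Context {R : realType} {V : normedModType R[i]}.

(** Polynomial curves divisible by [t ^+ j]. The order is tracked to see that terms of degree at
    least 2 do not affect the derivative of a disc at 0. *)
Definition poly_order (j : nat) (f : R[i] -> V) : Prop := exists n, exists c : nat -> V,
  (forall i, (i < j)%N -> c i = 0) /\ forall t, f t = \sum_(i < n) t ^+ i *: c i.

Lemma poly_order_le j j' f : (j <= j')%N -> poly_order j' f -> poly_order j f.
Proof.
move=> jj [n [c [c0 h]]]; exists n, c; split=> // i ij.
by apply: c0; exact: leq_trans jj.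
Qed.

Lemma poly_orderD j f g : poly_order j f -> poly_order j g ->
  poly_order j (fun t => f t + g t).
Proof.
move=> [n [c [c0 h]]] [m [d [d0 h']]].
exists (maxn n m), (fun i => (if (i < n)%N then c i else 0) + (if (i < m)%N then d i else 0)).
split=> [i ij|t]; first by rewrite c0 // d0 // !if_same addr0.
rewrite h h' -(sum_pad _ _ c t (leq_maxl n m)) -(sum_pad _ _ d t (leq_maxr n m)).
by rewrite -big_split /=; apply: eq_bigr => i _; rewrite scalerDr.
Qed.

Lemma poly_order0 j : poly_order j (fun=> 0).
Proof. by exists 0%N, (fun=> 0); split=> // t; rewrite big_ord0. Qed.

Lemma poly_order_cst x : poly_order 0 (fun=> x).
Proof. by exists 1%N, (fun=> x); split=> // t; rewrite big_ord1 expr0 scale1r. Qed.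

Lemma poly_order_sum (I : Type) (s : seq I) (f : I -> R[i] -> V) j :
  (forall i, poly_order j (f i)) -> poly_order j (fun t => \sum_(i <- s) f i t).
Proof.
move=> hf; elim: s => [|i s IH].
  by apply: (eq_ind _ _ (poly_order0 j)); apply/funext => t; rewrite big_nil.
apply: (eq_ind _ _ (poly_orderD _ _ _ (hf i) IH)); apply/funext => t.
by rewrite big_cons.
Qed.

Lemma poly_order_shift j i f : poly_order j f -> poly_order (j + i) (fun t => t ^+ i *: f t).
Proof.
move=> [n [c [c0 h]]].
exists (n + i)%N, (fun k => if (k < i)%N then 0 else c (k - i)%N); split.
  by move=> k kj; case: ifP => // /negbT; rewrite -leqNgt => ik; apply: c0; lia.
move=> t; rewrite h scaler_sumr.
rewrite [RHS](eq_bigr (fun k : 'I_(n + i) => if (k < i)%N then 0 else t ^+ k *: c (k - i)%N)); last first.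
  by move=> k _; case: ifP => // _; rewrite scaler0.
rewrite -(big_mkord xpredT (fun k => if (k < i)%N then 0 else t ^+ k *: c (k - i)%N)).
rewrite (@big_cat_nat _ _ _ i) //=; last exact: leq_addl.
rewrite big_nat_cond [X in X + _]big1 ?add0r; last by move=> k /andP[/andP[_ ->] _].
rewrite (big_addn 0 (n + i) i) addnK big_mkord; apply: eq_bigr => k _.
by rewrite ltnNge leq_addl /= addnK exprD scalerA mulrC.
Qed.

(* The slots of [L] are made variable one at a time. *)
Lemma multilinear_poly_order k (L : ('I_k -> V) -> V) j (u : 'I_k -> R[i] -> V) :
  multilinear L -> (forall i, poly_order j (u i)) ->
  poly_order (j * k) (fun t => L (fun i => u i t)).
Proof.
move=> LL hu.
have claim m : (m <= k)%N -> forall w : 'I_k -> R[i] -> V,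
    (forall i : 'I_k, (i < m)%N -> poly_order j (w i)) ->
    (forall i : 'I_k, (m <= i)%N -> forall t, w i t = w i 0) ->
    poly_order (j * m) (fun t => L (fun i => w i t)).
  elim: m => [|m IH] mk w wj wc.
    rewrite muln0; apply: (eq_ind _ _ (poly_order_cst (L (fun i => w i 0)))).
    by apply/funext => t; congr L; apply/funext => i; rewrite wc.
  pose i0 := Ordinal mk.
  have [n [c [c0 h]]] := wj i0 (ltnSn m).
  have slot t : exists g : {linear V -> V}, forall x, g x = L [eta (fun i => w i t) with i0 |-> x].
    exact: linear_bundle (LL i0 _).
  have E t : L (fun i => w i t) = \sum_(l < n) t ^+ l *: L [eta (fun i => w i t) with i0 |-> c l].
    have [g gE] := slot t.
    have -> : (fun i => w i t) = [eta (fun i => w i t) with i0 |-> w i0 t].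
      by apply/funext => i /=; case: eqP => // ->.
    rewrite -gE h (linear_sum g); apply: eq_bigr => l _; rewrite (linearZ_LR g) gE /=.
    by congr (_ *: L _); apply/funext => i /=; case: eqP.
  apply: (eq_ind _ _ (_ : poly_order _ (fun t => \sum_(l < n) t ^+ l *: L [eta (fun i => w i t) with i0 |-> c l]))); last first.
    by apply/funext => t; rewrite -E.
  apply: poly_order_sum => l.
  have [lj|jl] := ltnP l j.
    apply: (eq_ind _ _ (poly_order0 _)); apply/funext => t.
    by have [g gE] := slot t; rewrite (c0 _ lj) -gE (linear0 g) scaler0.
  apply: (@poly_order_le _ (j * m + l)); first by rewrite mulnS addnC leq_add2l.
  apply: poly_order_shift.
  pose w' (i : 'I_k) t := if i == i0 then c l else w i t.
  have := IH (ltnW mk) w'.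
  have -> : (fun t => L (fun i => w' i t)) = (fun t => L [eta (fun i => w i t) with i0 |-> c l]).
    by apply/funext => t; congr L.
  apply.
    move=> i im; rewrite /w'; have -> : (i == i0) = false by apply/eqP => ii; move: im; rewrite ii ltnn.
    by apply: wj; exact: ltnW.
  move=> i mi t; rewrite /w'; case: eqP => // ii; apply: wc.
  by rewrite ltn_neqAle mi andbT; apply: contra_not_neq ii => im; exact/val_inj.
by apply: (claim k (leqnn k) u) => i; [move=> _; exact: hu|rewrite leqNgt ltn_ord].
Qed.

Lemma multilinear_homogeneous k (L : ('I_k -> V) -> V) (t : R[i]) x :
  multilinear L -> L (fun=> t *: x) = t ^+ k *: L (fun=> x).
Proof.
move=> LL.
have claim m : (m <= k)%N -> L (fun i => if (i < m)%N then t *: x else x) = t ^+ m *: L (fun=> x).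
  elim: m => [|m IH] mk; first by rewrite expr0 scale1r.
  pose i0 := Ordinal mk; pose u (i : 'I_k) := if (i < m)%N then t *: x else x.
  have [g gE] := linear_bundle _ (LL i0 u).
  have -> : (fun i : 'I_k => if (i < m.+1)%N then t *: x else x) = [eta u with i0 |-> t *: x].
    apply/funext => i /=; rewrite ltnS leq_eqVlt -val_eqE /u /=.
    by case: eqP.
  rewrite -gE (linearZ_LR g) gE exprS -scalerA -IH ?(ltnW mk) //=; congr (_ *: L _).
  by apply/funext => i /=; rewrite /u; case: eqP => // ->; rewrite ltnn.
rewrite -(claim k (leqnn k)); congr L; apply/funext => i.
by rewrite ltn_ord.
Qed.

End VectorPolynomials.

Lemma geometric_sum_le2 {R : realType} (q : R) n : 0 <= q -> q <= 1 / 2 ->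
  \sum_(i < n) q ^+ i <= 2.
Proof.
move=> q0 q1; elim: n => [|n IH]; first by rewrite big_ord0.
rewrite big_ord_recl expr0; under eq_bigr => i _ do rewrite /bump /= exprS.
rewrite -mulr_sumr; have := ler_wpM2l q0 IH; lra.
Qed.

(** The factor [eta] in [exp_lip] makes [F - T] an arbitrarily weak perturbation on small balls. *)
Record local_expansion {R : realType} {V : completeNormedModType R[i]}
    (U : set V) (F : V -> V) (T : {linear V -> V}) (rho K : R) : Prop := LocalExpansion {
  exp_rho : 0 < rho;
  exp_K : 0 <= K;
  exp_dom : forall x, rnorm x <= rho -> U x;
  exp_bound : forall x, rnorm (T x) <= K * rnorm x;
  exp_quad : forall x, rnorm x <= rho -> rnorm (F x - T x) <= K * rnorm x ^+ 2;
  exp_lip : forall eta x y, 0 < eta -> eta <= rho -> rnorm x <= eta -> rnorm y <= eta ->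
    rnorm (F x - T x - (F y - T y)) <= K * eta * rnorm (x - y);
  exp_holo : forall z w, holo z w -> (forall t, cabs t = 1 -> rnorm (z t) <= rho / 2) ->
    holo (fun t => F (z t)) (T w) }.

Section LocalExpansion.
Context {R : realType} {V : completeNormedModType R[i]}.
Context (F : V -> V) (F0 : F 0 = 0) (P : nat -> V -> V) (r0 : R) (r0_gt0 : 0 < r0).
Hypothesis Phom : forall k, homogeneous_polynomial k (P k).

Definition psum n x : V := \sum_(k < n) P k x.

Hypothesis psum_cvg : forall e : R, 0 < e -> exists N, forall n x, (N <= n)%N ->
  rnorm x < r0 -> rnorm (psum n x - F x) <= e.

Lemma term_homogeneous k t x : P k (t *: x) = t ^+ k *: P k x.
Proof. by have [_ [L LL PL]] := Phom k; rewrite !PL; exact: multilinear_homogeneous. Qed.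

Lemma term_poly_order k j u : poly_order j u -> poly_order (j * k) (fun t => P k (u t)).
Proof.
move=> uj; have [_ [L LL PL]] := Phom k.
have -> : (fun t => P k (u t)) = (fun t => L (fun=> u t)) by apply/funext => t; rewrite PL.
exact: (multilinear_poly_order k L j (fun=> u) LL (fun=> uj)).
Qed.

(** Continuity of the polynomials enters here; together with uniform convergence it bounds all late
    partial sums on a common ball. *)
Lemma psum_locally_bounded n : exists2 d, 0 < d & exists2 B, 0 <= B &
  forall x, rnorm x < d -> rnorm (psum n x) <= B.
Proof.
elim: n => [|n [d d0 [B B0 hB]]].
  by exists 1 => //; exists 0 => // x _; rewrite /psum big_ord0 rnorm0.
have [Pc _] := Phom n.
have /(Pc 0)/nbhs_rnorm[d' d'0 hd'] : nbhs (P n 0) [set y | rnorm (P n 0 - y) < 1].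
  by apply/nbhs_rnorm; exists 1.
exists (Num.min d d'); first by rewrite lt_min d0 d'0.
exists (B + (rnorm (P n 0) + 1)); first by rewrite addr_ge0 // addr_ge0 // rnorm_ge0.
move=> x; rewrite lt_min => /andP[xd xd']; rewrite /psum big_ord_recr /=.
apply: le_trans (rnormD _ _) _; apply: lerD; first exact: hB.
apply: le_trans (ler_rnorm_sub _ (P n 0)) _; rewrite lerD2l rnorm_sub ltW //.
by apply: hd'; rewrite sub0r rnormN.
Qed.

Lemma psum_bound : exists M rho : R, [/\ 0 <= M, 0 < rho, rho <= r0 &
  exists N, forall n x, (N <= n)%N -> rnorm x < rho -> rnorm (psum n x) <= M].
Proof.
have [N hN] := psum_cvg 1 ltr01.
have [d d0 [B B0 hB]] := psum_locally_bounded N.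
exists (B + 2), (Num.min d r0); split; first lra.
- by rewrite lt_min d0 r0_gt0.
- by rewrite ge_min lexx orbT.
exists N => n x Nn; rewrite lt_min => /andP[xd xr].
have h1 := hN _ _ Nn xr; have h2 := hN _ _ (leqnn N) xr; have h3 := hB _ xd.
have h4 := ler_rnorm_sub (psum n x) (psum N x).
have h5 := rdistD (F x) (psum n x) (psum N x); rewrite (rnorm_sub (F x)) in h5.
lra.
Qed.

(** [P k x] is the coefficient of [t ^+ k] in a late partial sum along [t *: x], so Cauchy's
    estimate bounds it for small [x]; homogeneity extends the bound to all [x]. *)
Lemma term_bound : exists M rho : R, [/\ 0 <= M, 0 < rho, rho <= r0 &
  forall k x, rnorm (P k x) <= M * (rnorm x / rho) ^+ k].
Proof.
have [M [r [M0 rg0 rr0 [N hN]]]] := psum_bound.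
have tb k x : rnorm x < r -> rnorm (P k x) <= M.
  move=> xr; rewrite -[leLHS]mulr1 -(expr1n _ k).
  apply: (@poly_cauchy _ _ (maxn N k.+1) (fun i => P i x) 1 M k) => //; last exact: leq_maxr.
  move=> t t1; rewrite (eq_bigr (fun i : 'I_(maxn N k.+1) => P i (t *: x))); last first.
    by move=> i _; rewrite term_homogeneous.
  by apply: hN; [exact: leq_maxl|rewrite rnormZ t1 mul1r].
exists M, (r / 2); split; [done|by rewrite divr_gt0|lra|].
move=> k x; have [->|x0] := eqVneq x 0.
  rewrite rnorm0 mul0r -{1}(scale0r 0) term_homogeneous rnormZ cabsX cabs0 mulrC.
  by rewrite ler_wpM2r ?exprn_ge0 // tb // rnorm0.
have xg0 : 0 < rnorm x by rewrite rnorm_gt0.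
have r2 : 0 < r / 2 by rewrite divr_gt0.
pose a := r / 2 / rnorm x.
have a0 : 0 < a by rewrite divr_gt0.
have ax : rnorm (a%:C *: x) < r.
  by rewrite rnormZ cabs_real gtr0_norm // /a mulfVK ?gt_eqF //; lra.
have := tb k _ ax; rewrite term_homogeneous rnormZ cabsX cabs_real gtr0_norm //.
rewrite mulrC -ler_pdivlMr ?exprn_gt0 // => h; apply: le_trans h _.
by rewrite -exprVn /a invf_div.
Qed.

Lemma local_expansionP : exists T rho K, local_expansion (fun x => rnorm x < r0) F T rho K.
Proof.
have [M [r [M0 rg0 rr0 tb]]] := term_bound.
have P00 : P 0%N 0 = 0.
  apply/rnorm_le0 => e /psum_cvg[N /(_ N.+1 0 (leqnSn N))].
  rewrite rnorm0 => /(_ r0_gt0); rewrite F0 subr0 /psum big_ord_recl big1 ?addr0 // => i _.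
  by rewrite -{1}(scale0r 0) term_homogeneous expr0n scale0r.
have P0 x : P 0%N x = 0.
  have [_ [L _ PL]] := Phom 0; rewrite -P00 !PL; congr L; apply/funext => -[]//.
have [T TE] : exists T : {linear V -> V}, forall x, T x = P 1%N x.
  have [_ [L LL PL]] := Phom 1.
  have [g gE] := linear_bundle _ (LL ord0 (fun=> 0)).
  exists g => x; rewrite gE PL; congr L; apply/funext => i /=.
  by rewrite ord1 eqxx.
pose phi n x : V := \sum_(i < n) P i.+2 x.
have psumE n x : psum n.+2 x = T x + phi n x.
  by rewrite /psum !big_ord_recl P0 add0r TE.
have phi_bound n x : rnorm x <= r / 2 -> rnorm (phi n x) <= 2 * M * (rnorm x / r) ^+ 2.
  move=> xr; apply: le_trans (rnorm_sum _ _ _ _) _.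
  have q0 : 0 <= rnorm x / r by rewrite divr_ge0 ?rnorm_ge0 // ltW.
  have q1 : rnorm x / r <= 1 / 2 by rewrite ler_pdivrMr //; lra.
  apply: (@le_trans _ _ (\sum_(i < n) M * (rnorm x / r) ^+ 2 * (rnorm x / r) ^+ i)).
    apply: ler_sum => i _; apply: le_trans (tb _ _) _.
    by rewrite -mulrA -exprD add2n.
  rewrite -mulr_sumr -(mulrA 2); have := geometric_sum_le2 _ n q0 q1.
  have : 0 <= M * (rnorm x / r) ^+ 2 by rewrite mulr_ge0 // exprn_ge0.
  move: (M * _) (\sum_(_ < _) _) => a b a0 b2.
  by have := ler_wpM2l a0 b2; lra.
have phi_cvg (e : R) : 0 < e -> exists N, forall n x, (N <= n)%N -> rnorm x < r0 ->
    rnorm (phi n x - (F x - T x)) <= e.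
  move=> /psum_cvg[N hN]; exists N => n x Nn xr.
  have := hN n.+2 x (leq_trans Nn (leqW (leqnSn n))) xr; rewrite psumE.
  by rewrite opprB addrA [phi n x + T x]addrC.
(* The first summand of [K] comes from the Lipschitz estimate of [phi], the second from the bound on
   [T]. The radius [r / 4] keeps points of norm up to [2 * rho] within reach of [phi_bound]. *)
pose rho := r / 4; pose K := 32 * M / r ^+ 2 + M / r.
have rho0 : 0 < rho by rewrite divr_gt0.
have r2 : 0 < r ^+ 2 by rewrite exprn_gt0.
have K1 : 0 <= 32 * M / r ^+ 2 by rewrite divr_ge0 ?mulr_ge0 // ltW.
have K2 : 0 <= M / r by rewrite divr_ge0 // ltW.
have K0 : 0 <= K by rewrite addr_ge0.
have Tb x : rnorm (T x) <= K * rnorm x.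
  rewrite TE; apply: le_trans (tb 1%N x) _.
  by rewrite expr1 mulrCA mulrC ler_wpM2r ?rnorm_ge0 // lerDr.
have rho_r0 (x : V) : rnorm x <= rho -> rnorm x < r0.
  by move=> xr; apply: le_lt_trans xr _; rewrite /rho; lra.
have lim_le (x y : V) (B : R) : rnorm x < r0 -> rnorm y < r0 ->
    (forall n, rnorm (phi n x - phi n y) <= B) -> rnorm (F x - T x - (F y - T y)) <= B.
  move=> xr yr hB; apply/ler_addgt0Pr => e e0; have e2 : 0 < e / 2 by rewrite divr_gt0.
  have [N hN] := phi_cvg _ e2.
  have h1 := hN N x (leqnn N) xr; have h2 := hN N y (leqnn N) yr.
  have -> : F x - T x - (F y - T y) = (phi N x - phi N y) - ((phi N x - (F x - T x)) - (phi N y - (F y - T y))).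
    have E (a b c d : V) : c - d = (a - b) - ((a - c) - (b - d)).
      have -> : a - c - (b - d) = a - b - (c - d) by rewrite !opprD !opprK addrACA.
      by rewrite subKr.
    exact: E.
  have := rnormB (phi N x - phi N y) ((phi N x - (F x - T x)) - (phi N y - (F y - T y))).
  have := rnormB (phi N x - (F x - T x)) (phi N y - (F y - T y)).
  have := hB N; lra.
have lip eta x y : 0 < eta -> eta <= rho -> rnorm x <= eta -> rnorm y <= eta ->
    rnorm (F x - T x - (F y - T y)) <= K * eta * rnorm (x - y).
  move=> eta0 etar xe ye.
  apply: lim_le; [by apply: rho_r0; lra|by apply: rho_r0; lra|] => n.
  pose h := x - y.
  have [h0|hn0] := eqVneq h 0.
    have -> : x = y by apply/eqP; rewrite -subr_eq0 -/h h0.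
    by rewrite !subrr rnorm0 mulr0.
  have hg0 : 0 < rnorm h by rewrite rnorm_gt0.
  have b1 z : rnorm z <= 2 * eta -> rnorm (phi n z) <= 8 * M * (eta / r) ^+ 2.
    move=> ze; apply: le_trans (phi_bound n z _) _; first by rewrite /rho in etar; lra.
    rewrite (_ : 8 * M * (eta / r) ^+ 2 = 2 * M * (2 * eta / r) ^+ 2); last by field; rewrite gt_eqF.
    rewrite ler_wpM2l ?mulr_ge0 // ler_pXn2r ?nnegrE ?divr_ge0 ?rnorm_ge0 ?mulr_ge0 ?(ltW rg0) ?(ltW eta0) //.
    by rewrite ler_pM2r ?invr_gt0.
  have Keta : 32 * M * (eta / r) ^+ 2 * (rnorm h / eta) <= K * eta * rnorm h.
    have -> : 32 * M * (eta / r) ^+ 2 * (rnorm h / eta) = 32 * M / r ^+ 2 * (eta * rnorm h).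
      by field; rewrite !gt_eqF.
    rewrite -(mulrA K) ler_wpM2r ?lerDl //.
    by apply: mulr_ge0; exact: ltW.
  have B0 : 0 <= M * (eta / r) ^+ 2 by rewrite mulr_ge0 // exprn_ge0 // divr_ge0 // ltW.
  apply: le_trans Keta.
  (* Points far apart are handled by bounding the two values separately. For close points, Cauchy's
     estimate for the polynomial [phi n (y + t *: h)] in [t], on the circle of radius
     [eta / rnorm h], bounds its coefficients; the difference is their sum from index 1 on. *)
  have [ysmall|ybig] := leP (2 * rnorm h) eta; last first.
    have h1 : rnorm (phi n x) <= 8 * M * (eta / r) ^+ 2 by apply: b1; lra.
    have h2 : rnorm (phi n y) <= 8 * M * (eta / r) ^+ 2 by apply: b1; lra.
    apply: le_trans (rnormB _ _) (le_trans (lerD h1 h2) _).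
    have q1 : 1 / 2 <= rnorm h / eta by rewrite ler_pdivlMr //; lra.
    move: ((eta / r) ^+ 2) (rnorm h / eta) q1 B0 => X q q1 B0.
    by have := ler_wpM2l B0 q1; lra.
  have [m [c [_ hc]]] : poly_order 0 (fun t => phi n (y + t *: h)).
    apply: poly_order_sum => i; rewrite -[0%N](mul0n i.+2); apply: term_poly_order.
    apply: poly_orderD; first exact: poly_order_cst.
    exact: (poly_order_le 0 (0 + 1) _ isT (poly_order_shift 0 1 _ (poly_order_cst h))).
  have hx : phi n x = \sum_(i < m) c i.
    have := hc 1; rewrite scale1r /h subrKC => ->.
    by apply: eq_bigr => i _; rewrite expr1n scale1r.
  have hy : phi n y = \sum_(i < m) 0 ^+ i *: c i by rewrite -hc scale0r addr0.
  pose Rr := eta / rnorm h.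
  have Rr0 : 0 < Rr by rewrite divr_gt0.
  have cB i : (i < m)%N -> rnorm (c i) * Rr ^+ i <= 8 * M * (eta / r) ^+ 2.
    apply: poly_cauchy; first exact: ltW.
    move=> t tR; rewrite -hc; apply: b1.
    apply: le_trans (rnormD _ _) _; rewrite rnormZ tR /Rr mulfVK ?gt_eqF //; lra.
  case: m hc hx hy cB => [|m] _ hx hy cB.
    rewrite hx hy !big_ord0 subrr rnorm0; apply: mulr_ge0; first by rewrite -mulrA mulr_ge0.
    by apply: divr_ge0; exact: ltW.
  have -> : phi n x - phi n y = \sum_(i < m) c i.+1.
    rewrite hx hy !big_ord_recl expr0 scale1r [X in _ - (_ + X)]big1 ?addr0; last first.
      by move=> i _; rewrite lift0 exprS mul0r scale0r.
    by rewrite [c _ + _]addrC addrK; apply: eq_bigr => i _; rewrite lift0.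
  have q0 : 0 <= rnorm h / eta by apply: divr_ge0; exact: ltW.
  have q1 : rnorm h / eta <= 1 / 2 by rewrite ler_pdivrMr //; lra.
  apply: le_trans (rnorm_sum _ _ _ _) _.
  apply: (@le_trans _ _ (\sum_(i < m) 8 * M * (eta / r) ^+ 2 * (rnorm h / eta) * (rnorm h / eta) ^+ i)).
    apply: ler_sum => i _; rewrite -mulrA -exprS.
    have im : (i.+1 < m.+1)%N by rewrite ltnS.
    have := cB i.+1 im; rewrite -ler_pdivlMr ?exprn_gt0 // => hh; apply: le_trans hh _.
    by rewrite -exprVn /Rr invf_div.
  rewrite -mulr_sumr; have g2 := geometric_sum_le2 _ m q0 q1.
  have c0 : 0 <= 8 * M * (eta / r) ^+ 2 * (rnorm h / eta).
    by apply: mulr_ge0 => //; rewrite -mulrA mulr_ge0.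
  apply: le_trans (ler_wpM2l c0 g2) _.
  have B1 : 0 <= M * (eta / r) ^+ 2 * (rnorm h / eta) by apply: mulr_ge0.
  by move: ((eta / r) ^+ 2) (rnorm h / eta) B1 => X q B1; lra.
exists T, rho, K; split=> //.
- move=> x xr; have [->|x0] := eqVneq x 0.
    by rewrite F0 (linear0 T) subrr rnorm0 expr0n mulr0.
  have xg0 : 0 < rnorm x by rewrite rnorm_gt0.
  have := lip _ x 0 xg0 xr (lexx _); rewrite rnorm0 F0 (linear0 T) !subr0 => /(_ (ltW xg0)).
  by rewrite expr2 mulrA.
- move=> z w zw zb e e0.
  have c0 : 0 < 2 * (K + K * rho + 1) by have := mulr_ge0 K0 (ltW rho0); lra.
  (* The first term keeps the approximating polynomial [p] in the ball of radius [rho]; the second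
     controls the distance from [F (z t)] to [F (p t)]. *)
  pose e1 := Num.min (rho / 2) (e / (2 * (K + K * rho + 1))).
  have rho2 : 0 < rho / 2 by rewrite divr_gt0.
  have e10 : 0 < e1 by rewrite /e1 lt_min rho2 divr_gt0.
  have e1r : e1 <= rho / 2 by rewrite /e1 ge_min lexx.
  have e1e : e1 <= e / (2 * (K + K * rho + 1)) by rewrite /e1 ge_min lexx orbT.
  have [n [c [c00 c1 hc]]] := zw _ e10.
  pose p t := \sum_(i < n.+2) t ^+ i *: c i.
  have e2 : 0 < e / 2 by rewrite divr_gt0.
  have [N hN] := psum_cvg _ e2.
  have porder1 : poly_order 1 p by exists n.+2, c; split=> // -[].
  (* Since [p] vanishes at 0, terms of degree at least 2 leave the coefficients of index 0 and 1 to
     [T] alone. *)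
  have [m [d [d0 hd]]] : poly_order 2 (fun t => phi N (p t)).
    apply: poly_order_sum => i; apply: (@poly_order_le _ _ _ (1 * i.+2)) => //.
    exact: term_poly_order.
  pose l := maxn n.+2 m.
  have nl : (n.+2 <= l.+2)%N by rewrite (leq_trans (leq_maxl _ m)) // (leq_trans (leqnSn _)).
  have ml : (m <= l.+2)%N by rewrite (leq_trans (leq_maxr n.+2 _)) // (leq_trans (leqnSn _)).
  exists l, (fun i => (if (i < n.+2)%N then T (c i) else 0) + (if (i < m)%N then d i else 0)).
  split; first by rewrite c00 (linear0 T) d0 // if_same addr0.
    by rewrite c1 d0 // if_same addr0.
  move=> t t1.
  have -> : \sum_(i < l.+2) t ^+ i *: ((if (i < n.+2)%N then T (c i) else 0) + (if (i < m)%N then d i else 0)) =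
      psum N.+2 (p t).
    rewrite psumE hd /p (linear_sum T) -(sum_pad _ _ d t ml).
    rewrite (eq_bigr (fun i : 'I_n.+2 => t ^+ i *: T (c i))); last by move=> i _; rewrite (linearZ_LR T).
    rewrite -(sum_pad _ _ (fun i => T (c i)) t nl) -big_split /=.
    by apply: eq_bigr => i _; rewrite scalerDr.
  have zt := zb t t1.
  have zp : rnorm (z t - p t) <= e1 := hc t t1.
  have pt : rnorm (p t) <= rho.
    by have := ler_rnorm_sub (p t) (z t); rewrite rnorm_sub; lra.
  have ztr : rnorm (z t) <= rho by lra.
  have h1 := hN N.+2 (p t) (leqW (leqnSn N)) (rho_r0 _ pt).
  have h2 := lip rho (z t) (p t) rho0 (lexx _) ztr pt.
  have h3 := Tb (z t - p t).
  have h4 : rnorm (F (z t) - F (p t)) <= e / 2.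
    have -> : F (z t) - F (p t) = T (z t - p t) + (F (z t) - T (z t) - (F (p t) - T (p t))).
      by rewrite (linearB T) opprB [RHS]addrACA subrKC addKr.
    apply: le_trans (rnormD _ _) _; apply: le_trans (lerD h3 h2) _; rewrite -mulrDl.
    apply: (@le_trans _ _ ((K + K * rho + 1) * (e / (2 * (K + K * rho + 1))))).
      have Kr : 0 <= K + K * rho by rewrite addr_ge0 // mulr_ge0 // ltW.
      by apply: ler_pM; rewrite ?rnorm_ge0 ?lerDl //; exact: le_trans zp e1e.
    by rewrite le_eqVlt; apply/orP; left; apply/eqP; field; rewrite gt_eqF //; lra.
  apply: le_trans (rdistD (F (p t)) _ _) _; rewrite [leRHS]splitr lerD //.
  by rewrite rnorm_sub.
Qed.

End LocalExpansion.

Section AnalyticGerm.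
Context {R : realType} {V : completeNormedModType R[i]}.

Lemma analytic_local_expansion (U : set V) (F : V -> V) : U 0 -> F 0 = 0 ->
  analytic_on U F -> exists T rho K, local_expansion U F T rho K.
Proof.
move=> U0 F0 /(_ 0 U0)[r [r_gt0 rU] [P Phom cvgP]].
have rE : r = (complex.Re r)%:C by rewrite RRe_real // gtr0_real.
have r0 : 0 < complex.Re r by rewrite -ltcR -rE.
have ballE x : ball (0 : V) r x <-> rnorm x < complex.Re r.
  by rewrite rE ball_rnorm sub0r rnormN.
have hcvg (e : R) : 0 < e -> exists N, forall n x, (N <= n)%N ->
    rnorm x < complex.Re r -> rnorm (psum P n x - F x) <= e.
  move=> e0.
  have : nbhs (F : {uniform` ball (0 : V) r -> V})
      [set h | forall y, ball (0 : V) r y -> rnorm (F y - h y) < e].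
    apply/uniform_nbhs; exists [set xy | ball xy.1 e%:C xy.2]; split.
      have eC : 0 < e%:C :> R[i] by rewrite ltcR.
      exact: (entourage_ball V (PosNum eC)).
    by move=> h hh y /hh /ball_rnorm.
  move=> /cvgP[N _ hN]; exists N => n x Nn xr.
  have := hN n Nn x (iffRL (ballE x) xr); rewrite rnorm_sub => /ltW.
  by rewrite /psum; under eq_bigr do rewrite subr0.
have [T [rho [K [h1 h2 h3 h4 h5 h6 h7]]]] := local_expansionP F F0 P _ r0 Phom hcvg.
exists T, rho, K; split=> // x /h3 xr; apply: rU; exact/ballE.
Qed.

Context (U : set V) (F : V -> V) (T : {linear V -> V}) (rho K : R).
Hypothesis HF : local_expansion U F T rho K.
Hypothesis F0 : F 0 = 0.

Lemma expansion_differential : 'd F (0 : V) = T :> (V -> V).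
Proof.
have K0 := exp_K _ _ _ _ _ HF; have rho0 := exp_rho _ _ _ _ _ HF.
apply: diff_unique.
  move=> x A /nbhs_rnorm[e e0 hA]; apply/nbhs_rnorm.
  have K1 : 0 < K + 1 by lra.
  exists (e / (K + 1)); first by rewrite divr_gt0.
  move=> y hy; apply: hA; rewrite -(linearB T).
  apply: le_lt_trans (exp_bound _ _ _ _ _ HF _) _.
  apply: (@le_lt_trans _ _ ((K + 1) * rnorm (x - y))).
    by rewrite ler_wpM2r ?rnorm_ge0 // lerDl.
  by rewrite mulrC -ltr_pdivlMr.
apply/eqaddoP => e e0.
have eE : e = (complex.Re e)%:C by rewrite RRe_real // gtr0_real.
have e1 : 0 < complex.Re e by rewrite -ltcR -eE.
have K1 : 0 < K + 1 by lra.
apply/nbhs_rnorm; exists (Num.min rho (complex.Re e / (K + 1))).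
  by rewrite lt_min rho0 divr_gt0.
move=> x; rewrite sub0r rnormN lt_min => /andP[/ltW xr xe] /=.
rewrite eE !rnormE -rmorphM lecR /= /cst /= -[(_ - _) x]/(F (x + 0) - (F 0 + T x)).
rewrite addr0 F0 add0r; apply: le_trans (exp_quad _ _ _ _ _ HF _ xr) _.
rewrite expr2 mulrA ler_wpM2r ?rnorm_ge0 //.
apply: (@le_trans _ _ ((K + 1) * rnorm x)); first by rewrite ler_wpM2r ?rnorm_ge0 // lerDl.
by rewrite mulrC -ler_pdivlMr // ltW.
Qed.

Context {G : set_system nat} {GU : UltraFilter G}.
Hypothesis F_compact : compact_operator_on U F.

Lemma compact_ultralimit_ball (x : nat -> V) : (forall n, rnorm (x n) <= rho) ->
  exists y, forall e, 0 < e -> G [set n | rnorm (F (x n) - y) < e].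
Proof.
move=> xr; pose A := [set z : V | rnorm z <= rho].
have : precompact (F @` A).
  apply: F_compact; first exact: (exp_dom _ _ _ _ _ HF).
  exists rho%:C; split; first by rewrite complex_real.
  by move=> M hM z /= zA; rewrite rnormE (le_trans _ (ltW hM)) // lecR.
rewrite precompactE => cA.
have [n|y _ hy] := @compact_ultralimit _ _ _ _ (fun n => F (x n)) cA.
  by apply: subset_closure; exists (x n) => //; exact: xr.
exists y => e e0; have : nbhs y [set z | rnorm (y - z) < e] by apply/nbhs_rnorm; exists e.
by move=> /hy; apply: filterS => n /=; rewrite rnorm_sub.
Qed.

(* [T] is the limit of the compact maps [x |-> F (s x) / s] as [s] tends to [0],
   uniformly on bounded sets. *)
Lemma differential_ultracompact : ultracompact (G := G) T.
Proof.
move=> x B xB.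
have K0 := exp_K _ _ _ _ _ HF; have rho0 := exp_rho _ _ _ _ _ HF.
have B0 : 0 <= B := le_trans (rnorm_ge0 _) (xB 0%N).
have B1 : 0 < B + 1 by lra.
(* The first factor keeps [s j] times [x n] in the ball of radius [rho]. Halving the scale halves
   the error [K * B ^+ 2 * s j], which makes the approximating limits [u j] converge
   geometrically. *)
pose s j : R := rho / (B + 1) * 2^-1 ^+ j.
have h0 : 0 <= 2^-1 :> R by lra.
have h1 : 2^-1 <= 1 :> R by lra.
have s0 j : 0 < s j by rewrite /s mulr_gt0 ?divr_gt0 // exprn_gt0 // invr_gt0.
have sx j n : rnorm ((s j)%:C *: x n) <= rho.
  rewrite rnormZ cabs_real gtr0_norm //.
  apply: (@le_trans _ _ (rho / (B + 1) * (B + 1))); last by rewrite mulfVK ?gt_eqF.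
  apply: ler_pM; rewrite ?rnorm_ge0 ?(ltW (s0 j)) //; last by have := xB n; lra.
  by rewrite /s ler_piMr ?exprn_ile1 // divr_ge0 // ltW.
have /choice[y hy] j : exists y, forall e, 0 < e -> G [set n | rnorm (F ((s j)%:C *: x n) - y) < e].
  by apply: compact_ultralimit_ball => n; exact: sx.
pose u j := ((s j)^-1)%:C *: y j.
have appr j n : rnorm (T (x n) - ((s j)^-1)%:C *: F ((s j)%:C *: x n)) <= K * B ^+ 2 * s j.
  have -> : T (x n) = ((s j)^-1)%:C *: T ((s j)%:C *: x n).
    by rewrite (linearZ_LR T) /= scalerA -rmorphM mulVf ?gt_eqF //= scale1r.
  rewrite -scalerBr rnormZ cabs_real gtr0_norm ?invr_gt0 // rnorm_sub ler_pdivrMl //.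
  apply: le_trans (exp_quad _ _ _ _ _ HF _ (sx j n)) _.
  rewrite rnormZ cabs_real gtr0_norm // exprMn.
  rewrite (_ : s j * _ = K * (s j ^+ 2 * B ^+ 2)); last by ring.
  rewrite ler_wpM2l // ler_pM2l ?exprn_gt0 // ler_pXn2r ?nnegrE ?rnorm_ge0 //.
have near_u j e : 0 < e -> G [set n | rnorm (((s j)^-1)%:C *: F ((s j)%:C *: x n) - u j) < e].
  move=> e0; have := hy j _ (mulr_gt0 (s0 j) e0); apply: filterS => n /= h.
  by rewrite /u -scalerBr rnormZ cabs_real gtr0_norm ?invr_gt0 // ltr_pdivrMl.
pose D := 2 * (K * B ^+ 2 * (rho / (B + 1))).
have KB : 0 <= K * B ^+ 2 by rewrite mulr_ge0 // exprn_ge0.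
have D0 : 0 <= D by rewrite /D mulr_ge0 // mulr_ge0 // divr_ge0 // ltW.
have near_T j e : 0 < e -> G [set n | rnorm (T (x n) - u j) < K * B ^+ 2 * s j + e].
  move=> /(near_u j); apply: filterS => n /= h.
  by apply: le_lt_trans (rdistD (((s j)^-1)%:C *: F ((s j)%:C *: x n)) _ _) _; exact: ler_ltD.
have [|||l hl] := @geometric_cvg _ _ u D 2^-1 => //; first lra.
  move=> j; apply/ler_addgt0Pr => e e0; have e2 : 0 < e / 2 by rewrite divr_gt0.
  have /(filterI (near_T j.+1 _ e2))/filter_ex[n /= [i1 i2]] := near_T j _ e2.
  have sS : s j.+1 = 2^-1 * s j by rewrite /s exprS mulrCA.
  have DE : D * 2^-1 ^+ j = 2 * (K * B ^+ 2 * s j) by rewrite /D /s; ring.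
  have sK : K * B ^+ 2 * s j.+1 = 2^-1 * (K * B ^+ 2 * s j) by rewrite sS; ring.
  have p : 0 <= K * B ^+ 2 * s j by rewrite mulr_ge0 // ltW.
  have := rdistD (T (x n)) (u j.+1) (u j); rewrite (rnorm_sub (u j.+1) (T _)).
  rewrite DE; move: i1 i2; rewrite sK; lra.
exists l => e e0; have e3 : 0 < e / 3 by rewrite divr_gt0.
have : (fun j => (K * B ^+ 2 * (rho / (B + 1)) + 2 * D) * 2^-1 ^+ j) @ \oo --> (0 : R).
  rewrite -[X in _ --> X](mulr0 (K * B ^+ 2 * (rho / (B + 1)) + 2 * D)); apply: cvgM; first exact: cvg_cst.
  by apply: cvg_expr; rewrite ger0_norm //; lra.
move=> /cvgrPdist_le/(_ _ e3)[j _ /(_ j (leqnn j))] /=; rewrite sub0r normrN => /(le_trans (ler_norm _)) hj.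
have := near_T j _ e3; apply: filterS => n /= hn.
apply: le_lt_trans (rdistD (u j) _ _) _.
have hlj := hl j; have E2 : 1 - 2^-1 = 2^-1 :> R by lra.
rewrite E2 invrK in hlj.
have E : (K * B ^+ 2 * (rho / (B + 1)) + 2 * D) * 2^-1 ^+ j = K * B ^+ 2 * s j + D * 2^-1 ^+ j * 2.
  by rewrite /s; ring.
rewrite E in hj; lra.
Qed.

End AnalyticGerm.

(** * Logarithmic growth rates and conclusion *)

Lemma log_growth_cvg {R : realType} (a : nat -> R) (M : R) : (forall n, a n <= M) ->
  (forall e : R, 0 < e -> e < 1 / 2 -> exists2 c, 0 < c & forall n, c * (1 - 2 * e) ^+ n <= a n) ->
  (fun n : nat => n%:R^-1 * ln (a n)) @ \oo --> (0 : R).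
Proof.
move=> aM low.
have a0 n : 0 < a n.
  have [||c c0 hc] := low (1 / 4); [lra|lra|].
  by apply: lt_le_trans (hc n); rewrite mulr_gt0 // exprn_gt0; lra.
apply/cvgrPdist_le => e e0.
have q0 := expR_gt0 (- (e / 2)).
have q1 : expR (- (e / 2)) < 1 by rewrite expR_lt1; lra.
(* The parameter is chosen so that the base [1 - 2 * e] becomes [expR (- (e / 2))]: its logarithm
   uses half of the admissible error, and the other half absorbs the constants [c] and [M] for large
   [n]. *)
have [||c c0 hc] := low ((1 - expR (- (e / 2))) / 2); [lra|lra|].
have qE : 1 - 2 * ((1 - expR (- (e / 2))) / 2) = expR (- (e / 2)) by field.
rewrite qE in hc.
have lnlow n : ln c - n%:R * (e / 2) <= ln (a n).
  have -> : ln c - n%:R * (e / 2) = ln (c * expR (- (e / 2)) ^+ n).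
    by rewrite lnM ?posrE ?exprn_gt0 // lnXn // expRK -(mulr_natl (- (e / 2)) n) mulrN.
  by rewrite ler_ln ?posrE ?mulr_gt0 ?exprn_gt0.
have lnup n : ln (a n) <= ln M.
  by rewrite ler_ln ?posrE ?(lt_le_trans (a0 n)).
pose B := (`|ln c| + `|ln M|) * (2 / e).
have B0 : 0 <= B by rewrite mulr_ge0 ?addr_ge0 // divr_ge0 // ltW.
have /Num.Theory.archi_boundP := B0; set N := Num.bound _ => BN.
exists N.+1 => // n /= Nn.
have Bn : B < n%:R by apply: lt_trans BN _; rewrite ltr_nat.
have n0 : 0 < n%:R :> R := le_lt_trans B0 Bn.
rewrite sub0r normrN normrM gtr0_norm ?invr_gt0 // ler_pdivrMl //.
have key : `|ln c| + `|ln M| <= n%:R * (e / 2).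
  have : B * (e / 2) <= n%:R * (e / 2) by rewrite ler_wpM2r ?ltW // divr_gt0.
  by rewrite /B -mulrA (_ : 2 / e * (e / 2) = 1) ?mulr1 //; field; rewrite gt_eqF.
have k1 := ler_norm (- ln c); have k2 := ler_norm (ln M); rewrite normrN in k1.
have k3 := normr_ge0 (ln c); have k4 := normr_ge0 (ln M).
have := lnlow n; have := lnup n => l1 l2.
by rewrite ler_norml; apply/andP; split; lra.
Qed.

Theorem theorem3p1 (R : realType) (B : completeNormedModType R[i])
    (U : set B) (F : B -> B)
    (U_nbhs : open_nbhs 0 U)
    (F0 : F 0 = 0)
    (F_analytic : analytic_on U F)
    (F_compact : compact_operator_on U F)
    (F_neutral : exists2 lambda : R[i],
       eigenvalue_of ('d F (0 : B)) lambda & neutral lambda) :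
  slow_small_orbits U F.
Proof.
move=> N N0; have [_ U0] := U_nbhs.
have [T [rho [K HF]]] := analytic_local_expansion U F U0 F0 F_analytic.
have [lam [v v0 Tv] lam1'] := F_neutral.
rewrite (expansion_differential _ _ _ _ _ HF F0) in Tv.
have lam1 : cabs lam = 1 by rewrite /cabs lam1'.
have K0 := exp_K _ _ _ _ _ HF; have rho0 := exp_rho _ _ _ _ _ HF.
have [G [GU Goo]] := ultraFilterLemma (eventually_filter).
have TK := exp_bound _ _ _ _ _ HF.
have Tc : ultracompact (G := G) T.
  exact: (differential_ultracompact _ _ _ _ _ HF F_compact).
have [Q [S [r HS]]] := compact_spectral_splitting Goo T K K0 TK Tc.
have /andP[r0 r1] := split_rate _ _ _ _ HS.
pose kappa := (1 - r) / 8.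
have k0 : 0 < kappa by rewrite /kappa; lra.
have rE : r = 1 - 8 * kappa by rewrite /kappa; lra.
have [nc [Hnc ncQ nc_ge ncS ncT]] := central_norm _ _ _ _ HS _ k0.
have [ns [Hns nsP ns_ge nsT]] := stable_norm _ _ _ _ HS.
have Hn := nmax_seminorm nc ns Hnc Hns.
have [C C0 hC] := semi_bounded _ Hn.
have nle x : rnorm x <= 2 * nmax nc ns x := rnorm_le_nmax Q nc ns nc_ge ns_ge x.
have [d d0 hd] := iffLR (nbhs_rnorm 0 N) N0.
(* The vectors [iter n T (Q v)] all have the norm of [Q v], because the eigenvalue is neutral, yet
   they decay like [r ^+ n]. *)
have Qv : Q v = 0.
  have [D D0 hD] := split_stable _ _ _ _ HS.
  have TQv n : iter n T (Q v) = lam ^+ n *: Q v.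
    elim: n => [|n IH]; first by rewrite expr0 scale1r.
    rewrite iterS IH (linearZ_LR T) /= -(split_comm _ _ _ _ HS) Tv (linearZ_LR Q) /=.
    by rewrite scalerA -exprSr.
  apply: rnorm_le0 => e e0.
  have : (fun n => D * rnorm v * r ^+ n) @ \oo --> (0 : R).
    rewrite -[X in _ --> X](mulr0 (D * rnorm v)); apply: cvgM; first exact: cvg_cst.
    by apply: cvg_expr; rewrite gtr0_norm.
  move=> /cvgrPdist_le/(_ _ e0)[n _ /(_ n (leqnn n))] /=; rewrite sub0r normrN => h.
  apply: le_trans (le_trans (ler_norm _) h); have := hD n v.
  by rewrite TQv rnormZ cabsX lam1 expr1n mul1r mulrAC.
have CK : 0 < 4 * (C * K + 1) by have := mulr_ge0 C0 K0; lra.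
(* The [nmax]-ball of radius [delta] lies in the norm ball of radius [2 * delta]. The three terms
   put this ball inside the domain of the expansion, inside the neighborhood [N], and make [F - T]
   Lipschitz with constant [kappa] for [nmax]. *)
pose delta := Num.min (rho / 4) (Num.min (d / 4) (kappa / (4 * (C * K + 1)))).
have delta0 : 0 < delta by rewrite /delta !lt_min; apply/and3P; split; exact: divr_gt0.
have delta1 : delta <= rho / 4 by rewrite /delta ge_min lexx.
have delta2 : delta <= d / 4 by rewrite /delta !ge_min lexx orbT.
have delta3 : C * K * delta * 4 <= kappa.
  have : delta <= kappa / (4 * (C * K + 1)) by rewrite /delta !ge_min lexx !orbT.
  rewrite ler_pdivlMr // => h; apply: le_trans h.
  by have := ltW delta0; lra.
have small x : nmax nc ns x <= delta -> rnorm x <= 2 * delta.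
  by move=> xd; apply: le_trans (nle x) _; rewrite ler_pM2l.
have Flip x y : nmax nc ns x <= delta -> nmax nc ns y <= delta ->
    nmax nc ns (F x - T x - (F y - T y)) <= kappa * nmax nc ns (x - y).
  move=> /small xd /small yd.
  have e0 : 0 < 2 * delta by lra.
  have e1 : 2 * delta <= rho by lra.
  have h := exp_lip _ _ _ _ _ HF _ _ _ e0 e1 xd yd.
  apply: le_trans (hC _) _; apply: le_trans (ler_wpM2l C0 h) _.
  have hn := semi_ge0 _ Hn (x - y).
  apply: (@le_trans _ _ (C * (K * (2 * delta) * (2 * nmax nc ns (x - y))))).
    apply: ler_wpM2l => //; apply: ler_wpM2l => //.
    by apply: mulr_ge0 => //; exact: ltW.
  have := ler_wpM2r hn delta3; lra.
have holoF z w : holo z w -> (forall t, cabs t = 1 -> nmax nc ns (z t) <= delta) ->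
    holo (fun t => F (z t)) (T w).
  move=> zw zd; apply: (exp_holo _ _ _ _ _ HF) zw _ => t /zd /small zt; lra.
have Fc (x : nat -> B) : (forall n, nmax nc ns (x n) <= delta) ->
    exists y, forall e, 0 < e -> G [set n | rnorm (F (x n) - y) < e].
  move=> xd; apply: (compact_ultralimit_ball _ _ _ _ _ HF F_compact) => n.
  by have := small _ (xd n); lra.
have Fdiff (e : R) : 0 < e -> exists2 d, 0 < d &
    forall x, rnorm x <= d -> rnorm (F x - T x) <= e * rnorm x.
  move=> e0; have K1 : 0 < K + 1 by lra.
  exists (Num.min rho (e / (K + 1))); first by rewrite lt_min rho0 divr_gt0.
  move=> x; rewrite le_min => /andP[xr xe].
  apply: le_trans (exp_quad _ _ _ _ _ HF _ xr) _; rewrite expr2 mulrA ler_wpM2r ?rnorm_ge0 //.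
  apply: (@le_trans _ _ ((K + 1) * rnorm x)); first by rewrite ler_wpM2r ?rnorm_ge0 // lerDl.
  by rewrite mulrC -ler_pdivlMr.
have [x [xd xlow]] := slow_orbit T Q S r HS K K0 TK kappa rE nc ns Hnc Hns ncQ nc_ge ncS ncT
  nsP ns_ge nsT F delta delta0 F0 Flip holoF v lam Tv lam1 Qv v0 Goo Fc Fdiff.
exists x; split.
- move=> n; have xn := small _ (xd n); split.
    by apply: (exp_dom _ _ _ _ _ HF); lra.
  by apply: hd; rewrite sub0r rnormN; lra.
- move=> n; rewrite -rnorm_gt0; have [||c c0 hc] := xlow (1 / 4); [lra|lra|].
  apply: (lt_le_trans _ (hc n)); apply: mulr_gt0 => //; apply: exprn_gt0; lra.
- apply: (log_growth_cvg _ (2 * delta)) => // n; exact: small.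
Qed.
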